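(* Let $p\in\mathscr P^{\log}(\mathbb C)$ and $p'(z)=\frac{p(z)}{p(z)-1}$. For $h\in\mathcal F^{p'(\cdot)}$ define $\Lambda_h(f)=\langle f,h\rangle=\frac{2}{\pi}\int_{\mathbb C}f(z)\overline{h(z)}e^{-2|z|^2}\,dA(z)$ for $f\in\mathcal F^{p(\cdot)}$. Then each $\Lambda_h$ is a bounded linear functional on $\mathcal F^{p(\cdot)}$, every bounded linear functional $\Lambda$ on $\mathcal F^{p(\cdot)}$ equals $\Lambda_h$ for some $h\in\mathcal F^{p'(\cdot)}$, and $\|\Lambda_h\|\asymp\|h\|_{\mathcal F^{p'(\cdot)}}$ with constants independent of $h$. Thus the dual of $\mathcal F^{p(\cdot)}$ is isomorphic to $\mathcal F^{p'(\cdot)}$.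
   Context: $A$ denotes Lebesgue area measure on $\mathbb C$. A variable exponent is a measurable function $p:\mathbb C\to[1,\infty)$; $p^+=\operatorname{ess\,sup}_{\mathbb C}p$, $p^-=\operatorname{ess\,inf}_{\mathbb C}p$. $\mathscr P^{\log}(\mathbb C)$ is the set of variable exponents $p$ with $1<p^-\le p^+<\infty$ that are globally log-H\''older continuous: there is $C_{\log}>0$ with $|p(z)-p(w)|\le C_{\log}/\log(1/|z-w|)$ whenever $|z-w|<1/2$, and there exist $p_\infty\in[1,\infty)$ and $C>0$ with $|p(z)-p_\infty|\le C/\log(e+|z|)$ for all $z$. For a measurable exponent $q:\mathbb C\to[1,\infty)$, $\mathcal L^{q(\cdot)}$ is the space of measurable $f$ with $\int_{\mathbb C}(\lambda|f(z)|)^{q(z)}e^{-q(z)|z|^2}\,dA(z)<\infty$ for some $\lambda>0$, normed by $\|f\|_{\mathcal L^{q(\cdot)}}=\inf\{\lambda>0:\int_{\mathbb C}(|f(z)|/\lambda)^{q(z)}e^{-q(z)|z|^2}\,dA(z)\le1\}$, and the variable exponent Fock space $\mathcal F^{q(\cdot)}$ is the set of entire functions in $\mathcal L^{q(\cdot)}$ with the same norm. $a\asymp b$ means $a\le Cb$ and $b\le Ca$ for a constant $C>0$. *)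

(* Defs.v *)
From HB Require Import structures.
From mathcomp Require Import all_boot all_order all_algebra.
From mathcomp Require Import all_classical all_reals all_analysis.
From mathcomp Require Import complex ess_sup_inf.
Import Order.TTheory GRing.Theory Num.Theory.
Import numFieldNormedType.Exports.

Set Implicit Arguments.
Unset Strict Implicit.
Unset Printing Implicit Defensive.

Local Open Scope classical_set_scope.
Local Open Scope ring_scope.

Section FockDefs.
Context {R : realType}.

Definition cplx (xy : R * R) : R[i] := (xy.1 +i* xy.2)%C.

(* Lebesgue measure on R^2 = Lebesgue area measure on C (via cplx) *)
Definition areaM := (@lebesgue_measure R \x @lebesgue_measure R)%E.

Definition cabs (z : R[i]) : R := Normc.normc z.

Definition area_int (F : R[i] -> \bar R) : \bar R :=
  (\int[areaM]_(xy in setT) F (cplx xy))%E.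

Definition rmeasurable (g : R[i] -> R) : Prop := measurable_fun setT (g \o cplx).

Definition cmeasurable (f : R[i] -> R[i]) : Prop :=
  rmeasurable (fun z => complex.Re (f z)) /\ rmeasurable (fun z => complex.Im (f z)).

Definition cintegrable (F : R[i] -> R[i]) : Prop :=
  areaM.-integrable setT (fun xy => (complex.Re (F (cplx xy)))%:E) /\
  areaM.-integrable setT (fun xy => (complex.Im (F (cplx xy)))%:E).

Definition cint (F : R[i] -> R[i]) : R[i] :=
  ((Rintegral areaM setT (fun xy => complex.Re (F (cplx xy))))
   +i* (Rintegral areaM setT (fun xy => complex.Im (F (cplx xy)))))%C.

Definition var_exponent (p : R[i] -> R) : Prop :=
  rmeasurable p /\ (forall z, 1 <= p z).

Definition p_plus (p : R[i] -> R) : \bar R := ess_sup areaM (fun xy => (p (cplx xy))%:E).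
Definition p_minus (p : R[i] -> R) : \bar R := ess_inf areaM (fun xy => (p (cplx xy))%:E).

Definition Plog (p : R[i] -> R) : Prop :=
  var_exponent p /\
  (1 < p_minus p)%E /\ (p_plus p < +oo)%E /\
  (exists Clog : R, 0 < Clog /\
     forall z w : R[i], 0 < cabs (z - w) < 2^-1 ->
       `|p z - p w| <= Clog / ln ((cabs (z - w))^-1)) /\
  (exists pinf : R, 1 <= pinf /\ exists C : R, 0 < C /\
     forall z : R[i], `|p z - pinf| <= C / ln (expR 1 + cabs z)).

Definition conj_exponent (p : R[i] -> R) : R[i] -> R := fun z => p z / (p z - 1).

Definition modular (q : R[i] -> R) (f : R[i] -> R[i]) : \bar R :=
  area_int (fun z => ((cabs (f z)) `^ (q z) * expR (- (q z * cabs z ^+ 2)))%:E).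

Definition inL (q : R[i] -> R) (f : R[i] -> R[i]) : Prop :=
  cmeasurable f /\
  exists lam : R, 0 < lam /\ (modular q (fun z => (lam%:C%C * f z)%R) < +oo)%E.

Definition Lnorm_var (q : R[i] -> R) (f : R[i] -> R[i]) : R :=
  inf [set lam : R | 0 < lam /\ (modular q (fun z => (f z / lam%:C%C)%R) <= 1)%E].

Definition entire (f : R[i] -> R[i]) : Prop :=
  forall z : R[i], derivable (f : R[i]^o -> R[i]^o) z 1.

Definition inFock (q : R[i] -> R) (f : R[i] -> R[i]) : Prop := entire f /\ inL q f.

Definition pair_integrand (f h : R[i] -> R[i]) : R[i] -> R[i] :=
  fun z => f z * conjc (h z) * (expR (- (2 * cabs z ^+ 2)))%:C%C.

Definition Lambda (h : R[i] -> R[i]) (f : R[i] -> R[i]) : R[i] :=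
  (2 / pi)%:C%C * cint (pair_integrand f h).

Definition bounded_linear_functional (P : (R[i] -> R[i]) -> Prop)
  (N : (R[i] -> R[i]) -> R) (L : (R[i] -> R[i]) -> R[i]) : Prop :=
  (forall f g, P f -> P g -> L (fun z => f z + g z) = L f + L g) /\
  (forall (a : R[i]) f, P f -> L (fun z => a * f z) = a * L f) /\
  (exists C : R, forall f, P f -> cabs (L f) <= C * N f).

Definition op_norm (P : (R[i] -> R[i]) -> Prop)
  (N : (R[i] -> R[i]) -> R) (L : (R[i] -> R[i]) -> R[i]) : R :=
  sup [set cabs (L f) | f in [set f | P f /\ N f <= 1]].

End FockDefs.

(* Main.v *)
Require Import Defs.
From HB Require Import structures.
From mathcomp Require Import all_boot all_order all_algebra.
From mathcomp Require Import all_classical all_reals all_analysis.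
From mathcomp Require Import complex measurable_realfun ess_sup_inf ring lra.
Import Order.TTheory GRing.Theory Num.Theory.
Import numFieldNormedType.Exports.

(** Write K_w(z) = e^(2 z conj w) for the reproducing kernel and P g(z) =
    Lambda_{K_z}(g) for the Fock projection.  After multiplication by
    e^(-|z|^2), P is dominated by convolution with a Gaussian, and decay of
    p - p_infty at infinity makes this convolution bounded on the variable
    Lebesgue space; so P maps L^{p(.)} to F^{p(.)}, and it fixes F^{p(.)} by the
    mean value property.

    No Hahn-Banach extension is needed to represent a functional L: put
    h(w) = conj (L(K_w)), an entire function.  For g bounded with bounded
    support, L(P g) = Lambda_h(g), because the difference of the two sides,
    applied to g restricted to rectangles, is additive under bisection and
    o(diam^2) on small rectangles.  Testing this identity on
    g = (h/|h|) e^(|z|^2) u^(p'-1), u = |h| e^(-|z|^2)/lambda, cut off to large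
    squares, gives h in F^{p'(.)} with norm at most a multiple of that of L, and
    approximating f = P f by projections of truncations gives L = Lambda_h.
    Since h is recovered from Lambda_h by Lambda_h(K_w) = conj (h w), the same
    estimate is the lower bound for the norm of Lambda_h; the upper bound is
    Hoelder's inequality. *)

(** Completing the square gives e^(-|z|^2) |K_z(w)| e^(-|w|^2) = e^(-|z-w|^2), which is where the
    Gaussian comes from. Being bounded as well as integrable, it tames large values of a function
    outright; the variation of the exponent is felt at small values, where [log_decay] lets p be
    replaced by p_infty at the cost of an integrable weight. Local log-Hoelder continuity enters
    through continuity of p, which turns the almost everywhere bound p^- > 1 into a pointwise one
    and so controls p'. The norm is an infimum that is not shown to be attained, so estimates are
    made on modulars at scales strictly above the norm and passed to the limit. The identity L(P g)
    = Lambda_h(g) amounts to moving L inside a vector-valued integral of kernels. On a rectangle of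
    size s, freezing the kernel at a point costs O(s) and g has mass O(s^2); additivity under
    bisection forces the defect O(s^3) to be 0. The same principle proves Goursat's theorem. *)

Set Implicit Arguments.
Unset Strict Implicit.
Unset Printing Implicit Defensive.

Local Open Scope classical_set_scope.
Local Open Scope ring_scope.

(** * Complex numbers and entire functions *)

Section ComplexBasics.
Context {R : realType}.
Local Notation C := R[i].
Local Notation Re := complex.Re.
Local Notation Im := complex.Im.
Implicit Types (z w : C) (f g : C -> C).

Lemma cabs_norm z : (cabs z)%:C%C = `|z|. Proof. by case: z. Qed.

Lemma cabs_ge0 z : 0 <= cabs z.
Proof. by case: z => a b; rewrite /cabs/= sqrtr_ge0. Qed.

Lemma cabs0 : cabs (0 : C) = 0. Proof. exact: Normc.normc0. Qed.

Lemma cabs_eq0 z : cabs z = 0 -> z = 0. Proof. exact: Normc.eq0_normc. Qed.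

Lemma cabs_gt0 z : z != 0 -> 0 < cabs z.
Proof.
by move=> z0; rewrite lt0r cabs_ge0 andbT; apply: contraNneq z0 => /cabs_eq0 ->.
Qed.

Lemma cabsM z w : cabs (z * w) = cabs z * cabs w. Proof. exact: Normc.normcM. Qed.

Lemma cabsD z w : cabs (z + w) <= cabs z + cabs w.
Proof. exact: le_normcD. Qed.

Lemma cabsN z : cabs (- z) = cabs z. Proof. exact: normcN. Qed.

Lemma cabsB z w : cabs (z - w) <= cabs z + cabs w.
Proof. by rewrite -(cabsN w) cabsD. Qed.

Lemma cabs_distC z w : cabs (z - w) = cabs (w - z).
Proof. by rewrite -cabsN opprB. Qed.

Lemma cabs_conj z : cabs (conjc z) = cabs z.
Proof. by case: z => a b; rewrite /cabs/= sqrrN. Qed.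

Lemma cabs_real (x : R) : cabs x%:C%C = `|x|.
Proof. by rewrite /cabs/= expr0n/= addr0 sqrtr_sqr. Qed.

Lemma cabsV z : cabs z^-1 = (cabs z)^-1. Proof. exact: Normc.normcV. Qed.

Lemma cabs_i : cabs ('i%C : C) = 1.
Proof. by rewrite /cabs/= expr0n/= add0r expr1n sqrtr1. Qed.

Lemma cabs_sqr z : cabs z ^+ 2 = Re z ^+ 2 + Im z ^+ 2.
Proof. by case: z => a b; rewrite /cabs/= sqr_sqrtr// addr_ge0 ?sqr_ge0. Qed.

Lemma Re_le z : `|Re z| <= cabs z.
Proof. by rewrite -lecR cabs_norm normc_ge_Re. Qed.

Lemma Im_le z : `|Im z| <= cabs z.
Proof.
rewrite -(@ler_pXn2r _ 2)// ?nnegrE ?cabs_ge0// cabs_sqr.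
by rewrite -normrX ger0_norm ?sqr_ge0// lerDr sqr_ge0.
Qed.

Lemma cabs_le z : cabs z <= `|Re z| + `|Im z|.
Proof.
rewrite -(@ler_pXn2r _ 2)// ?nnegrE ?cabs_ge0 ?addr_ge0// cabs_sqr sqrrD.
by rewrite !real_normK ?num_real// lerD2r lerDl mulrn_wge0 ?mulr_ge0.
Qed.

Lemma cabs_eps_eq0 z : (forall e : R, 0 < e -> cabs z <= e) -> z = 0.
Proof.
move=> H; apply: cabs_eq0; apply/eqP; rewrite eq_le cabs_ge0 andbT.
by apply/ler_addgt0Pr => e e0; rewrite add0r H.
Qed.

Lemma mulC_conj z : z * conjc z = (cabs z ^+ 2)%:C%C.
Proof. by rewrite rmorphXn/= cabs_norm sqr_normc. Qed.

Lemma ReD z w : Re (z + w) = Re z + Re w. Proof. by case: z w => [? ?] []. Qed.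
Lemma ImD z w : Im (z + w) = Im z + Im w. Proof. by case: z w => [? ?] []. Qed.
Lemma ReN z : Re (- z) = - Re z. Proof. by case: z. Qed.
Lemma ImN z : Im (- z) = - Im z. Proof. by case: z. Qed.
Lemma ReM z w : Re (z * w) = Re z * Re w - Im z * Im w.
Proof. by case: z w => [? ?] []. Qed.
Lemma ImM z w : Im (z * w) = Re z * Im w + Im z * Re w.
Proof. by case: z w => [? ?] []. Qed.
Lemma Re_conj z : Re (conjc z) = Re z. Proof. by case: z. Qed.
Lemma Im_conj z : Im (conjc z) = - Im z. Proof. by case: z. Qed.
Definition cE := (ReD, ImD, ReN, ImN, ReM, ImM, Re_conj, Im_conj).

Lemma complex_ext z w : Re z = Re w -> Im z = Im w -> z = w.
Proof. by case: z w => [? ?] [? ?] /= -> ->. Qed.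

Lemma cplxK z : cplx (Re z, Im z) = z. Proof. by case: z. Qed.

(** Differentiability with an explicit remainder in the real-valued [cabs], the form in which Taylor
    estimates arrive; the norm of [R[i]] takes its values in [R[i]] itself. *)
Definition has_cderiv f z d := forall e : R, 0 < e ->
  exists2 r : R, 0 < r & forall h : C, cabs h < r ->
    cabs (f (z + h) - f z - h * d) <= e * cabs h.

Definition cdiff f := forall z, exists d, has_cderiv f z d.

Lemma entireP f : entire f <-> cdiff f.
Proof.
split=> [ef z|df z].
- have /cvg_ex[/= d /cvgrPdist_le fd] := ef z; exists d => e e0.
  have /fd : 0 < e%:C%C :> C by rewrite ltcR.
  rewrite /dnbhs near_withinE => /nbhs_ballP[/= r r0 H].
  have rr : r = (Re r)%:C%C by rewrite RRe_real// gtr0_real.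
  exists (Re r); first by rewrite -ltcR -rr.
  move=> h hr; have [->|h0] := eqVneq h 0.
    by rewrite addr0 subrr mul0r subr0 cabs0 mulr0.
  have := H h; rewrite /ball/= sub0r normrN -cabs_norm rr ltcR => /(_ hr h0).
  rewrite -cabs_norm lecR -[_%VF *: 1]/(h * 1) mulr1 -[_ *: _]/(_ * _) => Hh.
  have -> : f (z + h) - f z - h * d = - h * (d - h^-1 * (f (h + z) - f z)).
    by rewrite mulNr mulrBr mulVKf// opprB (addrC h z).
  by rewrite cabsM cabsN mulrC ler_wpM2r ?cabs_ge0.
- have [d fd] := df z.
  apply/cvg_ex; exists d; apply/cvgrPdist_le => e e0.
  have ee : e = (Re e)%:C%C by rewrite RRe_real// gtr0_real.
  have [r r0 H] := fd (Re e) ltac:(by rewrite -ltcR -ee).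
  rewrite /dnbhs near_withinE; apply/nbhs_ballP; exists r%:C%C => /=.
    by rewrite ltcR.
  move=> h; rewrite /ball/= sub0r normrN -cabs_norm ltcR => /H + h0.
  rewrite -cabs_norm ee lecR -[_%VF *: 1]/(h * 1) mulr1 -[_ *: _]/(_ * _).
  have -> : f (z + h) - f z - h * d = - h * (d - h^-1 * (f (h + z) - f z)).
    by rewrite mulNr mulrBr mulVKf// opprB (addrC h z).
  by rewrite cabsM cabsN mulrC ler_pM2r// cabs_gt0.
Qed.

End ComplexBasics.

(** Locked so that simplification keeps [cexp] folded; it is opened through [cexpE]. *)
HB.lock Definition cexp {R : realType} (z : R[i]) : R[i] :=
  ((expR (complex.Re z))%:C * (cos (complex.Im z) +i* sin (complex.Im z)))%C.

(** * The complex exponential and its Taylor remainders *)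

Section ComplexExp.
Context {R : realType}.
Local Notation C := R[i].
Local Notation Re := complex.Re.
Local Notation Im := complex.Im.
Implicit Types (z w : C) (f g : C -> C).

Lemma cexpE z : cexp z = ((expR (Re z))%:C * (cos (Im z) +i* sin (Im z)))%C.
Proof. by rewrite unlock. Qed.

Lemma cexpD z w : cexp (z + w) = cexp z * cexp w.
Proof.
rewrite !cexpE ReD ImD expRD cosD sinD.
by apply: complex_ext; rewrite !cE/=; ring.
Qed.

Lemma cabs_cexp z : cabs (cexp z) = expR (Re z).
Proof.
rewrite !cexpE cabsM cabs_real ger0_norm ?expR_ge0//.
by rewrite [X in _ * X](_ : _ = 1) ?mulr1// /cabs/= cos2Dsin2 sqrtr1.
Qed.

Lemma cexp0 : cexp (0 : C) = 1.
Proof. by rewrite cexpE/= expR0 cos0 sin0 mul1r. Qed.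

Lemma cexp_neq0 z : cexp z != 0.
Proof.
apply/eqP => e; have := cabs_cexp z; rewrite e cabs0 => /eqP.
by rewrite eq_sym expR_eq0.
Qed.

Lemma cexp_conj z : conjc (cexp z) = cexp (conjc z).
Proof.
rewrite !cexpE Re_conj Im_conj cosN sinN.
by apply: complex_ext; rewrite !cE/=; ring.
Qed.

Lemma cexp_real (x : R) : cexp x%:C%C = (expR x)%:C%C.
Proof. by rewrite cexpE/= cos0 sin0 mulr1. Qed.

Lemma entire_comp f g : entire f -> entire g -> entire (f \o g).
Proof.
move=> ef eg z.
have /derivable1_diffP dg := eg z; have /derivable1_diffP df := ef (g z).
by apply/derivable1_diffP; exact: (differentiable_comp dg df).
Qed.

Lemma entireM f g : entire f -> entire g -> entire (fun z => f z * g z).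
Proof. by move=> ef eg z; apply: derivableM; [exact: ef|exact: eg]. Qed.

Lemma entireD f g : entire f -> entire g -> entire (fun z => f z + g z).
Proof. by move=> ef eg z; apply: derivableD; [exact: ef|exact: eg]. Qed.

Lemma entire_cst (c : C) : entire (fun=> c).
Proof. by move=> z; exact: derivable_cst. Qed.

Lemma entire_id : entire (fun z : C => z).
Proof. by move=> z; exact: derivable_id. Qed.

Lemma entireZ (c : C) f : entire f -> entire (fun z => c * f z).
Proof. by move=> ef z; apply: derivableM; [exact: derivable_cst|exact: ef]. Qed.

Lemma entireZr (c : C) f : entire f -> entire (fun z => f z * c).
Proof. by move=> ef z; apply: derivableM; [exact: ef|exact: derivable_cst]. Qed.

Lemma le_sin (y : R) : `|sin y| <= `|y|.
Proof.
wlog y0 : y / 0 <= y.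
  move=> H; have [|/ltW y0] := leP 0 y; first exact: H.
  by rewrite -normrN -sinN -[leRHS]normrN H// oppr_ge0.
have [c _] := @MVT_segment R sin cos 0 y y0 (fun x _ => is_derive_sin x)
  (continuous_subspaceT (@continuous_sin R)).
rewrite sin0 !subr0 => ->; rewrite normrM ler_piMl//; exact: cos_max.
Qed.

Lemma le_1Bcos (y : R) : `|cos y - 1| <= y ^+ 2.
Proof.
have -> : y = (y / 2) *+ 2 by rewrite mulr2n; field.
rewrite cos_mulr2n cos2sin2; set t := y / 2.
have -> : (1 - sin t ^+ 2) *+ 2 - 1 - 1 = - (sin t ^+ 2 *+ 2) by ring.
rewrite normrN -mulr_natl normrM normrX normr_nat.
have -> : (t *+ 2) ^+ 2 = 2 * (2 * t ^+ 2) by rewrite -mulr_natl; ring.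
rewrite ler_pM2l//; apply: (@le_trans _ _ (`|t| ^+ 2)).
  by rewrite lerXn2r ?nnegrE// le_sin.
by rewrite real_normK ?num_real// ler_peMl ?sqr_ge0// ler1n.
Qed.

Lemma le_cosB1 (y : R) : `|cos y - 1| <= `|y|.
Proof.
wlog y0 : y / 0 <= y.
  move=> H; have [|/ltW y0] := leP 0 y; first exact: H.
  by rewrite -cosN -[leRHS]normrN H// oppr_ge0.
have [c _] := @MVT_segment R cos (fun x => - sin x) 0 y y0 (fun x _ => is_derive_cos x)
  (continuous_subspaceT (@continuous_cos R)).
rewrite cos0 !subr0 => ->; rewrite normrM normrN ler_piMl//; exact: sin_max.
Qed.

Lemma le_sinB (y : R) : `|sin y - y| <= y ^+ 2.
Proof.
wlog y0 : y / 0 <= y.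
  move=> H; have [|/ltW y0] := leP 0 y; first exact: H.
  by rewrite -normrN -sqrrN opprB addrC -sinN -[X in sin _ + X]opprK H// oppr_ge0.
have dF (x : R) : is_derive x (1 : R) (fun y : R => sin y - y) (cos x - 1).
  exact: is_deriveB.
have [c] := @MVT_segment R (fun y => sin y - y) (fun x => cos x - 1) 0 y y0 (fun x _ => dF x)
  (continuous_subspaceT (fun x => cvgB (@continuous_sin R x) (@cvg_id _ _))).
rewrite in_itv/= sin0 !subr0 => /andP[c0 cy] ->; rewrite normrM (ger0_norm y0) expr2.
by rewrite ler_wpM2r// (le_trans (le_cosB1 c))// ger0_norm.
Qed.

Lemma le_expRB1 (x : R) : `|expR x - 1| <= `|x| * expR `|x|.
Proof.
have := expR_ge1Dx x; have := expR_ge1Dx (- x); rewrite expRN => h1 h2.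
have e0 := expR_gt0 x.
have h3 : expR x - 1 <= x * expR x.
  have : (1 - x) * expR x <= (expR x)^-1 * expR x by rewrite ler_wpM2r// ltW.
  by rewrite mulVf ?gt_eqF//; lra.
have [x0|x0] := leP 0 x.
  by rewrite (ger0_norm x0) ger0_norm// subr_ge0 -expR0 ler_expR.
rewrite (ltr0_norm x0) ltr0_norm; last by rewrite subr_lt0 expR_lt1.
apply: (@le_trans _ _ (- x)); first lra.
by rewrite ler_peMr ?oppr_ge0 1?ltW// expR_gt1 oppr_gt0.
Qed.

Lemma le_expRB1B (x : R) : `|expR x - 1 - x| <= x ^+ 2 * expR `|x|.
Proof.
have := expR_ge1Dx x; have := expR_ge1Dx (- x); rewrite expRN => h1 h2.
have e0 := expR_gt0 x.
have h3 : expR x - 1 <= x * expR x.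
  have : (1 - x) * expR x <= (expR x)^-1 * expR x by rewrite ler_wpM2r// ltW.
  by rewrite mulVf ?gt_eqF//; lra.
rewrite ger0_norm; last lra.
apply: (@le_trans _ _ (x * (expR x - 1))); first lra.
apply: (le_trans (ler_norm _)); rewrite normrM.
rewrite -(real_normK (num_real x)) expr2 -mulrA ler_wpM2l//; exact: le_expRB1.
Qed.

(** A global bound with the growth e^|z| kept explicit, since z will be a product of a small
    parameter and an unbounded variable. Of the three equal terms, two bound the real part and one
    the imaginary part. *)
Lemma cexp_taylor1 z : cabs (cexp z - 1) <= 3 * (cabs z * expR (cabs z)).
Proof.
apply: (le_trans (cabs_le _)).
have hx := Re_le z; have hy := Im_le z.
have ex : expR (Re z) <= expR (cabs z) by rewrite ler_expR (le_trans (ler_norm _)).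
have e1 : 1 <= expR (cabs z) by rewrite -expR0 ler_expR cabs_ge0.
have c0 := cabs_ge0 z.
rewrite cexpE !cE/= !mul0r subr0 addr0 oppr0 addr0.
have -> : 3 * (cabs z * expR (cabs z)) =
  (cabs z * expR (cabs z) + cabs z * expR (cabs z)) + cabs z * expR (cabs z) by ring.
apply: lerD.
  have -> : expR (Re z) * cos (Im z) - 1 =
    (expR (Re z) - 1) + expR (Re z) * (cos (Im z) - 1) by ring.
  rewrite (le_trans (ler_normD _ _))// lerD//.
    rewrite (le_trans (le_expRB1 _))// ler_pM ?expR_ge0 ?ler_expR//.
  rewrite normrM mulrC ler_pM//; last by rewrite ger0_norm ?expR_ge0.
  exact: le_trans (le_cosB1 _) _.
rewrite normrM mulrC ler_pM//; last by rewrite ger0_norm ?expR_ge0.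
exact: le_trans (le_sin _) _.
Qed.

(** The second-order analogue: two of the four equal terms bound the real part and two the imaginary
    part. *)
Lemma cexp_taylor2 z : cabs (cexp z - 1 - z) <= 4 * (cabs z ^+ 2 * expR (cabs z)).
Proof.
apply: (le_trans (cabs_le _)).
have hx := Re_le z; have hy := Im_le z.
have ex : expR (Re z) <= expR (cabs z) by rewrite ler_expR (le_trans (ler_norm _)).
have e1 : 1 <= expR (cabs z) by rewrite -expR0 ler_expR cabs_ge0.
have c0 := cabs_ge0 z.
have hx2 : Re z ^+ 2 <= cabs z ^+ 2 by rewrite cabs_sqr lerDl sqr_ge0.
have hy2 : Im z ^+ 2 <= cabs z ^+ 2 by rewrite cabs_sqr lerDr sqr_ge0.
rewrite cexpE !cE/= !mul0r subr0 addr0 oppr0 addr0.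
set T := cabs z ^+ 2 * expR (cabs z).
have -> : 4 * T = (T + T) + (T + T) by ring.
apply: lerD.
  have -> : expR (Re z) * cos (Im z) - 1 - Re z =
    (expR (Re z) - 1 - Re z) + expR (Re z) * (cos (Im z) - 1) by ring.
  rewrite (le_trans (ler_normD _ _))// lerD//.
    by rewrite (le_trans (le_expRB1B _))// ler_pM ?expR_ge0 ?sqr_ge0 ?ler_expR.
  rewrite normrM mulrC ler_pM//; last by rewrite ger0_norm ?expR_ge0.
  exact: le_trans (le_1Bcos _) _.
have -> : expR (Re z) * sin (Im z) - Im z =
    (expR (Re z) - 1) * sin (Im z) + (sin (Im z) - Im z) by ring.
rewrite (le_trans (ler_normD _ _))// lerD//.
  rewrite normrM /T expr2 mulrAC ler_pM//.
    by rewrite (le_trans (le_expRB1 _))// ler_pM ?expR_ge0 ?ler_expR.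
  exact: le_trans (le_sin _) _.
apply: (le_trans (le_sinB _)); apply: (le_trans hy2).
by rewrite ler_peMr ?sqr_ge0.
Qed.

Lemma entire_cexp : entire (@cexp R).
Proof.
apply/entireP => z; exists (cexp z) => e e0.
(* By [cexpD] the remainder at z is e^z times the remainder at 0; [expR 1] bounds e^|h| for |h| <
   1. *)
pose K := cabs (cexp z) * (4 * expR 1).
have K0 : 0 < K by rewrite !mulr_gt0// ?expR_gt0 ?cabs_gt0 ?cexp_neq0.
exists (Num.min 1 (e / K)); first by rewrite lt_min ltr01 divr_gt0.
move=> h; rewrite lt_min => /andP[h1 hK].
have -> : cexp (z + h) - cexp z - h * cexp z = cexp z * (cexp h - 1 - h).
  by rewrite cexpD; ring.
rewrite cabsM; apply: (@le_trans _ _ (K * cabs h ^+ 2)).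
  rewrite /K -mulrA ler_wpM2l ?cabs_ge0// (le_trans (cexp_taylor2 _))//.
  by rewrite -mulrA (mulrC (expR 1)) ler_wpM2l// ler_wpM2l ?sqr_ge0// ler_expR ltW.
by rewrite expr2 mulrA ler_wpM2r ?cabs_ge0// mulrC -ler_pdivlMr// ltW.
Qed.

Lemma entire_continuous f : entire f -> forall z (e : R), 0 < e ->
  exists2 r : R, 0 < r & forall h : C, cabs h < r -> cabs (f (z + h) - f z) <= e.
Proof.
move=> /entireP/(_ _)/cid-/all_sig[d fd] z e e0.
have [r r0 H] := fd z 1 ltr01.
have K0 : 0 < 1 + cabs (d z) by rewrite ltr_pwDl ?cabs_ge0.
exists (Num.min r (e / (1 + cabs (d z)))); first by rewrite lt_min r0 divr_gt0.
move=> h; rewrite lt_min => /andP[hr]; rewrite ltr_pdivlMr// => hd.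
have -> : f (z + h) - f z = (f (z + h) - f z - h * d z) + h * d z by ring.
rewrite (le_trans (cabsD _ _))// cabsM.
by apply: le_trans (ltW hd); rewrite mulrDr mulr1 lerD2r -[leRHS]mul1r H.
Qed.

End ComplexExp.

Notation R2 R := (measurableTypeR R * measurableTypeR R)%type.

(** A copy of [areaM] carrying measure and sigma-finiteness instances, so that Tonelli's theorem
    applies to pairs of points of the plane. *)
Definition area {R : realType} : set (R2 R) -> \bar R := areaM.
HB.instance Definition _ (R : realType) := Measure.on (@area R).

Lemma area_sigma_finite (R : realType) : sigma_finite setT (@area R).
Proof.
have /sigma_finiteP[F [TF ndF Foo]] := sigma_finiteT (@lebesgue_measure R).
exists (fun n => F n `*` F n).
  rewrite -setXTT TF predeqE => -[x y]; split.
    move=> [/= [n _ Fnx] [k _ Gky]]; exists (maxn n k) => //; split.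
    - by move: x Fnx; exact/subsetPset/ndF/leq_maxl.
    - by move: y Gky; exact/subsetPset/ndF/leq_maxr.
  by move=> [n _ []/= ? ?]; split; exists n.
move=> k; have [mk fk] := Foo k.
split; first exact: measurableX.
rewrite /area /areaM product_measure1E// lte_mul_pinfty// ge0_fin_numE//.
Qed.
HB.instance Definition _ (R : realType) :=
  Measure_isSigmaFinite.Build _ _ _ (@area R) (@area_sigma_finite R).

(** * Area measure *)

Section Area.
Context {R : realType}.
Local Notation C := R[i].
Local Notation leb := (@lebesgue_measure R).
Local Notation Re := complex.Re.
Local Notation Im := complex.Im.

Section translation.
Variable a : R.
Let phi (x : measurableTypeR R) : measurableTypeR R := x + a.
Let mphi : measurable_fun setT phi.
Proof. by apply: measurable_funD => //; exact: measurable_id. Qed.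

(** The pushforward of Lebesgue measure under a translation agrees with it on half-open intervals,
    and these determine the measure. *)
Lemma ge0_lebesgue_translate (f : R -> \bar R) : measurable_fun setT f ->
  (forall x, 0 <= f x)%E -> (\int[leb]_x f (x + a)%R = \int[leb]_x f x)%E.
Proof.
move=> mf f0.
pose nu' : {measure set (measurableTypeR R) -> \bar R} := pushforward leb phi.
pose nu := nu' mphi.
have H : forall A, measurable A -> leb A = nu A.
  apply: lebesgue_measure_unique => X [[u v] _ <-].
  rewrite lebesgue_measure_itv/= /nu/= /pushforward.
  have -> : phi @^-1` `]u, v] = `]u - a, v - a]%classic.
    by apply/seteqP; split => x /=; rewrite !in_itv/= /phi ltrBlDr lerBrDr.
  by rewrite lebesgue_measure_itv/= !lte_fin ltrD2r -!EFinB opprB addrA subrK.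
rewrite [RHS](eq_measure_integral nu); last by move=> A mA _; exact: H.
rewrite ge0_integral_pushforward//.
Qed.

End translation.

(** A shear acts on each horizontal line as a translation, so Tonelli reduces it to one dimension; t
    = 0 gives translations of the plane. *)
Lemma ge0_area_shear1 (t a : R) (f : R2 R -> \bar R) : measurable_fun setT f ->
  (forall x, 0 <= f x)%E ->
  (\int[area]_x f (x.1 + t * x.2 + a, x.2)%R = \int[area]_x f x)%E.
Proof.
move=> mf f0.
have mg : measurable_fun setT (fun x : R2 R => f (x.1 + t * x.2 + a, x.2)).
  apply: measurableT_comp => //; apply: measurable_fun_pair => //=.
  apply: measurable_funD => //; apply: measurable_funD => //.
  exact: measurable_funM.
rewrite /area /areaM fubini_tonelli2// [RHS]fubini_tonelli2//.
apply: eq_integral => y _; rewrite /fubini_G/=.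
under eq_integral do rewrite -addrA.
rewrite (@ge0_lebesgue_translate (t * y + a) (fun x => f (x, y)))//.
apply: measurableT_comp => //; exact: measurable_fun_pair.
Qed.

Lemma ge0_area_shear2 (t a : R) (f : R2 R -> \bar R) : measurable_fun setT f ->
  (forall x, 0 <= f x)%E ->
  (\int[area]_x f (x.1, x.2 + t * x.1 + a)%R = \int[area]_x f x)%E.
Proof.
move=> mf f0.
have mg : measurable_fun setT (fun x : R2 R => f (x.1, x.2 + t * x.1 + a)).
  apply: measurableT_comp => //; apply: measurable_fun_pair => //=.
  apply: measurable_funD => //; apply: measurable_funD => //.
  exact: measurable_funM.
rewrite /area /areaM fubini_tonelli1// [RHS]fubini_tonelli1//.
apply: eq_integral => y _; rewrite /fubini_F/=.
under eq_integral do rewrite -addrA.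
rewrite (@ge0_lebesgue_translate (t * y + a) (fun x => f (y, x)))//.
apply: measurableT_comp => //; exact: measurable_fun_pair.
Qed.

Definition emeas (F : C -> \bar R) := measurable_fun setT (F \o cplx).

Lemma area_intE (F : C -> \bar R) : area_int F = (\int[area]_x F (cplx x))%E.
Proof. by []. Qed.

Lemma ge0_area_int_translate (c : C) (F : C -> \bar R) : emeas F ->
  (forall z, 0 <= F z)%E -> area_int (fun z => F (z + c)) = area_int F.
Proof.
move=> mF F0; rewrite !area_intE.
pose F1 (x : R2 R) := F (cplx (x.1, x.2 + 0 * x.1 + Im c)).
have mF1 : measurable_fun setT F1.
  apply: (measurableT_comp mF); apply: measurable_fun_pair => //=.
  by do 2 apply: measurable_funD => //; exact: measurable_funM.
rewrite -[RHS](@ge0_area_shear2 0 (Im c) (F \o cplx))//; last by move=> x; exact: F0.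
rewrite -[RHS](@ge0_area_shear1 0 (Re c) F1)//; last by move=> x; exact: F0.
apply: eq_integral => -[x y] _; rewrite /F1/= !mul0r !addr0; congr F.
by case: c {F1 mF1} => a b.
Qed.

Lemma emeasM (c : C) (F : C -> \bar R) : emeas F -> emeas (fun z => F (c * z)).
Proof.
move=> mF; rewrite /emeas.
rewrite (_ : _ \o _ = (F \o cplx) \o (fun x : R2 R =>
   (Re c * x.1 - Im c * x.2, Re c * x.2 + Im c * x.1))); last first.
  by apply/funext => -[x y]/=; case: c => a b.
apply: (measurableT_comp mF); apply: measurable_fun_pair => /=.
  by apply: measurable_funB; exact: measurable_funM.
by apply: measurable_funD; exact: measurable_funM.
Qed.

(* When Im c <> 0 the rotation by c is a product of three shears. *)
Lemma ge0_area_int_rot (c : C) (F : C -> \bar R) : cabs c = 1 -> emeas F ->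
  (forall z, 0 <= F z)%E -> area_int (fun z => F (c * z)) = area_int F.
Proof.
wlog b0 : c F / Im c != 0.
  move=> H c1 mF F0; have [b0|b0] := eqVneq (Im c) 0; last exact: H.
  (* Here c is 1 or -1: it is factored as (c i)(-i), two rotations with nonzero imaginary part. *)
  have i2 : 'i%C * - 'i%C = 1 :> C by rewrite mulrN -expr2 sqr_i opprK.
  transitivity (area_int (fun z => F ((c * 'i%C) * ((- 'i%C) * z)))).
    by congr area_int; apply/funext => z; rewrite mulrA -(mulrA c) i2 mulr1.
  rewrite (H (- 'i%C) (fun z => F ((c * 'i%C) * z)))//.
  - apply: H => //; last by rewrite cabsM c1 cabs_i mulr1.
    rewrite !cE/= mulr1 b0 mul0r addr0; apply: contra_eq_neq c1 => a0.
    by rewrite (_ : c = 0) ?cabs0 1?eq_sym ?oner_eq0//; exact: complex_ext.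
  - by rewrite !cE/= oppr_eq0 oner_eq0.
  - by rewrite cabsN cabs_i.
  - exact: emeasM.
move=> c1 mF F0.
have ab : Re c ^+ 2 + Im c ^+ 2 = 1 by rewrite -cabs_sqr c1 expr1n.
(* For c = e^(i theta), t is -tan(theta/2): the rotation is a horizontal shear by t, a vertical one
   by sin theta, and the first again. *)
pose a := Re c; pose b := Im c; pose t := (a - 1) / b.
pose F1 (x : R2 R) := F (cplx (x.1 + t * x.2 + 0, x.2)).
pose F2 (x : R2 R) := F1 (x.1, x.2 + b * x.1 + 0).
have mF1 : measurable_fun setT F1.
  apply: (measurableT_comp mF); apply: measurable_fun_pair => //=.
  by do 2 apply: measurable_funD => //; exact: measurable_funM.
have mF2 : measurable_fun setT F2.
  apply: (measurableT_comp mF1); apply: measurable_fun_pair => //=.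
  by do 2 apply: measurable_funD => //; exact: measurable_funM.
rewrite !area_intE.
rewrite -[RHS](@ge0_area_shear1 t 0 (F \o cplx))//; last by move=> x; exact: F0.
rewrite -[RHS](@ge0_area_shear2 b 0 F1)//; last by move=> x; exact: F0.
rewrite -[RHS](@ge0_area_shear1 t 0 F2)//; last by move=> x; exact: F0.
apply: eq_integral => -[x y] _; rewrite /F2 /F1/= !addr0; congr F.
have bt : b * t = a - 1 by rewrite /t mulrC divfK.
have -> : y + b * (x + t * y) = b * x + a * y.
  by rewrite mulrDr mulrA bt; ring.
have -> : x + t * y + t * (b * x + a * y) = a * x - b * y.
  have -> : x + t * y + t * (b * x + a * y) = x * (1 + b * t) + y * (t * (1 + a)) by ring.
  rewrite bt (_ : t * (1 + a) = - b); first by ring.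
  rewrite /t mulrAC; apply: (mulIf b0); rewrite divfK// -/b.
  by apply/eqP; rewrite -subr_eq0; apply/eqP; move: ab; rewrite -/a -/b; lra.
by rewrite /a /b; case: c {c1 ab a b t F1 F2 mF1 mF2 bt b0} => a b; apply: complex_ext; rewrite /cplx !cE//=; ring.
Qed.

Lemma ge0_area_int_tonelli (F : C -> C -> \bar R) :
  measurable_fun setT (fun p : R2 R * R2 R => F (cplx p.1) (cplx p.2)) ->
  (forall z w, 0 <= F z w)%E ->
  area_int (fun z => area_int (fun w => F z w)) =
  area_int (fun w => area_int (fun z => F z w)).
Proof.
move=> mF F0; rewrite !area_intE.
have := @fubini_tonelli1 _ _ _ _ _ area area _ mF (fun x => F0 _ _).
by have := @fubini_tonelli2 _ _ _ _ _ area area _ mF (fun x => F0 _ _) => ->.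
Qed.

Lemma ge0_area_int_prod (f g : R -> R) :
  measurable_fun setT f -> measurable_fun setT g ->
  (forall x, 0 <= f x) -> (forall x, 0 <= g x) ->
  area_int (fun z => (f (Re z) * g (Im z))%:E) =
  ((\int[leb]_x (f x)%:E) * (\int[leb]_x (g x)%:E))%E.
Proof.
move=> mf mg f0 g0; rewrite area_intE /area /areaM fubini_tonelli1//=.
- under eq_integral => x _.
    rewrite /fubini_F/=.
    under eq_integral do rewrite EFinM.
    rewrite ge0_integralZl//; last 3 first.
      by apply/measurable_EFinP.
      by move=> y _; rewrite lee_fin.
      by rewrite lee_fin.
    over.
  rewrite ge0_integralZr//.
  - exact/measurable_EFinP.
  - by move=> y _; rewrite lee_fin.
  - by apply: integral_ge0 => y _; rewrite lee_fin.
- apply/measurable_EFinP; apply: measurable_funM => /=.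
    exact: measurableT_comp.
  exact: measurableT_comp.
- by move=> x; rewrite lee_fin mulr_ge0.
Qed.

(** The normal density with standard deviation 1/2 has exactly this exponent; its total mass 1 gives
    the constant. *)
Lemma integralT_gauss2 :
  (\int[leb]_x (expR (- (2 * x ^+ 2)))%:E = (Num.sqrt (pi / 2))%:E)%E.
Proof.
have := @integral_normal_pdf R 0 2^-1.
have s0 : (2^-1 : R) != 0 by rewrite invr_neq0.
rewrite normal_pdfE// /normal_peak /normal_fun.
have -> : 2^-1 ^+ 2 * pi *+ 2 = pi / 2 :> R by rewrite -mulr_natl; field.
under eq_integral do rewrite EFinM.
rewrite ge0_integralZl; last 4 first.
- by [].
- apply/measurable_EFinP; apply: measurableT_comp => //.
  apply: measurable_funM => //; apply: measurable_funN; apply: measurable_funX.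
  exact: measurable_funB.
- by move=> x _; rewrite lee_fin expR_ge0.
- by rewrite lee_fin invr_ge0 sqrtr_ge0.
under eq_integral => x _.
  rewrite subr0 (_ : - x ^+ 2 / _ = - (2 * x ^+ 2)); last by rewrite -[_ *+ 2]mulr_natl; field.
  over.
have p0 : (Num.sqrt (pi / 2) : R) != 0.
  by rewrite gt_eqF// sqrtr_gt0 divr_gt0// pi_gt0.
move=> /(congr1 (fun u => (Num.sqrt (pi / 2))%:E * u)%E).
by rewrite muleA -EFinM divff// mul1e mule1.
Qed.

Lemma area_int_gauss2 :
  area_int (fun z : C => (expR (- (2 * cabs z ^+ 2)))%:E) = (pi / 2)%:E.
Proof.
have := @ge0_area_int_prod (fun x => expR (- (2 * x ^+ 2))) (fun x => expR (- (2 * x ^+ 2))).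
rewrite !integralT_gauss2 -EFinM -expr2 sqr_sqrtr ?divr_ge0 ?pi_ge0//.
have mE : measurable_fun setT (fun x : R => expR (- (2 * x ^+ 2))).
  apply: measurableT_comp => //; apply: measurable_funN.
  by apply: measurable_funM => //; exact: measurable_funX.
move=> <- => //; rewrite ?expR_ge0//; [|by move=> x; rewrite expR_ge0..].
congr area_int; apply/funext => z; congr EFin; rewrite -expRD cabs_sqr; congr expR; ring.
Qed.

Lemma area_int_gauss :
  area_int (fun z : C => (expR (- cabs z ^+ 2))%:E) = pi%:E.
Proof.
have := @ge0_area_int_prod (fun x => expR (- x ^+ 2)) (fun x => expR (- x ^+ 2)).
have -> : (\int[leb]_x (expR (- x ^+ 2))%:E = (Num.sqrt pi)%:E)%E.
  exact: integralT_gauss.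
rewrite -EFinM -expr2 sqr_sqrtr ?pi_ge0//.
have mE : measurable_fun setT (fun x : R => expR (- x ^+ 2)).
  by apply: measurableT_comp => //; apply: measurable_funN; exact: measurable_funX.
move=> <- => //; rewrite ?expR_ge0//; [|by move=> x; rewrite expR_ge0..].
congr area_int; apply/funext => z; congr EFin; rewrite -expRD cabs_sqr; congr expR; ring.
Qed.

(** Integrable over the plane, yet decaying only polynomially: the modulus of its logarithm is
    O(ln(e + |z|)), which is what [log_decay] can absorb. The product form makes its mass a
    one-dimensional computation. *)
Definition poisson_weight (z : C) : R := (1 + Re z ^+ 2)^-1 * (1 + Im z ^+ 2)^-1.

Lemma oneDsqr_gt0 (x : R) : 0 < 1 + x ^+ 2.
Proof. by rewrite ltr_pwDl// sqr_ge0. Qed.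

Lemma integralT_oneDsqr : (\int[leb]_x ((1 + x ^+ 2)^-1)%:E = pi%:E)%E.
Proof.
have c1 : continuous (fun x : R => (1 + x ^+ 2)^-1).
  exact: continuous_oneDsqrV.
rewrite ge0_symfun_integralT//; last 2 first.
  by move=> x; rewrite invr_ge0 ltW// oneDsqr_gt0.
  by move=> x /=; rewrite sqrrN.
have := @integral0y_oneDsqr R; rewrite /oneDsqr.
have -> : [set x : R | 0%R <= x] = `[0, +oo[%classic.
  by apply/seteqP; split => x/=; rewrite in_itv/= andbT.
by move=> ->; rewrite -EFinM; congr EFin; field.
Qed.

Lemma area_int_poisson_weight :
  area_int (fun z => (poisson_weight z)%:E) = (pi ^+ 2)%:E.
Proof.
have mE : measurable_fun setT (fun x : R => (1 + x ^+ 2)^-1).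
  by apply: continuous_measurable_fun; exact: continuous_oneDsqrV.
rewrite (@ge0_area_int_prod (fun x => (1 + x ^+ 2)^-1) (fun x => (1 + x ^+ 2)^-1))//.
- by rewrite !integralT_oneDsqr -EFinM -expr2.
- by move=> x; rewrite invr_ge0 ltW// oneDsqr_gt0.
- by move=> x; rewrite invr_ge0 ltW// oneDsqr_gt0.
Qed.

End Area.

(** * Measurability and complex-valued integrals over the plane *)

Section AreaInt.
Context {R : realType}.
Local Notation C := R[i].
Local Notation Re := complex.Re.
Local Notation Im := complex.Im.

(** Measurability refers to the product sigma-algebra, so the open superlevel set is exhibited as a
    countable union of boxes with rational centres. *)
Lemma continuous_rmeasurable (g : C -> R) :
  (forall z (e : R), 0 < e -> exists2 r : R, 0 < r &
     forall h : C, cabs h < r -> `|g (z + h) - g z| <= e) -> rmeasurable g.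
Proof.
move=> cg mD; apply: (measurability _ (RGenOInfty.measurableE R)) => //.
move=> /= _ [_ [a ->] <-]; rewrite setTI.
pose U := [set x : R2 R | a < g (cplx x)].
pose box (p q : rat) (n : nat) : set (R2 R) :=
  `]ratr p - n.+1%:R^-1, ratr p + n.+1%:R^-1[ `*`
  `]ratr q - n.+1%:R^-1, ratr q + n.+1%:R^-1[.
pose F p q n := if `[< box p q n `<=` U >] then box p q n else set0.
have mF p q n : measurable (F p q n).
  by rewrite /F; case: ifPn => // _; apply: measurableX; exact: measurable_itv.
rewrite [X in measurable X](_ : _ = \bigcup_p \bigcup_q \bigcup_n F p q n); last first.
  apply/seteqP; split => [xy|xy [p _ [q _ [n _]]]]; last first.
    rewrite /F; case: asboolP => // bU /bU; rewrite /U/=.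
    by rewrite in_itv/= andbT.
  rewrite /= in_itv/= andbT => axy.
  have e0 : 0 < (g (cplx xy) - a) / 2 by rewrite divr_gt0// subr_gt0.
  have [r r0 H] := cg (cplx xy) _ e0.
  have r40 : 0 < r / 4 by rewrite divr_gt0.
  have [n _ /(_ n (leqnn _))/= nr] := near_infty_natSinv_lt (PosNum r40).
  pose d : R := n.+1%:R^-1.
  have d0 : 0 < d by rewrite invr_gt0.
  (* A rational centre within d of each coordinate keeps the point in the box; points of the box are
     then within 2d in each coordinate, and 4d < r. *)
  have H1 (x : R) : exists q : rat, x - d < ratr q < x + d.
    have [|q] := @rat_in_itvoo R (x - d) (x + d); first lra.
    by rewrite in_itv/=; exists q.
  have [p hp] := H1 xy.1; have [q hq] := H1 xy.2.
  exists p => //; exists q => //; exists n => //; rewrite /F ifT.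
    by rewrite /box/= !in_itv/= -/d; split; lra.
  apply/asboolP => -[u v]; rewrite /box /U/= !in_itv/= -/d => -[hu hv].
  have := H (cplx (u, v) - cplx xy); rewrite (addrC (cplx xy)) subrK.
  have : cabs (cplx (u, v) - cplx xy) < r.
    rewrite (le_lt_trans (cabs_le _))// !cE/= -/d.
    have h1 : `|u - xy.1| < 2 * d by rewrite ltr_norml; apply/andP; split; lra.
    have h2 : `|v - xy.2| < 2 * d by rewrite ltr_norml; apply/andP; split; lra.
    by move: nr; rewrite -/d/=; lra.
  by move=> /[swap]/[apply]; rewrite ler_norml => /andP[+ _]; lra.
apply: bigcupT_measurable_rat => p; apply: bigcupT_measurable_rat => q.
by apply: bigcupT_measurable => n; exact: mF.
Qed.

Implicit Types (f g : C -> C) (u v : C -> R).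

Lemma rmeasurable_cst (a : R) : rmeasurable (fun _ : C => a).
Proof. exact: measurable_cst. Qed.

Lemma rmeasurable_comp (h : R -> R) u : measurable_fun setT h ->
  rmeasurable u -> rmeasurable (fun z => h (u z)).
Proof. by move=> mh mu; exact: (measurableT_comp mh mu). Qed.

Lemma rmeasurableD u v : rmeasurable u -> rmeasurable v ->
  rmeasurable (fun z => u z + v z).
Proof. exact: measurable_funD. Qed.

Lemma rmeasurableB u v : rmeasurable u -> rmeasurable v ->
  rmeasurable (fun z => u z - v z).
Proof. exact: measurable_funB. Qed.

Lemma rmeasurableM u v : rmeasurable u -> rmeasurable v ->
  rmeasurable (fun z => u z * v z).
Proof. exact: measurable_funM. Qed.

Lemma rmeasurableN u : rmeasurable u -> rmeasurable (fun z => - u z).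
Proof. exact: measurable_funN. Qed.

Lemma rmeasurableX u n : rmeasurable u -> rmeasurable (fun z => u z ^+ n).
Proof. exact: measurable_funX. Qed.

Lemma rmeasurable_expR u : rmeasurable u -> rmeasurable (fun z => expR (u z)).
Proof. exact: rmeasurable_comp. Qed.

Lemma rmeasurable_if (b : C -> bool) u v :
  measurable_fun setT (fun x : R2 R => b (cplx x)) ->
  rmeasurable u -> rmeasurable v -> rmeasurable (fun z => if b z then u z else v z).
Proof. by move=> mb mu mv; exact: (measurable_fun_ifT mb mu mv). Qed.

Lemma rmeasurable_Re : rmeasurable (fun z : C => Re z).
Proof.
rewrite /rmeasurable (_ : _ \o _ = fst); last by apply/funext => -[].
exact: measurable_fst.
Qed.

Lemma rmeasurable_Im : rmeasurable (fun z : C => Im z).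
Proof.
rewrite /rmeasurable (_ : _ \o _ = snd); last by apply/funext => -[].
exact: measurable_snd.
Qed.

Lemma measurable_sqrt : measurable_fun setT (@Num.sqrt R).
Proof. by apply: continuous_measurable_fun; exact: sqrt_continuous. Qed.

Lemma rmeasurable_cabs f : cmeasurable f -> rmeasurable (fun z => cabs (f z)).
Proof.
move=> [mr mi].
have -> : (fun z => cabs (f z)) =
    (fun z => Num.sqrt (Re (f z) ^+ 2 + Im (f z) ^+ 2)).
  by apply/funext => z; rewrite /cabs; case: (f z).
apply: (rmeasurable_comp measurable_sqrt).
by apply: rmeasurableD; exact: rmeasurableX.
Qed.

Lemma cmeasurable_cst (a : C) : cmeasurable (fun=> a).
Proof. by split; exact: rmeasurable_cst. Qed.

Lemma cmeasurable_id : cmeasurable (fun z : C => z).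
Proof. by split; [exact: rmeasurable_Re|exact: rmeasurable_Im]. Qed.

Lemma cmeasurableD f g : cmeasurable f -> cmeasurable g ->
  cmeasurable (fun z => f z + g z).
Proof.
move=> [mf1 mf2] [mg1 mg2]; split.
  rewrite (_ : (fun z => _) = fun z => Re (f z) + Re (g z)); first exact: rmeasurableD.
  by apply/funext => z; rewrite ReD.
rewrite (_ : (fun z => _) = fun z => Im (f z) + Im (g z)); first exact: rmeasurableD.
by apply/funext => z; rewrite ImD.
Qed.

Lemma cmeasurableM f g : cmeasurable f -> cmeasurable g ->
  cmeasurable (fun z => f z * g z).
Proof.
move=> [mf1 mf2] [mg1 mg2]; split.
  rewrite (_ : (fun z => _) = fun z => Re (f z) * Re (g z) - Im (f z) * Im (g z)).
    by apply: rmeasurableB; exact: rmeasurableM.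
  by apply/funext => z; rewrite ReM.
rewrite (_ : (fun z => _) = fun z => Re (f z) * Im (g z) + Im (f z) * Re (g z)).
  by apply: rmeasurableD; exact: rmeasurableM.
by apply/funext => z; rewrite ImM.
Qed.

Lemma cmeasurableZ (a : C) f : cmeasurable f -> cmeasurable (fun z => a * f z).
Proof. by move=> mf; apply: cmeasurableM => //; exact: cmeasurable_cst. Qed.

Lemma cmeasurable_conj f : cmeasurable f -> cmeasurable (fun z => conjc (f z)).
Proof.
move=> [mf1 mf2]; split.
  rewrite (_ : (fun z => _) = fun z => Re (f z))//.
  by apply/funext => z; rewrite Re_conj.
rewrite (_ : (fun z => _) = fun z => - Im (f z)); first exact: rmeasurableN.
by apply/funext => z; rewrite Im_conj.
Qed.

Lemma cmeasurable_real u : rmeasurable u -> cmeasurable (fun z => (u z)%:C%C).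
Proof. by move=> mu; split => //=; exact: rmeasurable_cst. Qed.

Lemma cmeasurable_if (b : C -> bool) f g :
  measurable_fun setT (fun x : R2 R => b (cplx x)) ->
  cmeasurable f -> cmeasurable g -> cmeasurable (fun z => if b z then f z else g z).
Proof.
move=> mb [mf1 mf2] [mg1 mg2]; split.
  rewrite (_ : (fun z => _) = fun z => if b z then Re (f z) else Re (g z)).
    exact: rmeasurable_if.
  by apply/funext => z; case: ifP.
rewrite (_ : (fun z => _) = fun z => if b z then Im (f z) else Im (g z)).
  exact: rmeasurable_if.
by apply/funext => z; case: ifP.
Qed.

Lemma entire_cmeasurable f : entire f -> cmeasurable f.
Proof.
move=> /entire_continuous cf; split; apply: continuous_rmeasurable => z e e0;
  have [r r0 H] := cf z e e0; exists r => // h /H; apply: le_trans.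
  by rewrite -ReN -ReD Re_le.
by rewrite -ImN -ImD Im_le.
Qed.

Lemma rmeasurable_cabs_id : rmeasurable (fun z : C => cabs z).
Proof. exact: rmeasurable_cabs cmeasurable_id. Qed.

Lemma cmeasurable_cexp f : cmeasurable f -> cmeasurable (fun z => cexp (f z)).
Proof.
move=> [mf1 mf2]; under eq_fun do rewrite cexpE; apply: cmeasurableM.
  by apply: cmeasurable_real; exact: rmeasurable_expR.
split => /=.
  exact: (rmeasurable_comp (continuous_measurable_fun (@continuous_cos R))).
exact: (rmeasurable_comp (continuous_measurable_fun (@continuous_sin R))).
Qed.

Lemma rmeas_emeas u : rmeasurable u -> emeas (fun z => (u z)%:E).
Proof. by move=> mu; apply/measurable_EFinP. Qed.

Lemma area_int_ge0 (F : C -> \bar R) : (forall z, 0 <= F z)%E -> (0 <= area_int F)%E.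
Proof. by move=> F0; apply: integral_ge0 => x _; exact: F0. Qed.

Lemma le_area_int (F G : C -> \bar R) : emeas F -> emeas G ->
  (forall z, 0 <= F z)%E -> (forall z, F z <= G z)%E ->
  (area_int F <= area_int G)%E.
Proof.
by move=> mF mG F0 FG; apply: ge0_le_integral.
Qed.

Lemma area_intD (F G : C -> \bar R) : emeas F -> emeas G ->
  (forall z, 0 <= F z)%E -> (forall z, 0 <= G z)%E ->
  area_int (fun z => F z + G z)%E = (area_int F + area_int G)%E.
Proof.
move=> mF mG F0 G0; rewrite !area_intE.
apply: (@ge0_integralD _ _ _ area _ _ (F \o cplx) (G \o cplx)) => //.
  by move=> x _; exact: F0.
by move=> x _; exact: G0.
Qed.

Lemma area_intZl (k : R) (F : C -> \bar R) : 0 <= k -> emeas F ->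
  (forall z, 0 <= F z)%E ->
  area_int (fun z => k%:E * F z)%E = (k%:E * area_int F)%E.
Proof.
move=> k0 mF F0; rewrite !area_intE.
apply: (@ge0_integralZl _ _ _ area _ _ (F \o cplx)) => //.
by move=> x _; exact: F0.
Qed.

(** [cintegrable] speaks of real and imaginary parts; a condition on the modulus is what the
    estimates produce. *)
Lemma cintegrableP f : cintegrable f <->
  cmeasurable f /\ (area_int (fun z => (cabs (f z))%:E) < +oo)%E.
Proof.
split=> [[i1 i2]|[[m1 m2] fi]].
- have m : cmeasurable f.
    split; apply/measurable_EFinP; [exact: measurable_int i1|exact: measurable_int i2].
  split=> //; have := integrableD measurableT (integrable_norm i1) (integrable_norm i2).
  move=> /integrableP[mI]; apply: le_lt_trans; apply: ge0_le_integral => //.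
  + by move=> x _; rewrite lee_fin cabs_ge0.
  + exact: (rmeas_emeas (rmeasurable_cabs m)).
  + exact: measurableT_comp mI.
  + by move=> x _; rewrite -EFinD/= lee_fin (le_trans (cabs_le _))// ler_norm.
- have H u : rmeasurable u -> (forall z, `|u z| <= cabs (f z)) ->
    areaM.-integrable setT (fun xy => (u (cplx xy))%:E).
    move=> mu uf; apply/integrableP; split; first exact/measurable_EFinP.
    apply: le_lt_trans fi; apply: ge0_le_integral => //.
    + by apply: measurableT_comp => //; exact/measurable_EFinP.
    + exact: (rmeas_emeas (rmeasurable_cabs (conj m1 m2))).
    + by move=> x _; rewrite lee_fin.
  split; first by apply: (H (fun z => Re (f z))) => // z; exact: Re_le.
  by apply: (H (fun z => Im (f z))) => // z; exact: Im_le.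
Qed.

Lemma cintegrableD f g : cintegrable f -> cintegrable g ->
  cintegrable (fun z => f z + g z).
Proof.
move=> [f1 f2] [g1 g2]; split.
  rewrite (_ : (fun xy => _) = (fun xy => (Re (f (cplx xy)))%:E + (Re (g (cplx xy)))%:E))%E.
    exact: integrableD.
  by apply/funext => x; rewrite ReD EFinD.
rewrite (_ : (fun xy => _) = (fun xy => (Im (f (cplx xy)))%:E + (Im (g (cplx xy)))%:E))%E.
  exact: integrableD.
by apply/funext => x; rewrite ImD EFinD.
Qed.

Lemma cintD f g : cintegrable f -> cintegrable g ->
  cint (fun z => f z + g z) = cint f + cint g.
Proof.
move=> [f1 f2] [g1 g2]; apply: complex_ext; rewrite ?cE/=.
  by rewrite -RintegralD//; apply: eq_Rintegral => x _; rewrite ReD.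
by rewrite -RintegralD//; apply: eq_Rintegral => x _; rewrite ImD.
Qed.

Lemma cintegrableZ (a : C) f : cintegrable f -> cintegrable (fun z => a * f z).
Proof.
move=> [f1 f2]; split.
  rewrite (_ : (fun xy => _) = (fun xy => (Re a)%:E * (Re (f (cplx xy)))%:E +
     (- Im a)%:E * (Im (f (cplx xy)))%:E))%E.
    by apply: integrableD => //; exact: integrableZl.
  by apply/funext => x; rewrite ReM -!EFinM -EFinD mulNr.
rewrite (_ : (fun xy => _) = (fun xy => (Re a)%:E * (Im (f (cplx xy)))%:E +
     (Im a)%:E * (Re (f (cplx xy)))%:E))%E.
  by apply: integrableD => //; exact: integrableZl.
by apply/funext => x; rewrite ImM -!EFinM -EFinD.
Qed.

Lemma cintZ (a : C) f : cintegrable f -> cint (fun z => a * f z) = a * cint f.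
Proof.
move=> [f1 f2]; apply: complex_ext; rewrite ?cE/=.
  rewrite -mulNr -!RintegralZl// -RintegralD//; last 2 first.
    exact: (@integrableZl _ _ _ _ _ measurableT (Re a) _ f1).
    exact: (@integrableZl _ _ _ _ _ measurableT (- Im a) _ f2).
  by apply: eq_Rintegral => x _; rewrite ReM mulNr.
rewrite -!RintegralZl// -RintegralD//; last 2 first.
  exact: (@integrableZl _ _ _ _ _ measurableT (Re a) _ f2).
  exact: (@integrableZl _ _ _ _ _ measurableT (Im a) _ f1).
by apply: eq_Rintegral => x _; rewrite ImM.
Qed.

Lemma cintegrableB f g : cintegrable f -> cintegrable g ->
  cintegrable (fun z => f z - g z).
Proof.
move=> fi gi; rewrite (_ : (fun z => _) = fun z => f z + -1 * g z).
  by apply: cintegrableD => //; exact: cintegrableZ.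
by apply/funext => z; rewrite mulN1r.
Qed.

Lemma cintB f g : cintegrable f -> cintegrable g ->
  cint (fun z => f z - g z) = cint f - cint g.
Proof.
move=> fi gi; rewrite -mulN1r -cintZ// -cintD//; last exact: cintegrableZ.
by congr cint; apply/funext => z; rewrite mulN1r.
Qed.

Lemma cint_conj f : cintegrable f ->
  cint (fun z => conjc (f z)) = conjc (cint f).
Proof.
move=> [_ i2]; apply: complex_ext; rewrite ?cE/=.
  by apply: eq_Rintegral => x _; rewrite Re_conj.
rewrite -mulN1r -RintegralZl//.
by apply: eq_Rintegral => x _; rewrite Im_conj mulN1r.
Qed.

(** Multiplying f by a unimodular constant makes the integral a nonnegative real, hence equal to its
    own real part. *)
Lemma cabs_cint f : cintegrable f ->
  ((cabs (cint f))%:E <= area_int (fun z => (cabs (f z))%:E))%E.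
Proof.
move=> fi; have [->|c0] := eqVneq (cint f) 0.
  by rewrite cabs0 area_int_ge0// => z; rewrite lee_fin cabs_ge0.
pose a := (cabs (cint f))%:C%C / cint f.
have a1 : cabs a = 1.
  by rewrite cabsM cabs_real cabsV ger0_norm ?cabs_ge0// divff// gt_eqF// cabs_gt0.
have -> : cabs (cint f) = Re (cint (fun z => a * f z)).
  by rewrite cintZ// /a divfK.
have [i1 _] := cintegrableZ a fi.
have [m _] := (cintegrableP _).1 fi.
rewrite /cint/= /Rintegral fineK; last exact: integrable_fin_num.
apply: (le_trans (lee_abs _)); apply: (le_trans (le_abse_integral _ _ _)) => //.
  exact: measurable_int i1.
apply: ge0_le_integral => //.
- exact: (measurable_int _ (integrable_abse i1)).
- exact: (rmeas_emeas (rmeasurable_cabs m)).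
- by move=> x _; rewrite /= lee_fin (le_trans (Re_le _))// cabsM a1 mul1r.
Qed.

Lemma le_cintegrable f u : cmeasurable f -> rmeasurable u ->
  (forall z, cabs (f z) <= u z) -> (area_int (fun z => (u z)%:E) < +oo)%E ->
  cintegrable f.
Proof.
move=> mf mu fu ui; apply/cintegrableP; split => //; apply: le_lt_trans ui.
apply: le_area_int; [exact: (rmeas_emeas (rmeasurable_cabs mf))|exact: rmeas_emeas|..].
  by move=> z; rewrite lee_fin cabs_ge0.
by move=> z; rewrite lee_fin.
Qed.

End AreaInt.

(** * Bisection of rectangles and Goursat's theorem *)

Section Rectangles.
Context {R : realType}.
Local Notation C := R[i].
Local Notation Re := complex.Re.
Local Notation Im := complex.Im.

(** If P fails on a rectangle, it fails on one of its quarters. Repeated choice gives nested failing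
    rectangles shrinking to a point, where the local hypothesis is contradicted. *)
Lemma rect_induction (P : R -> R -> R -> R -> Prop) :
  (forall a b c d, a <= b -> c <= d ->
    P a ((a + b) / 2) c ((c + d) / 2) -> P ((a + b) / 2) b c ((c + d) / 2) ->
    P a ((a + b) / 2) ((c + d) / 2) d -> P ((a + b) / 2) b ((c + d) / 2) d ->
    P a b c d) ->
  (forall x y, exists2 r : R, 0 < r & forall a b c d, a <= x <= b -> c <= y <= d ->
    b - a < r -> d - c < r -> P a b c d) ->
  forall a b c d, a <= b -> c <= d -> P a b c d.
Proof.
move=> quarters small a b c d ab cd; apply: contrapT => nP.
pose T := ((R * R) * (R * R))%type.
pose Q (q : T) := P q.1.1 q.1.2 q.2.1 q.2.2.
pose ok (q : T) := q.1.1 <= q.1.2 /\ q.2.1 <= q.2.2.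
pose sub (q q' : T) := [/\ q.1.1 <= q'.1.1, q'.1.2 <= q.1.2, q.2.1 <= q'.2.1,
  q'.2.2 <= q.2.2 & q'.1.2 - q'.1.1 = (q.1.2 - q.1.1) / 2 /\
                    q'.2.2 - q'.2.1 = (q.2.2 - q.2.1) / 2].
(* The implication is kept under the existential so that [choice] produces a total successor
   function on rectangles. *)
have step q : exists q', ok q /\ ~ Q q -> [/\ sub q q', ok q' & ~ Q q'].
  case: q => -[a0 b0] [c0 d0].
  have [[[/= h1 h2] nQ]|h] := pselect (ok ((a0, b0), (c0, d0)) /\ ~ Q ((a0, b0), (c0, d0)));
    last by exists ((a0, b0), (c0, d0)).
  pose m := (a0 + b0) / 2; pose n := (c0 + d0) / 2.
  have : exists q', [/\ sub ((a0, b0), (c0, d0)) q', ok q' & ~ Q q'].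
    have [q1|q1] := pselect (Q ((a0, m), (c0, n))); last first.
      exists ((a0, m), (c0, n)); split => //; rewrite /sub /ok/= /m /n; last by split; lra.
      by split; [lra..|split; field].
    have [q2|q2] := pselect (Q ((m, b0), (c0, n))); last first.
      exists ((m, b0), (c0, n)); split => //; rewrite /sub /ok/= /m /n; last by split; lra.
      by split; [lra..|split; field].
    have [q3|q3] := pselect (Q ((a0, m), (n, d0))); last first.
      exists ((a0, m), (n, d0)); split => //; rewrite /sub /ok/= /m /n; last by split; lra.
      by split; [lra..|split; field].
    have [q4|q4] := pselect (Q ((m, b0), (n, d0))); last first.
      exists ((m, b0), (n, d0)); split => //; rewrite /sub /ok/= /m /n; last by split; lra.
      by split; [lra..|split; field].
    by exfalso; apply: nQ; exact: quarters.
  by move=> [q' hq']; exists q'.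
have [next nextP] := choice step.
pose q n := iter n next ((a, b), (c, d)).
have qok n : ok (q n) /\ ~ Q (q n).
  elim: n => [//|n ih]; rewrite /q iterS -/(q n).
  by have [_ ? ?] := nextP _ ih.
have qsub n : sub (q n) (q n.+1).
  by rewrite /q iterS -/(q n); have [] := nextP _ (qok n).
have mono n k : (q n).1.1 <= (q (n + k)%N).1.1 /\ (q (n + k)%N).1.2 <= (q n).1.2 /\
    (q n).2.1 <= (q (n + k)%N).2.1 /\ (q (n + k)%N).2.2 <= (q n).2.2.
  elim: k => [|k [i1 [i2 [i3 i4]]]]; first by rewrite addn0.
  rewrite addnS; have [s1 s2 s3 s4 _] := qsub (n + k)%N.
  by split; [|split; [|split]]; lra.
(* Every left end lies below every right end, so the suprema of the left ends lie in all the
   rectangles. *)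
have mix n k : (q n).1.1 <= (q k).1.2 /\ (q n).2.1 <= (q k).2.2.
  have [i1 [i2 [i3 i4]]] := mono n k; have [j1 [j2 [j3 j4]]] := mono k n.
  rewrite (addnC k) in j1 j2 j3 j4; have [[w1 w2] _] := qok (n + k)%N.
  by split; lra.
pose x := sup [set (q n).1.1 | n in setT]; pose y := sup [set (q n).2.1 | n in setT].
have xP n : (q n).1.1 <= x <= (q n).1.2.
  apply/andP; split.
    by apply: ub_le_sup; [exists (q 0%N).1.2 => _ [k _ <-]; case: (mix k 0%N)|exists n].
  by apply: ge_sup; [exists (q 0%N).1.1; exists 0%N|move=> _ [k _ <-]; case: (mix k n)].
have yP n : (q n).2.1 <= y <= (q n).2.2.
  apply/andP; split.
    by apply: ub_le_sup; [exists (q 0%N).2.2 => _ [k _ <-]; case: (mix k 0%N)|exists n].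
  by apply: ge_sup; [exists (q 0%N).2.1; exists 0%N|move=> _ [k _ <-]; case: (mix k n)].
have len n : (q n).1.2 - (q n).1.1 = (b - a) / 2 ^+ n /\
             (q n).2.2 - (q n).2.1 = (d - c) / 2 ^+ n.
  elim: n => [|n [i1 i2]]; first by rewrite expr0 !divr1.
  have [_ _ _ _ [e1 e2]] := qsub n.
  by rewrite e1 e2 i1 i2 exprS invfM; split; ring.
have [r r0 H] := small x y.
have sab : 0 <= b - a by rewrite subr_ge0.
have scd : 0 <= d - c by rewrite subr_ge0.
(* The summand 1 keeps s positive when the rectangle is degenerate. *)
pose s := (b - a) + (d - c) + 1.
have s0 : 0 < s by rewrite /s; lra.
have [n sn] : exists n, s / 2 ^+ n < r.
  have [n _ /(_ n (leqnn _))/= hn] := near_infty_natSinv_lt (PosNum (divr_gt0 r0 s0)).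
  exists n; rewrite mulrC -ltr_pdivlMr//; apply: le_lt_trans hn.
  rewrite lef_pV2 ?posrE ?exprn_gt0// -natrX ler_nat.
  exact: ltn_expl.
have h2 : 0 < (2 ^+ n)^-1 :> R by rewrite invr_gt0 exprn_gt0.
have [_] := qok n; apply.
have [l1 l2] := len n.
by apply: H => //; rewrite ?l1 ?l2; apply: le_lt_trans sn; rewrite ler_pM2r// /s; lra.
Qed.

(** Quartering divides the squared half-perimeter by 4, so a bound by eps times that square survives
    the addition of four quarters. It therefore spreads from small rectangles to all of them, for
    every eps. *)
Lemma rect_additive_eq0 (J : R -> R -> R -> R -> C) :
  (forall a b c d, a <= b -> c <= d -> J a b c d =
    J a ((a + b) / 2) c ((c + d) / 2) + J ((a + b) / 2) b c ((c + d) / 2) +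
    J a ((a + b) / 2) ((c + d) / 2) d + J ((a + b) / 2) b ((c + d) / 2) d) ->
  (forall x y (e : R), 0 < e -> exists2 r : R, 0 < r &
    forall a b c d, a <= x <= b -> c <= y <= d ->
    b - a < r -> d - c < r -> cabs (J a b c d) <= e * (b - a + (d - c)) ^+ 2) ->
  forall a b c d, a <= b -> c <= d -> J a b c d = 0.
Proof.
move=> Jadd Jsmall a b c d ab cd; apply: cabs_eq0; apply/eqP.
rewrite eq_le cabs_ge0 andbT; apply/ler_addgt0Pr => e e0; rewrite add0r.
pose s := (b - a + (d - c)) ^+ 2 + 1.
have s0 : 0 < s by rewrite ltr_pwDr// sqr_ge0.
have := @rect_induction (fun a b c d => cabs (J a b c d) <= (e / s) * (b - a + (d - c)) ^+ 2).
move=> /(_ _ _ a b c d ab cd) H; apply: (le_trans (H _ _)).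
- move=> {H}a0 b0 c0 d0 ab0 cd0 h1 h2 h3 h4; rewrite (Jadd _ _ _ _ ab0 cd0).
  have tri (z1 z2 z3 z4 : C) : cabs (z1 + z2 + z3 + z4) <=
      cabs z1 + cabs z2 + cabs z3 + cabs z4.
    by do 3 (apply: (le_trans (cabsD _ _)); rewrite ?lerD2r).
  apply: (le_trans (tri _ _ _ _)).
  have e1 : (a0 + b0) / 2 - a0 + ((c0 + d0) / 2 - c0) = (b0 - a0 + (d0 - c0)) / 2 by field.
  have e2 : b0 - (a0 + b0) / 2 + ((c0 + d0) / 2 - c0) = (b0 - a0 + (d0 - c0)) / 2 by field.
  have e3 : (a0 + b0) / 2 - a0 + (d0 - (c0 + d0) / 2) = (b0 - a0 + (d0 - c0)) / 2 by field.
  have e4 : b0 - (a0 + b0) / 2 + (d0 - (c0 + d0) / 2) = (b0 - a0 + (d0 - c0)) / 2 by field.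
  apply: (le_trans (lerD (lerD (lerD h1 h2) h3) h4)).
  rewrite e1 e2 e3 e4 -!mulrDr le_eqVlt; apply/orP; left; apply/eqP.
  by congr (_ * _); field.
- by move=> x y; apply: Jsmall; rewrite divr_gt0.
- by rewrite mulrAC ler_pdivrMr// ler_pM2l// /s lerDl.
Qed.

End Rectangles.

Section Goursat.
Context {R : realType}.
Local Notation C := R[i].
Local Notation leb := (@lebesgue_measure R).
Local Notation Re := complex.Re.
Local Notation Im := complex.Im.
Implicit Types (u v : R -> R) (g : R -> C).

Lemma epsdelta_continuous u :
  (forall x (e : R), 0 < e -> exists2 r : R, 0 < r &
    forall h, `|h| < r -> `|u (x + h) - u x| <= e) -> continuous u.
Proof.
move=> cu x; apply/cvgrPdist_le => e e0; have [r r0 H] := cu x e e0.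
apply/nbhs_ballP; exists r => //= y; rewrite /ball/= distrC => yr.
by have := H _ yr; rewrite (addrC x) subrK distrC.
Qed.

Lemma continuous_integrable_itv u (a b : R) : continuous u ->
  leb.-integrable `[a, b] (EFin \o u).
Proof.
move=> cu; apply: continuous_compact_integrable; first exact: segment_compact.
exact: continuous_subspaceT.
Qed.

Lemma Rintegral_itv_split u (a m b : R) : continuous u -> a <= m -> m <= b ->
  \int[leb]_(x in `[a, b]) u x =
  \int[leb]_(x in `[a, m]) u x + \int[leb]_(x in `[m, b]) u x.
Proof.
move=> cu am mb.
have := @Rintegral_itvB R u (BLeft a) (BRight b) m (continuous_integrable_itv _ _ cu).
rewrite !bnd_simp => /(_ am mb) /eqP; rewrite subr_eq addrC => /eqP ->.
congr (_ + _); rewrite Rintegral_itv_obnd_cbnd//.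
apply: (integrableS _ _ _ (continuous_integrable_itv m b cu)) => //.
exact: subset_itv_oc_cc.
Qed.

Lemma Rintegral_itv_cst (a b k : R) : a <= b ->
  \int[leb]_(x in `[a, b]) k = k * (b - a).
Proof.
move=> ab; rewrite Rintegral_cst//= lebesgue_measure_itv/= lte_fin.
by case: ltP => //= ba; rewrite (@le_anti _ _ a b) ?ab// subrr.
Qed.

Lemma Rintegral_itv_est u (a b k M : R) : continuous u -> a <= b ->
  (forall x, a <= x <= b -> `|u x - k| <= M) ->
  `|\int[leb]_(x in `[a, b]) u x - (b - a) * k| <= M * (b - a).
Proof.
move=> cu ab ukM.
have ck : continuous (fun _ : R => k) by move=> x; exact: cvg_cst.
have cuk : continuous (fun x => u x - k) by move=> x; apply: cvgB; [exact: cu|exact: ck].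
have -> : (b - a) * k = \int[leb]_(x in `[a, b]) k by rewrite Rintegral_itv_cst// mulrC.
rewrite -RintegralB//; [|exact: continuous_integrable_itv..].
apply: (le_trans (le_normr_Rintegral _ _)) => //.
  exact: (continuous_integrable_itv _ _ cuk).
have -> : M * (b - a) = \int[leb]_(x in `[a, b]) M by rewrite Rintegral_itv_cst.
apply: le_Rintegral => //.
- by apply: (@continuous_integrable_itv (fun x => `|u x - k|)) => x; apply: cvg_norm; exact: cuk.
- by apply: (@continuous_integrable_itv (fun=> M)) => x; exact: cvg_cst.
Qed.

Definition ci (a b : R) g : C :=
  ((\int[leb]_(x in `[a, b]) Re (g x)) +i* (\int[leb]_(x in `[a, b]) Im (g x)))%C.

Definition ccont g := continuous (fun x => Re (g x)) /\ continuous (fun x => Im (g x)).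

Lemma ci_split g (a m b : R) : ccont g -> a <= m -> m <= b ->
  ci a b g = ci a m g + ci m b g.
Proof.
by move=> [g1 g2] am mb; apply: complex_ext; rewrite ?cE/=; exact: Rintegral_itv_split.
Qed.

Lemma ciB g1 g2 (a b : R) : ccont g1 -> ccont g2 ->
  ci a b (fun x => g1 x - g2 x) = ci a b g1 - ci a b g2.
Proof.
move=> [c1 c2] [d1 d2]; apply: complex_ext; rewrite ?cE/= -RintegralB//;
  try exact: continuous_integrable_itv.
  by apply: eq_Rintegral => x _; rewrite !cE.
by apply: eq_Rintegral => x _; rewrite !cE.
Qed.

Lemma ccontB g1 g2 : ccont g1 -> ccont g2 -> ccont (fun x => g1 x - g2 x).
Proof.
move=> [c1 c2] [d1 d2]; split => x.
  rewrite (_ : (fun x => _) = fun x => Re (g1 x) - Re (g2 x)).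
    by apply: cvgB; [exact: c1|exact: d1].
  by apply/funext => y; rewrite !cE.
rewrite (_ : (fun x => _) = fun x => Im (g1 x) - Im (g2 x)).
  by apply: cvgB; [exact: c2|exact: d2].
by apply/funext => y; rewrite !cE.
Qed.

(** The factor 2 pays for treating real and imaginary parts separately. *)
Lemma ci_est g (a b : R) (k : C) (M : R) : ccont g -> a <= b ->
  (forall x, a <= x <= b -> cabs (g x - k) <= M) ->
  cabs (ci a b g - (b - a)%:C%C * k) <= 2 * M * (b - a).
Proof.
move=> [c1 c2] ab gM; apply: (le_trans (cabs_le _)).
have -> : 2 * M * (b - a) = M * (b - a) + M * (b - a) by ring.
rewrite !cE/= !mul0r subr0 addr0; apply: lerD; apply: Rintegral_itv_est => // x /gM;
  apply: le_trans; rewrite -?ReN -?ReD -?ImN -?ImD; [exact: Re_le|exact: Im_le].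
Qed.

Lemma entire_ccont_h (G : C -> C) (c : R) : entire G -> ccont (fun x => G (cplx (x, c))).
Proof.
move=> /entire_continuous cG; split; apply: epsdelta_continuous => x e e0;
  have [r r0 H] := cG (cplx (x, c)) e e0; exists r => // h hr;
  have := H h%:C%C; rewrite cabs_real => /(_ hr);
  (have -> : cplx (x, c) + h%:C%C = cplx (x + h, c) by apply: complex_ext; rewrite !cE/= ?addr0);
  apply: le_trans; rewrite -?ReN -?ReD -?ImN -?ImD; [exact: Re_le|exact: Im_le].
Qed.

Lemma entire_ccont_v (G : C -> C) (c : R) : entire G -> ccont (fun x => G (cplx (c, x))).
Proof.
move=> /entire_continuous cG; split; apply: epsdelta_continuous => x e e0;
  have [r r0 H] := cG (cplx (c, x)) e e0; exists r => // h hr;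
  have := H ('i%C * h%:C%C); rewrite cabsM cabs_i mul1r cabs_real => /(_ hr);
  (have -> : cplx (c, x) + 'i%C * h%:C%C = cplx (c, x + h) by apply: complex_ext; rewrite !cE/=; ring);
  apply: le_trans; rewrite -?ReN -?ReD -?ImN -?ImD; [exact: Re_le|exact: Im_le].
Qed.

(** Opposite sides are paired, so that constants cancel within each pair. On a small rectangle of
    half-perimeter s, G is affine up to (e/4) s, and the linear contributions of the two pairs
    cancel each other. *)
Lemma goursat (G : C -> C) (a b c d : R) : entire G -> a <= b -> c <= d ->
  ci a b (fun x => G (cplx (x, c))) - ci a b (fun x => G (cplx (x, d))) +
  'i%C * (ci c d (fun y => G (cplx (b, y))) - ci c d (fun y => G (cplx (a, y)))) = 0.
Proof.
move=> eG; move: a b c d.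
have ch c := entire_ccont_h c eG; have cv c := entire_ccont_v c eG.
apply: rect_additive_eq0 => [a b c d ab cd|x y e e0].
  have h1 : a <= (a + b) / 2 by lra.
  have h2 : (a + b) / 2 <= b by lra.
  have h3 : c <= (c + d) / 2 by lra.
  have h4 : (c + d) / 2 <= d by lra.
  rewrite (ci_split (ch c) h1 h2) (ci_split (ch d) h1 h2).
  rewrite (ci_split (cv a) h3 h4) (ci_split (cv b) h3 h4).
  ring.
have [D] := (entireP G).1 eG (cplx (x, y)).
move=> /(_ (e / 4)) []; first by rewrite divr_gt0.
move=> r r0 H; exists (r / 4); first by rewrite divr_gt0.
move=> a b c d xab ycd sab scd.
have ab : a <= b by move/andP: xab => [? ?]; lra.
have cd : c <= d by move/andP: ycd => [? ?]; lra.
set s := b - a + (d - c).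
have HG x' y' : a <= x' <= b -> c <= y' <= d ->
    cabs (G (cplx (x', y')) - G (cplx (x, y)) - (cplx (x', y') - cplx (x, y)) * D) <= e / 4 * s.
  move=> hx hy.
  have hs : cabs (cplx (x', y') - cplx (x, y)) <= s.
    rewrite (le_trans (cabs_le _))// !cE/= /s; apply: lerD; rewrite ler_norml;
    move/andP: xab => [? ?]; move/andP: ycd => [? ?]; move/andP: hx => [? ?]; move/andP: hy => [? ?];
    by apply/andP; split; lra.
  have hr : cabs (cplx (x', y') - cplx (x, y)) < r by apply: (le_lt_trans hs); rewrite /s; lra.
  have := H _ hr; rewrite (addrC (cplx (x, y))) subrK => /le_trans; apply.
  by rewrite ler_pM2l// divr_gt0.
rewrite -!ciB//.
have E1 := @ci_est (fun x => G (cplx (x, c)) - G (cplx (x, d))) a b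
  ((cplx (0, c) - cplx (0, d)) * D) (e / 2 * s) (ccontB (ch c) (ch d)) ab.
have E2 := @ci_est (fun y => G (cplx (b, y)) - G (cplx (a, y))) c d
  ((cplx (b, 0) - cplx (a, 0)) * D) (e / 2 * s) (ccontB (cv b) (cv a)) cd.
have {}E1 := E1 _; have {}E2 := E2 _.
have e2s : e / 2 * s = e / 4 * s + e / 4 * s by field.
have {}E1 : cabs (ci a b (fun x => G (cplx (x, c)) - G (cplx (x, d))) -
    (b - a)%:C%C * ((cplx (0, c) - cplx (0, d)) * D)) <= 2 * (e / 2 * s) * (b - a).
  apply: E1 => x' hx.
  have k1 := HG x' c hx ltac:(by rewrite lexx). have k2 := HG x' d hx ltac:(by rewrite lexx cd).
  have -> : G (cplx (x', c)) - G (cplx (x', d)) - (cplx (0, c) - cplx (0, d)) * D =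
    (G (cplx (x', c)) - G (cplx (x, y)) - (cplx (x', c) - cplx (x, y)) * D) -
    (G (cplx (x', d)) - G (cplx (x, y)) - (cplx (x', d) - cplx (x, y)) * D).
    have -> : cplx (0, c) - cplx (0, d) = cplx (x', c) - cplx (x', d).
      by apply: complex_ext; rewrite !cE/= ?subrr.
    ring.
  by rewrite (le_trans (cabsB _ _))// e2s lerD.
have {}E2 : cabs (ci c d (fun y => G (cplx (b, y)) - G (cplx (a, y))) -
    (d - c)%:C%C * ((cplx (b, 0) - cplx (a, 0)) * D)) <= 2 * (e / 2 * s) * (d - c).
  apply: E2 => y' hy.
  have k1 := HG b y' ltac:(by rewrite lexx ab) hy. have k2 := HG a y' ltac:(by rewrite lexx) hy.
  have -> : G (cplx (b, y')) - G (cplx (a, y')) - (cplx (b, 0) - cplx (a, 0)) * D =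
    (G (cplx (b, y')) - G (cplx (x, y)) - (cplx (b, y') - cplx (x, y)) * D) -
    (G (cplx (a, y')) - G (cplx (x, y)) - (cplx (a, y') - cplx (x, y)) * D).
    have -> : cplx (b, 0) - cplx (a, 0) = cplx (b, y') - cplx (a, y').
      by apply: complex_ext; rewrite !cE/= ?subrr.
    ring.
  by rewrite (le_trans (cabsB _ _))// e2s lerD.
move: E1 E2; set I1 := ci a b _; set I2 := ci c d _; move=> E1 E2.
have -> : I1 + 'i%C * I2 =
   (I1 - (b - a)%:C%C * ((cplx (0, c) - cplx (0, d)) * D)) +
   'i%C * (I2 - (d - c)%:C%C * ((cplx (b, 0) - cplx (a, 0)) * D)).
  (* The linear terms are i(c - d)(b - a)D and i(b - a)(d - c)D. *)
  suff : (b - a)%:C%C * ((cplx (0, c) - cplx (0, d)) * D) =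
    - ('i%C * ((d - c)%:C%C * ((cplx (b, 0) - cplx (a, 0)) * D))) by move=> ->; ring.
  rewrite !mulrA -mulNr; congr (_ * _).
  by apply: complex_ext; rewrite !cE/=; ring.
apply: (le_trans (cabsD _ _)); rewrite cabsM cabs_i mul1r.
apply: (le_trans (lerD E1 E2)).
by rewrite le_eqVlt; apply/orP; left; apply/eqP; rewrite -/s /s; field.
Qed.

End Goursat.

Local Opaque entire.

(** * Circle means, local bounds and invariance of signed integrals *)

Section MeanValue.
Context {R : realType}.
Local Notation C := R[i].
Local Notation leb := (@lebesgue_measure R).
Local Notation Re := complex.Re.
Local Notation Im := complex.Im.
Implicit Types (F f : C -> C).

(* In the coordinate z = e^(s + it) circles become vertical segments, so Goursat
   on a rectangle compares the means over two circles; let the radius go to 0. *)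
Lemma circle_mean F (w : C) : entire F ->
  ci 0 (pi *+ 2) (fun y => F (cexp (cplx (0, y)) * w)) = (pi *+ 2)%:C%C * F 0.
Proof.
move=> eF; pose G (z : C) := F (cexp z * w).
have eG : entire G.
  exact: (entire_comp eF (entireZr (c := w) (@entire_cexp R))).
have d0 : 0 <= pi *+ 2 :> R by rewrite mulrn_wge0// pi_ge0.
(* Periodicity of the exponential makes the two horizontal sides cancel in Goursat's identity. *)
have per x : G (cplx (x, 0)) = G (cplx (x, pi *+ 2)).
  by rewrite /G !cexpE/= cos2pi sin2pi cos0 sin0.
have eqt (t : R) : 0 <= t -> ci 0 (pi *+ 2) (fun y => G (cplx (0, y))) =
    ci 0 (pi *+ 2) (fun y => G (cplx (- t, y))).
  move=> t0; have := @goursat _ G (- t) 0 0 (pi *+ 2) eG; rewrite oppr_le0 => /(_ t0 d0).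
  under eq_fun do rewrite per.
  rewrite subrr add0r => /eqP; rewrite mulf_eq0 => /orP[/eqP e|].
    by move/(congr1 (@cabs R)): e; rewrite cabs_i cabs0 => /eqP; rewrite oner_eq0.
  by rewrite subr_eq0 => /eqP.
apply/eqP; rewrite -subr_eq0; apply/eqP/cabs_eq0/eqP.
rewrite eq_le cabs_ge0 andbT; apply/ler_addgt0Pr => e e0; rewrite add0r.
pose D : R := 2 * (pi *+ 2) + 1.
have D0 : 0 < D by rewrite ltr_pwDr// mulr_ge0.
have [r r0 H] := entire_continuous eF 0 (divr_gt0 e0 D0).
(* Chosen so that |w|/(1 + t) < r, hence e^(-t) |w| < r: the circle of radius e^(-t) |w| lies where
   F is close to F 0. *)
pose t := (cabs w + 1) / r.
have t0 : 0 <= t by rewrite divr_ge0 ?addr_ge0 ?cabs_ge0// ltW.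
rewrite -[X in X - _]/(ci 0 (pi *+ 2) (fun y => G (cplx (0, y)))) (eqt _ t0).
have := @ci_est _ (fun y => G (cplx (- t, y))) 0 (pi *+ 2) (F 0) (e / D)
  (entire_ccont_v (- t) eG) d0.
rewrite subr0 => /(_ _)/le_trans; apply.
  move=> y _; rewrite /G -[X in F X]add0r; apply: H.
  rewrite cabsM cabs_cexp/=.
  have h1 : expR (- t) <= (1 + t)^-1.
    by rewrite expRN lef_pV2 ?posrE ?expR_gt0 ?ltr_pwDl// expR_ge1Dx.
  apply: (@le_lt_trans _ _ ((1 + t)^-1 * cabs w)).
    by rewrite ler_wpM2r ?cabs_ge0.
  rewrite mulrC ltr_pdivrMr ?ltr_pwDl// mulrDr mulr1 /t mulrC divfK ?gt_eqF//.
  by rewrite addrCA ltrDl addr_gt0.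
have -> : 2 * (e / D) * (pi *+ 2) = e * (2 * (pi *+ 2) / D) by ring.
apply: ler_piMr; first exact: ltW.
by rewrite ler_pdivrMr// mul1r /D ltW// ltrDl.
Qed.

(** Compactness by bisection: continuity bounds F near each point, and four bounds on quarters
    combine into one. *)
Lemma entire_bounded F (r : R) : entire F ->
  exists M, forall z, cabs z < r -> cabs (F z) <= M.
Proof.
move=> eF; have [r0|r0] := leP 0 r; last first.
  by exists 0 => z zr; have := cabs_ge0 z; lra.
have [||||M HM] := @rect_induction R (fun a b c d => exists M, forall x y,
  a <= x <= b -> c <= y <= d -> cabs (F (cplx (x, y))) <= M) _ _ (- r) r (- r) r; [| |lra|lra|].
- move=> a b c d ab cd [M1 h1] [M2 h2] [M3 h3] [M4 h4].
  exists (`|M1| + `|M2| + `|M3| + `|M4|) => x y /andP[ax xb] /andP[cy yd].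
  have := normr_ge0 M1; have := normr_ge0 M2; have := normr_ge0 M3; have := normr_ge0 M4.
  have := ler_norm M1; have := ler_norm M2; have := ler_norm M3; have := ler_norm M4.
  have [xm|/ltW xm] := leP x ((a + b) / 2); have [ym|/ltW ym] := leP y ((c + d) / 2).
  + have := h1 x y ltac:(by apply/andP) ltac:(by apply/andP); lra.
  + have := h3 x y ltac:(by apply/andP) ltac:(by apply/andP); lra.
  + have := h2 x y ltac:(by apply/andP) ltac:(by apply/andP); lra.
  + have := h4 x y ltac:(by apply/andP) ltac:(by apply/andP); lra.
- move=> x y; have [s s0 H] := entire_continuous eF (cplx (x, y)) ltr01.
  exists (s / 2); first by rewrite divr_gt0.
  move=> a b c d /andP[ax xb] /andP[cy yd] sab scd.
  exists (cabs (F (cplx (x, y))) + 1) => x' y' /andP[ax' xb'] /andP[cy' yd'].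
  have hr : cabs (cplx (x', y') - cplx (x, y)) < s.
    rewrite (le_lt_trans (cabs_le _))// !cE/=.
    have h1 : `|x' - x| < s / 2 by rewrite ltr_norml; apply/andP; split; lra.
    have h2 : `|y' - y| < s / 2 by rewrite ltr_norml; apply/andP; split; lra.
    lra.
  have := H _ hr; rewrite (addrC (cplx (x, y))) subrK => h.
  have := cabsD (F (cplx (x', y')) - F (cplx (x, y))) (F (cplx (x, y))); rewrite subrK; lra.
exists M => z zr; rewrite -[z]cplxK; apply: HM.
  by have := Re_le z; rewrite -ler_norml; lra.
by have := Im_le z; rewrite -ler_norml; lra.
Qed.

Lemma area_int_posneg (F : C -> \bar R) : area_int F =
  (area_int (fun z => maxe (F z) 0) - area_int (fun z => maxe (- F z) 0))%E.
Proof.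
rewrite [LHS](integralE areaM setT (F \o cplx)).
by congr (_ - _)%E; apply: eq_integral => x _; rewrite ?funepos.unlock ?funeneg.unlock.
Qed.

Lemma area_int_translate (c : C) (F : C -> \bar R) : emeas F ->
  area_int (fun z => F (z + c)) = area_int F.
Proof.
move=> mF; rewrite area_int_posneg [RHS]area_int_posneg; congr (_ - _)%E.
  rewrite (@ge0_area_int_translate _ c (fun z => maxe (F z) 0%E))//; last by move=> z; rewrite le_max lexx orbT.
  by have := measurable_funepos mF; rewrite funepos.unlock.
rewrite (@ge0_area_int_translate _ c (fun z => maxe (- F z)%E 0%E))//; last by move=> z; rewrite le_max lexx orbT.
by have := measurable_funeneg mF; rewrite funeneg.unlock.
Qed.

Lemma area_int_rot (c : C) (F : C -> \bar R) : cabs c = 1 -> emeas F ->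
  area_int (fun z => F (c * z)) = area_int F.
Proof.
move=> c1 mF; rewrite area_int_posneg [RHS]area_int_posneg; congr (_ - _)%E.
  rewrite (@ge0_area_int_rot _ c (fun z => maxe (F z) 0%E))//; last by move=> z; rewrite le_max lexx orbT.
  by have := measurable_funepos mF; rewrite funepos.unlock.
rewrite (@ge0_area_int_rot _ c (fun z => maxe (- F z)%E 0%E))//; last by move=> z; rewrite le_max lexx orbT.
by have := measurable_funeneg mF; rewrite funeneg.unlock.
Qed.

Lemma cint_translate (c : C) F : cmeasurable F ->
  cint (fun z => F (z + c)) = cint F.
Proof.
move=> [m1 m2]; congr (_ +i* _)%C; congr fine.
  by apply: (@area_int_translate c (fun z => (Re (F z))%:E)); exact: rmeas_emeas.
by apply: (@area_int_translate c (fun z => (Im (F z))%:E)); exact: rmeas_emeas.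
Qed.

End MeanValue.

(** * Averaging over rotations *)

Section MeanValue.
Context {R : realType}.
Local Notation C := R[i].
Local Notation leb := (@lebesgue_measure R).
Local Notation Re := complex.Re.
Local Notation Im := complex.Im.
Implicit Types (F f : C -> C).

(** The integral of u W does not change when u is rotated, so it equals its own mean over all
    angles; exchanging the integrals replaces u by its circle mean k. The bound on u is asked only
    where W is nonzero, so that W may be a Gaussian cut off to a disc. *)
Lemma radial_average (u W : C -> R) (M k : R) :
  rmeasurable u -> rmeasurable W -> (forall z, 0 <= W z) ->
  (forall c z, cabs c = 1 -> W (c * z) = W z) ->
  (area_int (fun z => (W z)%:E) < +oo)%E ->
  (forall z, W z != 0 -> `|u z| <= M) ->
  (forall z, \int[leb]_(y in `[0, pi *+ 2]) u (cexp (cplx (0, y)) * z) = (pi *+ 2) * k) ->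
  area_int (fun z => (u z * W z)%:E) = (k%:E * area_int (fun z => (W z)%:E))%E.
Proof.
move=> mu mW W0 Wrot iW uM umean.
have d0 : 0 < pi *+ 2 :> R by rewrite mulrn_wgt0// pi_gt0.
pose one (y : R) : R := \1_(`[0, pi *+ 2]%classic) y.
have mone : measurable_fun setT one by exact: measurable_indic.
have one01 y : 0 <= one y by rewrite /one indicE.
have ione : (\int[leb]_y (one y)%:E)%E = (pi *+ 2)%:E.
  rewrite integral_indic//.
  rewrite setIT -[LHS]/(leb `[0, pi *+ 2]%classic).
  by rewrite lebesgue_measure_itv/= lte_fin d0 -EFinB subr0.
pose f (p : R * R2 R) : R := one p.1 * (u (cexp (cplx (0, p.1)) * cplx p.2) * W (cplx p.2)).
have muc : measurable_fun setT (fun p : R * R2 R => u (cexp (cplx (0, p.1)) * cplx p.2)).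
  rewrite (_ : (fun p => _) = (u \o cplx) \o (fun p : R * R2 R =>
    (cos p.1 * p.2.1 - sin p.1 * p.2.2, cos p.1 * p.2.2 + sin p.1 * p.2.1))); last first.
    apply/funext => -[y [a b]]/=; rewrite cexpE/= expR0; congr u.
    by apply: complex_ext; rewrite !cE/=; ring.
  have mc : measurable_fun setT (fun p : R * R2 R => cos p.1).
    by apply: (measurableT_comp (continuous_measurable_fun (@continuous_cos R))).
  have ms : measurable_fun setT (fun p : R * R2 R => sin p.1).
    by apply: (measurableT_comp (continuous_measurable_fun (@continuous_sin R))).
  have m1 : measurable_fun setT (fun p : R * R2 R => p.2.1).
    by apply: (measurableT_comp measurable_fst); exact: measurable_snd.
  have m2 : measurable_fun setT (fun p : R * R2 R => p.2.2).
    by apply: (measurableT_comp measurable_snd); exact: measurable_snd.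
  apply: (measurableT_comp mu); apply: measurable_fun_pair => /=.
    by apply: measurable_funB; exact: measurable_funM.
  by apply: measurable_funD; exact: measurable_funM.
have mf : measurable_fun setT (EFin \o f).
  apply/measurable_EFinP; apply: measurable_funM.
    by apply: (measurableT_comp mone).
  apply: measurable_funM => //.
  by apply: (measurableT_comp mW).
have uM' y z : `|u (cexp (cplx (0, y)) * z) * W z| <= `|M| * W z.
  rewrite normrM (ger0_norm (W0 _)); have [->|Wz] := eqVneq (W z) 0; first by rewrite !mulr0.
  rewrite ler_wpM2r//; apply: (@le_trans _ _ M); last exact: ler_norm.
  by apply: uM; rewrite Wrot// cabs_cexp/= expR0.
have fi : (leb \x area)%E.-integrable setT (EFin \o f).
  apply/integrable12ltyP => //=.
  pose B := area_int (fun z => (`|M| * W z)%:E).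
  have BE : B = (`|M|%:E * area_int (fun z => (W z)%:E))%E.
    by rewrite -area_intZl//; exact: rmeas_emeas.
  apply: (@le_lt_trans _ _ (\int[leb]_y ((one y)%:E * B))%E).
    apply: ge0_le_integral.
    - by [].
    - by move=> y _; exact: integral_ge0.
    - have := @measurable_fun_fubini_tonelli_F _ _ _ _ _ area (fun x => `|(f x)%:E|%E).
      by apply; [apply: measurableT_comp mf|move=> x; exact: abse_ge0].
    - apply: emeasurable_funM; last exact: measurable_cst.
      exact/measurable_EFinP.
    - move=> y _; rewrite /f/= /one indicE; case: (y \in _) => /=; last first.
        by rewrite mul0e integral0_eq// => z _; rewrite mul0r normr0.
      rewrite mul1e; apply: ge0_le_integral; first by [].
      + by move=> z _; rewrite lee_fin.
      + apply/measurable_EFinP; apply: measurableT_comp => //; apply: measurable_funM => //.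
        apply: measurable_funM; last exact: mW.
        exact: (measurableT_comp muc (@pair1_measurable _ _ R (R2 R) y)).
      + by apply/measurable_EFinP; apply: measurable_funM => //; exact: mW.
      + by move=> z _; rewrite lee_fin mul1r.
  rewrite ge0_integralZr//; last 2 first.
    by move=> y _; rewrite lee_fin.
    by apply: area_int_ge0 => z; rewrite lee_fin mulr_ge0.
    rewrite ione BE muleA -EFinM; apply: lte_mul_pinfty => //.
    by rewrite lee_fin mulr_ge0// ltW.
  exact/measurable_EFinP.
have muW : emeas (fun z => (u z * W z)%:E) by apply: rmeas_emeas; exact: rmeasurableM.
have iW' : area.-integrable setT (fun x => (W (cplx x))%:E).
  apply/integrableP; split; first exact/measurable_EFinP.
  by under eq_integral do rewrite /= ger0_norm//.
have iuW : area.-integrable setT (fun x => (u (cplx x) * W (cplx x))%:E).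
  apply: (le_integrable measurableT _ _ (integrableZl measurableT `|M| iW')).
    exact: muW.
  move=> x _; have := uM' 0 (cplx x); rewrite cexpE/= expR0 cos0 sin0 mul1r mul1r => h.
  by rewrite /= lee_fin (le_trans h)// ler_norm.
(* Plane integrated first: rotation invariance of area and of W. *)
have I1 : (\int[leb]_y \int[area]_z (f (y, z))%:E)%E =
   ((pi *+ 2)%:E * area_int (fun z => (u z * W z)%:E))%E.
  have [r rE] : exists r, area_int (fun z => (u z * W z)%:E) = r%:E.
    exists (fine (area_int (fun z => (u z * W z)%:E))); rewrite fineK//.
    exact: (integrable_fin_num measurableT iuW).
  transitivity (\int[leb]_y ((one y)%:E * r%:E))%E.
    apply: eq_integral => y _; rewrite -rE -(@area_int_rot _ (cexp (cplx (0, y))) (fun z => (u z * W z)%:E))//; last first.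
      by rewrite cabs_cexp/= expR0.
    rewrite /f/= /one indicE; case: (y \in _) => /=.
      rewrite mul1e area_intE; apply: eq_integral => z _.
      by rewrite mul1r Wrot// cabs_cexp/= expR0.
    by rewrite mul0e; apply: integral0_eq => z _; rewrite mul0r.
  rewrite integralZr//; last exact: integrable_indic_itv.
  by rewrite ione rE.
(* Angle integrated first: the circle mean [umean]. *)
have I2 : (\int[area]_z \int[leb]_y (f (y, z))%:E)%E =
   (((pi *+ 2) * k)%:E * area_int (fun z => (W z)%:E))%E.
  transitivity (\int[area]_z (((pi *+ 2) * k)%:E * (W (cplx z))%:E))%E.
    apply: eq_integral => z _; rewrite /f/=; have [->|Wz] := eqVneq (W (cplx z)) 0.
      by rewrite mule0; apply: integral0_eq => y _; rewrite !mulr0.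
    have iu : leb.-integrable `[0, pi *+ 2] (fun y => (u (cexp (cplx (0, y)) * cplx z))%:E).
      apply: (@le_integrable _ _ _ leb _ _ _ (fun=> `|M|%:E)) => //.
      - apply/measurable_EFinP; apply: measurable_funTS.
        exact: (measurableT_comp muc (@pair2_measurable _ _ R (R2 R) z)).
      - move=> y _; rewrite /= lee_fin normr_id (le_trans _ (ler_norm M))//.
        by apply: uM; rewrite Wrot// cabs_cexp/= expR0.
      - by apply: (@continuous_integrable_itv _ (fun=> `|M|)) => x; exact: cvg_cst.
    rewrite -(umean (cplx z)) /Rintegral fineK; last exact: integrable_fin_num.
    rewrite -integralZr// [RHS]integral_mkcond; apply: eq_integral => y _.
    rewrite patchE /one indicE; case: (y \in _) => /=; first by rewrite mul1r EFinM.
    by rewrite mul0r.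
  by rewrite integralZl.
have := integral12_prod_meas1 fi; rewrite -(integral21_prod_meas1 fi).
rewrite /fubini_F /fubini_G I1 I2 EFinM -muleA => /(congr1 (fun x => ((pi *+ 2)^-1)%:E * x)%E).
by rewrite !(muleA (_^-1)%:E) -!EFinM mulVf ?gt_eqF// !mul1e.
Qed.

End MeanValue.

(** * The reproducing kernel *)

Section Reproducing.
Context {R : realType}.
Local Notation C := R[i].
Local Notation Re := complex.Re.
Local Notation Im := complex.Im.
Implicit Types (F f : C -> C).

Definition gauss2 (z : C) : R := expR (- (2 * cabs z ^+ 2)).

Lemma gauss2_ge0 z : 0 <= gauss2 z. Proof. exact: expR_ge0. Qed.

Lemma rmeasurable_gauss2 : rmeasurable gauss2.
Proof.
apply: rmeasurable_expR; apply: rmeasurableN; apply: rmeasurableM.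
  exact: rmeasurable_cst.
exact: rmeasurableX rmeasurable_cabs_id.
Qed.

Lemma measurable_disc (r : R) : measurable_fun setT (fun x : R2 R => cabs (cplx x) < r).
Proof.
apply: (@measurable_fun_ltr _ _ _ setT (fun x => cabs (cplx x)) (fun=> r)) => //.
exact: rmeasurable_cabs_id.
Qed.

(** Dominated convergence along an exhausting sequence of sets; discs and squares are both used. *)
Lemma area_int_tail (G : C -> R) (b : nat -> C -> bool) (e : R) :
  rmeasurable G -> (forall z, 0 <= G z) -> (area_int (fun z => (G z)%:E) < +oo)%E ->
  (forall n, measurable_fun setT (fun x : R2 R => b n (cplx x))) ->
  (forall z, exists N, forall n, (N <= n)%N -> b n z) -> 0 < e ->
  exists N, forall n, (N <= n)%N ->
    (area_int (fun z => (if b n z then 0 else G z)%:E) <= e%:E)%E.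
Proof.
move=> mG G0 iG mb bz e0.
pose f_ n (x : R2 R) : \bar R := (if b n (cplx x) then 0 else G (cplx x))%:E.
have mf_ n : measurable_fun setT (f_ n).
  apply: (@rmeas_emeas _ (fun z => if b n z then 0 else G z)).
  by apply: rmeasurable_if => //; exact: rmeasurable_cst.
have f0 n x : (0 <= f_ n x)%E by rewrite /f_ lee_fin; case: ifP.
pose g (x : R2 R) : \bar R := (G (cplx x))%:E.
have H1 : {ae area, forall x, setT x -> f_ ^~ x @ \oo --> (cst 0%E : R2 R -> \bar R) x}.
  apply: aeW => x _; have [N HN] := bz (cplx x).
  by apply: cvg_near_cst; exists N => // n /= Nn; rewrite /f_ HN.
have H2 : area.-integrable setT g.
  apply/integrableP; split; first exact: (rmeas_emeas mG).
  by under eq_integral do rewrite /= ger0_norm//.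
have H3 : {ae area, forall x n, setT x -> (`|f_ n x| <= g x)%E}.
  apply: aeW => x n _; rewrite /f_ /g/= lee_fin; case: ifP => _; rewrite ?normr0//.
  by rewrite ger0_norm.
have [_ _] := dominated_convergence measurableT mf_ (@measurable_cst _ _ _ _ _ _) H1 H2 H3.
rewrite integral0 => /fine_cvgP[[N1 _ HN1] /cvgrPdist_le/(_ e e0)[N2 _ HN2]].
exists (maxn N1 N2) => n; rewrite geq_max => /andP[n1 n2].
have /fineK E := HN1 _ n1; have := HN2 _ n2; rewrite /= sub0r normrN => h.
rewrite area_intE -[X in (X <= _)%E]E lee_fin; apply: le_trans h; exact: ler_norm.
Qed.

(** On a disc F is bounded, as [radial_average] demands, and its circle means are all F 0 = 0. *)
Lemma cint_disc_eq0 F (r : R) : entire F -> F 0 = 0 ->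
  let W z := if cabs z < r then gauss2 z else 0 in
  cint (fun z => F z * (W z)%:C%C) = 0.
Proof.
move=> eF F0 W.
have mW : rmeasurable W.
  apply: rmeasurable_if; [exact: measurable_disc|exact: rmeasurable_gauss2|exact: rmeasurable_cst].
have W0 z : 0 <= W z by rewrite /W; case: ifP => _ //; exact: gauss2_ge0.
have Wg z : W z <= gauss2 z by rewrite /W; case: ifP => _ //; exact: gauss2_ge0.
have Wrot c z : cabs c = 1 -> W (c * z) = W z by move=> c1; rewrite /W /gauss2 cabsM c1 mul1r.
have iW : (area_int (fun z => (W z)%:E) < +oo)%E.
  apply: (@le_lt_trans _ _ (area_int (fun z => (gauss2 z)%:E))).
    apply: le_area_int => [||z|z]; rewrite ?lee_fin//; apply: rmeas_emeas => //.
    exact: rmeasurable_gauss2.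
  by rewrite area_int_gauss2 ltry.
have [M HM] := entire_bounded r eF.
have WM z : W z != 0 -> cabs (F z) <= M.
  by rewrite /W; case: ifP => [zr _|_]; [exact: HM|rewrite eqxx].
have mF := entire_cmeasurable eF.
have mean z := circle_mean z eF.
apply: complex_ext; rewrite /cint/=.
  rewrite (_ : (fun xy => _) = fun xy => Re (F (cplx xy)) * W (cplx xy)); last first.
    by apply/funext => x; rewrite ReM/= mulr0 subr0.
  transitivity (fine (area_int (fun z => (Re (F z) * W z)%:E))) => //.
  rewrite (@radial_average _ (fun z => Re (F z)) W M 0 mF.1 mW W0 Wrot iW) ?mul0e// => z.
    by move=> /WM; apply: le_trans; exact: Re_le.
  by have := congr1 (fun z : C => Re z) (mean z); rewrite F0 mulr0/= mulr0.
rewrite (_ : (fun xy => _) = fun xy => Im (F (cplx xy)) * W (cplx xy)); last first.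
  by apply/funext => x; rewrite ImM/= mulr0 add0r.
transitivity (fine (area_int (fun z => (Im (F z) * W z)%:E))) => //.
rewrite (@radial_average _ (fun z => Im (F z)) W M 0 mF.2 mW W0 Wrot iW) ?mul0e// => z.
  by move=> /WM; apply: le_trans; exact: Im_le.
by have := congr1 (fun z : C => Im z) (mean z); rewrite F0 mulr0/= mulr0.
Qed.

Lemma cmeasurable_gauss2 : cmeasurable (fun z => (gauss2 z)%:C%C).
Proof. exact: cmeasurable_real rmeasurable_gauss2. Qed.

Lemma cint_gauss2 : cint (fun z => (gauss2 z)%:C%C) = (pi / 2)%:C%C.
Proof.
apply: complex_ext; rewrite /cint/= /Rintegral; last by rewrite integral0.
by have := @area_int_gauss2 R; rewrite area_intE => ->.
Qed.

Lemma cintegrable_gauss2 : cintegrable (fun z => (gauss2 z)%:C%C).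
Proof.
apply: (le_cintegrable cmeasurable_gauss2 rmeasurable_gauss2).
  by move=> z; rewrite cabs_real ger0_norm// gauss2_ge0.
by rewrite area_int_gauss2 ltry.
Qed.

(** With F 0 subtracted, the integral over each disc vanishes, so the whole integral is bounded by
    the tails of an integrable function. *)
Lemma gauss_mean F : entire F -> cintegrable (fun z => F z * (gauss2 z)%:C%C) ->
  cint (fun z => F z * (gauss2 z)%:C%C) = F 0 * (pi / 2)%:C%C.
Proof.
wlog F0 : F / F 0 = 0.
  move=> H eF iF; pose F1 z := F z + (- F 0).
  have eF1 : entire F1 := entireD eF (@entire_cst R (- F 0)).
  have e z : F1 z * (gauss2 z)%:C%C = F z * (gauss2 z)%:C%C - F 0 * (gauss2 z)%:C%C.
    by rewrite /F1 mulrBl.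
  have i2 := cintegrableZ (F 0) cintegrable_gauss2.
  have iF1 : cintegrable (fun z => F1 z * (gauss2 z)%:C%C).
    by under eq_fun do rewrite e; exact: cintegrableB.
  have := H F1 _ eF1 iF1; rewrite /F1 subrr mul0r => /(_ erefl).
  rewrite -/F1; under eq_fun do rewrite e.
  by rewrite cintB// cintZ// ?cint_gauss2 => [/eqP|]; [rewrite subr_eq0 => /eqP|exact: cintegrable_gauss2].
move=> eF iF; rewrite F0 mul0r; apply: cabs_eps_eq0 => e e0.
have [mH iH] := (cintegrableP _).1 iF.
have [N HN] := @area_int_tail (fun z => cabs (F z * (gauss2 z)%:C%C)) (fun n z => cabs z < n%:R) e
  (rmeasurable_cabs mH) (fun z => cabs_ge0 _) iH (fun n => measurable_disc n%:R)
  (fun z => ltac:(exists (Num.truncn (cabs z)).+1 => n zn; apply: (lt_le_trans (truncnS_gt _)); by rewrite ler_nat)) e0.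
pose W z := if cabs z < N%:R then gauss2 z else 0.
have d z : F z * (gauss2 z)%:C%C - F z * (W z)%:C%C =
    if cabs z < N%:R then 0 else F z * (gauss2 z)%:C%C.
  by rewrite /W; case: ifP => _; rewrite ?subrr// mulr0 subr0.
have iW : cintegrable (fun z => F z * (W z)%:C%C).
  apply: (le_cintegrable _ (rmeasurable_cabs mH) _ iH).
    apply: cmeasurableM; first exact: entire_cmeasurable.
    apply: cmeasurable_real; apply: rmeasurable_if;
      [exact: measurable_disc|exact: rmeasurable_gauss2|exact: rmeasurable_cst].
  by move=> z; rewrite /W; case: ifP => // _; rewrite mulr0 cabs0 cabs_ge0.
have W0 : cint (fun z => F z * (W z)%:C%C) = 0 := cint_disc_eq0 N%:R eF F0.
have -> : cint (fun z => F z * (gauss2 z)%:C%C) =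
    cint (fun z => F z * (gauss2 z)%:C%C) - cint (fun z => F z * (W z)%:C%C).
  by rewrite W0 subr0.
rewrite -cintB//.
rewrite -lee_fin; apply: (le_trans (cabs_cint (cintegrableB iF iW))).
under eq_fun do rewrite d.
have := HN N (leqnn _); congr (_ <= _)%E; congr area_int; apply/funext => z.
by case: ifP; rewrite ?cabs0.
Qed.

Definition fock_kernel (w z : C) : C := cexp (2 * z * conjc w).

Lemma cabs_fock_kernel w z : cabs (fock_kernel w z) = expR (2 * Re (z * conjc w)).
Proof. by rewrite /fock_kernel cabs_cexp; congr expR; rewrite !cE/=; ring. Qed.

(** Translating by w turns the integrand into e^(-2|u|^2) times the entire function f(u + w) e^(-2 u
    conj w), whose value at 0 is f(w); then [gauss_mean] applies. *)
Lemma reproducing f w : entire f ->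
  cintegrable (pair_integrand f (fock_kernel w)) ->
  Lambda (fock_kernel w) f = f w.
Proof.
move=> ef iH; have [mH aH] := (cintegrableP _).1 iH.
pose F u := f (u + w) * cexp (- 2 * u * conjc w).
have e u : pair_integrand f (fock_kernel w) (u + w) = F u * (gauss2 u)%:C%C.
  rewrite /pair_integrand /F /fock_kernel /gauss2 -!mulrA; congr (_ * _).
  rewrite cexp_conj -!cexp_real -!cexpD; congr cexp.
  apply: complex_ext; rewrite !cE/= ?cabs_sqr ?cE/=; ring.
have eF : entire F.
  apply: entireM; first exact: (entire_comp ef (entireD (@entire_id R) (@entire_cst R w))).
  apply: (entire_comp (@entire_cexp R)).
  exact: (entireZr (entireZ (@entire_id R))).
have iF : cintegrable (fun u => F u * (gauss2 u)%:C%C).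
  apply/cintegrableP; split.
    apply: cmeasurableM; [exact: entire_cmeasurable|exact: cmeasurable_gauss2].
  have := @area_int_translate _ w (fun z => (cabs (pair_integrand f (fock_kernel w) z))%:E)
    (rmeas_emeas (rmeasurable_cabs mH)).
  by under eq_fun do rewrite e; move=> ->.
rewrite /Lambda -(cint_translate w mH); under eq_fun do rewrite e.
rewrite gauss_mean// /F add0r mulr0 mul0r cexp0 mulr1 mulrCA -rmorphM.
rewrite (_ : 2 / pi * (pi / 2) = 1 :> R) ?mulr1//.
by rewrite mulrA divfK ?gt_eqF ?pi_gt0// divff.
Qed.

End Reproducing.

(** * Variable exponent modulars *)

Section VariableExponent.
Context {R : realType}.
Local Notation C := R[i].
Local Notation Re := complex.Re.
Local Notation Im := complex.Im.
Implicit Types (q X Y U : C -> R) (z w : C).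

(** The modular of a nonnegative function without weight; [modularE] absorbs the Gaussian weight
    into the function. *)
Definition vmod q X : \bar R := area_int (fun z => (X z `^ q z)%:E).

Lemma rmeasurable_powR q X : rmeasurable q -> rmeasurable X ->
  (forall z, 1 <= q z) -> (forall z, 0 <= X z) -> rmeasurable (fun z => X z `^ q z).
Proof.
move=> mq mX q1 X0.
have -> : (fun z => X z `^ q z) = (fun z => if 0 < X z then expR (q z * ln (X z)) else 0).
  apply/funext => z; rewrite /powR; have [x0|x0] := ltP 0 (X z); first by rewrite gt_eqF.
  by rewrite (@le_anti _ _ (X z) 0) ?x0 ?X0// eqxx gt_eqF// (lt_le_trans ltr01).
apply: rmeasurable_if; last exact: rmeasurable_cst.
  by apply: (@measurable_fun_ltr _ _ _ setT (fun=> 0) (fun x => X (cplx x))).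
apply: rmeasurable_expR; apply: rmeasurableM => //.
by apply: (rmeasurable_comp (@measurable_ln R)).
Qed.

Lemma powR_le_id (t r : R) : 0 <= t <= 1 -> 1 <= r -> t `^ r <= t.
Proof.
move=> /andP[t0 t1] r1; have [->|tn0] := eqVneq t 0.
  by rewrite powR0// gt_eqF// (lt_le_trans ltr01).
by rewrite ge1r_powR// lt0r tn0 t0.
Qed.

Lemma le_powR (s t r : R) : 0 <= s -> s <= t -> 0 <= r -> s `^ r <= t `^ r.
Proof. by move=> s0 st r0; rewrite ge0_ler_powR// ?nnegrE// (le_trans s0). Qed.

(** The midpoint is at most the larger of s and t. This plays the part of the triangle inequality
    for modulars, uniformly in the exponent. *)
Lemma powR_half_sum (s t r : R) : 0 <= s -> 0 <= t -> 0 <= r ->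
  ((s + t) / 2) `^ r <= s `^ r + t `^ r.
Proof.
move=> s0 t0 r0; wlog st : s t s0 t0 / s <= t.
  by move=> H; have [|/ltW] := leP s t => st; [exact: H|rewrite addrC [leRHS]addrC H].
apply: (@le_trans _ _ (t `^ r)); last by rewrite lerDr powR_ge0.
by apply: le_powR => //; [rewrite divr_ge0// addr_ge0|lra].
Qed.

Lemma le_vmod q X Y : rmeasurable q -> rmeasurable X -> rmeasurable Y ->
  (forall z, 1 <= q z) -> (forall z, 0 <= X z) -> (forall z, X z <= Y z) ->
  (vmod q X <= vmod q Y)%E.
Proof.
move=> mq mX mY q1 X0 XY.
apply: le_area_int => [||z|z]; rewrite ?lee_fin ?powR_ge0//.
- exact: (rmeas_emeas (rmeasurable_powR mq mX q1 X0)).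
- exact: (rmeas_emeas (rmeasurable_powR mq mY q1 (fun z => le_trans (X0 z) (XY z)))).
- by apply: le_powR => //; exact: le_trans (q1 z).
Qed.

(** Since q >= 1, dividing by K >= 1 divides the modular by at least K: a bound on the modular
    becomes a bound on the norm. *)
Lemma vmod_scale q X (K : R) : rmeasurable q -> rmeasurable X ->
  (forall z, 1 <= q z) -> (forall z, 0 <= X z) -> 1 <= K ->
  (vmod q X <= K%:E)%E -> (vmod q (fun z => (X z / K)%R) <= 1)%E.
Proof.
move=> mq mX q1 X0 K1 XK; have K0 : 0 < K by exact: lt_le_trans K1.
apply: (@le_trans _ _ (K^-1%:E * vmod q X)%E); last first.
  apply: (@le_trans _ _ (K^-1%:E * K%:E)%E); last by rewrite -EFinM mulVf ?gt_eqF.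
  by rewrite lee_pmul2l// lte_fin invr_gt0.
rewrite /vmod -area_intZl; last 3 first.
- by rewrite invr_ge0 ltW.
- exact: (rmeas_emeas (rmeasurable_powR mq mX q1 X0)).
- by move=> z; rewrite lee_fin powR_ge0.
apply: le_area_int => [||z|z]; rewrite -?EFinM ?lee_fin ?powR_ge0//.
- apply: rmeas_emeas; apply: rmeasurable_powR => //.
    by apply: rmeasurableM => //; exact: rmeasurable_cst.
  by move=> z; rewrite divr_ge0// ltW.
- under eq_fun do rewrite -EFinM.
  by apply: rmeas_emeas; apply: rmeasurableM; [exact: rmeasurable_cst|exact: rmeasurable_powR].
- rewrite powRM ?X0 ?invr_ge0 ?(ltW K0)// mulrC ler_wpM2r ?powR_ge0//.
  by apply: powR_le_id => //; rewrite invr_ge0 (ltW K0)/= invf_le1.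
Qed.

Definition log_decay q (s c : R) := forall z, `|q z - s| <= c / ln (expR 1 + cabs z).

Lemma poisson_weight_gt0 z : 0 < poisson_weight z.
Proof. by rewrite mulr_gt0// invr_gt0 oneDsqr_gt0. Qed.

Lemma rmeasurable_poisson_weight : rmeasurable (@poisson_weight R).
Proof.
have mV : measurable_fun setT (fun x : R => (1 + x ^+ 2)^-1).
  by apply: continuous_measurable_fun; exact: continuous_oneDsqrV.
apply: rmeasurableM; apply: (rmeasurable_comp mV);
  [exact: rmeasurable_Re|exact: rmeasurable_Im].
Qed.

(** Each factor 1 + x^2 is at most (e + |z|)^2, so each contributes 2 to the constant. *)
Lemma ln_poisson_weight z : - ln (poisson_weight z) <= 4 * ln (expR 1 + cabs z).
Proof.
have e2 : 2 <= expR 1 :> R by have := @expR_ge1Dx R 1; lra.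
have c0 := cabs_ge0 z; set S := expR 1 + cabs z.
have S0 : 0 < S by rewrite /S; lra.
have b (x : R) : `|x| <= cabs z -> ln (1 + x ^+ 2) <= 2 * ln S.
  move=> xz; have -> : 2 * ln S = ln (S ^+ 2) by rewrite lnXn// mulr_natl.
  rewrite ler_ln ?posrE ?oneDsqr_gt0 ?exprn_gt0//.
  rewrite -(real_normK (num_real x)) /S.
  have : `|x| ^+ 2 <= cabs z ^+ 2 by rewrite lerXn2r ?nnegrE.
  rewrite sqrrD; have : 1 <= expR 1 ^+ 2 :> R by rewrite expr_ge1//; lra.
  have : 0 <= expR 1 * cabs z *+ 2 by rewrite mulrn_wge0// mulr_ge0// expR_ge0.
  lra.
rewrite /poisson_weight lnM ?posrE ?invr_gt0 ?oneDsqr_gt0// !lnV ?posrE ?oneDsqr_gt0//.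
have := b _ (Re_le z); have := b _ (Im_le z); lra.
Qed.

(* Either t is below the integrable weight, or |ln t| is at most
   4 ln (e + |z|), and then the exponents differ harmlessly. *)
Lemma powR_exponent_shift (t q s c : R) z : 0 <= t <= 1 -> 1 <= q ->
  `|q - s| <= c / ln (expR 1 + cabs z) ->
  t `^ q <= expR (4 * c) * t `^ s + poisson_weight z.
Proof.
move=> /andP[t0 t1] q1 qs; have P0 := poisson_weight_gt0 z.
have [tP|Pt] := leP t (poisson_weight z).
  apply: (@le_trans _ _ t); first by rewrite powR_le_id// t0.
  by apply: (le_trans tP); rewrite lerDr mulr_ge0 ?expR_ge0 ?powR_ge0.
have t0' : 0 < t by exact: lt_trans Pt.
rewrite -[leLHS]addr0 lerD ?(ltW P0)//.
rewrite /powR gt_eqF// -expRD ler_expR -lerBlDr -mulrBl.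
have lt0 : ln t <= 0 by rewrite ln_le0.
have l1 : 1 <= ln (expR 1 + cabs z).
  rewrite -[X in X <= _](@expRK R 1) ler_ln ?posrE ?expR_gt0 ?lerDl ?cabs_ge0//.
  by rewrite ltr_pwDl ?expR_gt0 ?cabs_ge0.
have lP := ln_poisson_weight z.
have tP : ln (poisson_weight z) <= ln t by rewrite ler_ln ?posrE// ltW.
apply: (@le_trans _ _ (`|q - s| * - ln t)).
  by rewrite -[X in X <= _]mulrNN ler_wpM2r ?oppr_ge0// -normrN ler_norm.
apply: (@le_trans _ _ (c / ln (expR 1 + cabs z) * (4 * ln (expR 1 + cabs z)))).
  by apply: ler_pM; rewrite ?oppr_ge0//; lra.
by rewrite mulrCA divfK ?gt_eqF// (lt_le_trans ltr01).
Qed.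

End VariableExponent.

(** * Convolution with a Gaussian *)

Section GaussConvolution.
Context {R : realType}.
Local Notation C := R[i].
Local Notation Re := complex.Re.
Local Notation Im := complex.Im.
Implicit Types (q X Y U : C -> R) (z w : C).

(** Normalised to mass 1, so that convolving with it is averaging and Jensen's inequality is
    available. *)
Definition gker z : R := pi^-1 * expR (- cabs z ^+ 2).

Lemma gker_ge0 z : 0 <= gker z.
Proof. by rewrite mulr_ge0 ?expR_ge0// invr_ge0 pi_ge0. Qed.

Lemma gker_le1 z : gker z <= 1.
Proof.
rewrite /gker mulr_ile1 ?invr_ge0 ?pi_ge0 ?expR_ge0//.
  by rewrite invf_le1 ?pi_gt0// (le_trans _ (pi_ge2 R))// ler1n.
by rewrite -expR0 ler_expR oppr_le0 sqr_ge0.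
Qed.

Lemma gkerC z w : gker (z - w) = gker (w - z).
Proof. by rewrite /gker cabs_distC. Qed.

Lemma rmeasurable_gker : rmeasurable gker.
Proof.
apply: rmeasurableM; first exact: rmeasurable_cst.
apply: rmeasurable_expR; apply: rmeasurableN.
exact: rmeasurableX rmeasurable_cabs_id.
Qed.

Lemma measurable_gker_sub :
  measurable_fun setT (fun p : R2 R * R2 R => gker (cplx p.1 - cplx p.2)).
Proof.
rewrite (_ : (fun p => _) = (gker \o cplx) \o (fun p : R2 R * R2 R =>
  (p.1.1 - p.2.1, p.1.2 - p.2.2))); last first.
  by apply/funext => -[[a b] [c d]].
apply: (measurableT_comp rmeasurable_gker).
have m11 : measurable_fun setT (fun p : R2 R * R2 R => p.1.1).
  by apply: (measurableT_comp measurable_fst); exact: measurable_fst.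
have m12 : measurable_fun setT (fun p : R2 R * R2 R => p.1.2).
  by apply: (measurableT_comp measurable_snd); exact: measurable_fst.
have m21 : measurable_fun setT (fun p : R2 R * R2 R => p.2.1).
  by apply: (measurableT_comp measurable_fst); exact: measurable_snd.
have m22 : measurable_fun setT (fun p : R2 R * R2 R => p.2.2).
  by apply: (measurableT_comp measurable_snd); exact: measurable_snd.
by apply: measurable_fun_pair; exact: measurable_funB.
Qed.

Lemma area_int_gker : area_int (fun z => (gker z)%:E) = 1%E.
Proof.
rewrite /gker; under eq_fun do rewrite EFinM.
rewrite area_intZl ?area_int_gauss.
- by rewrite -EFinM mulVf ?gt_eqF ?pi_gt0.
- by rewrite invr_ge0 pi_ge0.
- apply: rmeas_emeas; apply: rmeasurable_expR; apply: rmeasurableN.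
  exact: rmeasurableX rmeasurable_cabs_id.
- by move=> z; rewrite lee_fin expR_ge0.
Qed.

Lemma area_int_gker_sub w : area_int (fun z => (gker (z - w))%:E) = 1%E.
Proof.
rewrite (@ge0_area_int_translate _ (- w) (fun z => (gker z)%:E)).
- exact: area_int_gker.
- exact: rmeas_emeas rmeasurable_gker.
- by move=> z; rewrite lee_fin gker_ge0.
Qed.

Lemma rmeasurable_gker_sub z : rmeasurable (fun w => gker (z - w)).
Proof.
case: z => a b.
exact: (measurableT_comp measurable_gker_sub (@pair1_measurable _ _ (R2 R) (R2 R) (a, b))).
Qed.

Definition gconv U z : \bar R := area_int (fun w => (U w * gker (z - w))%:E).

Lemma gconv_ge0 U z : (forall w, 0 <= U w) -> (0 <= gconv U z)%E.
Proof. by move=> U0; apply: area_int_ge0 => w; rewrite lee_fin mulr_ge0 ?gker_ge0. Qed.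

Lemma measurable_gconv_integrand U : rmeasurable U ->
  measurable_fun setT (fun p : R2 R * R2 R => (U (cplx p.2) * gker (cplx p.1 - cplx p.2))%:E).
Proof.
move=> mU; apply/measurable_EFinP; apply: measurable_funM; last exact: measurable_gker_sub.
exact: (measurableT_comp mU measurable_snd).
Qed.

Lemma emeas_gconv U : rmeasurable U -> (forall w, 0 <= U w) -> emeas (gconv U).
Proof.
move=> mU U0.
have := @measurable_fun_fubini_tonelli_F _ _ _ _ _ area _ (measurable_gconv_integrand mU).
by apply => x; rewrite lee_fin mulr_ge0 ?gker_ge0.
Qed.

Lemma area_int_gconv U : rmeasurable U -> (forall w, 0 <= U w) ->
  area_int (gconv U) = area_int (fun w => (U w)%:E).
Proof.
move=> mU U0; rewrite /gconv (@ge0_area_int_tonelli _ (fun z w => (U w * gker (z - w))%:E)).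
- congr area_int; apply/funext => w; under eq_fun do rewrite EFinM.
  rewrite area_intZl//; first by rewrite area_int_gker_sub mule1.
    under eq_fun do rewrite gkerC; exact: rmeas_emeas (rmeasurable_gker_sub w).
  by move=> z; rewrite lee_fin gker_ge0.
- exact: measurable_gconv_integrand.
- by move=> z w; rewrite lee_fin mulr_ge0 ?gker_ge0.
Qed.

Lemma rmeasurable_gconv_sec U z : rmeasurable U -> rmeasurable (fun w => U w * gker (z - w)).
Proof. by move=> mU; apply: rmeasurableM => //; exact: rmeasurable_gker_sub. Qed.

Lemma le_gconv U X z : rmeasurable U -> rmeasurable X ->
  (forall w, 0 <= U w) -> (forall w, U w <= X w) -> (gconv U z <= gconv X z)%E.
Proof.
move=> mU mX U0 UX; apply: le_area_int => [||w|w].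
- exact: rmeas_emeas (rmeasurable_gconv_sec z mU).
- exact: rmeas_emeas (rmeasurable_gconv_sec z mX).
- by rewrite lee_fin mulr_ge0 ?gker_ge0.
- by rewrite lee_fin ler_wpM2r ?gker_ge0.
Qed.

Lemma gconvD U X z : rmeasurable U -> rmeasurable X ->
  (forall w, 0 <= U w) -> (forall w, 0 <= X w) ->
  gconv (fun w => U w + X w) z = (gconv U z + gconv X z)%E.
Proof.
move=> mU mX U0 X0; rewrite /gconv -area_intD.
- by congr area_int; apply/funext => w; rewrite mulrDl.
- exact: rmeas_emeas (rmeasurable_gconv_sec z mU).
- exact: rmeas_emeas (rmeasurable_gconv_sec z mX).
- by move=> w; rewrite lee_fin mulr_ge0 ?gker_ge0.
- by move=> w; rewrite lee_fin mulr_ge0 ?gker_ge0.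
Qed.

Lemma gconvZ (k : R) U z : 0 <= k -> rmeasurable U -> (forall w, 0 <= U w) ->
  gconv (fun w => k * U w) z = (k%:E * gconv U z)%E.
Proof.
move=> k0 mU U0; rewrite /gconv -area_intZl//.
- by congr area_int; apply/funext => w; rewrite -mulrA.
- exact: rmeas_emeas (rmeasurable_gconv_sec z mU).
- by move=> w; rewrite lee_fin mulr_ge0 ?gker_ge0.
Qed.

Lemma gconv1 z : gconv (fun=> 1) z = 1%E.
Proof.
rewrite /gconv -(area_int_gker_sub z); congr area_int; apply/funext => w.
by rewrite mul1r gkerC.
Qed.

(** The kernel is at most 1. This turns an integral bound into a uniform one, which is how large
    values are controlled. *)
Lemma gconv_le_area_int U z : rmeasurable U -> (forall w, 0 <= U w) ->
  (gconv U z <= area_int (fun w => (U w)%:E))%E.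
Proof.
move=> mU U0; apply: le_area_int => [||w|w].
- exact: rmeas_emeas (rmeasurable_gconv_sec z mU).
- exact: rmeas_emeas.
- by rewrite lee_fin mulr_ge0 ?gker_ge0.
- by rewrite lee_fin ler_piMr ?gker_le1.
Qed.

(* Integrating Young's inequality u t^(s-1) <= u^s/s + (1-1/s) t^s at t = gconv U z. *)
Lemma gconv_jensen U z (s : R) : 1 <= s -> rmeasurable U ->
  (forall w, 0 <= U w <= 1) ->
  ((fine (gconv U z) `^ s)%R%:E <= gconv (fun w => (U w `^ s)%R) z)%E.
Proof.
move=> s1 mU U01.
have U0 w : 0 <= U w by have /andP[] := U01 w.
have U1 w : U w <= 1 by have /andP[] := U01 w.
have mUs : rmeasurable (fun w => U w `^ s).
  by apply: (@rmeasurable_powR _ (fun=> s)) => //; exact: rmeasurable_cst.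
have Us0 w : 0 <= U w `^ s by exact: powR_ge0.
have le1 V : rmeasurable V -> (forall w, 0 <= V w) -> (forall w, V w <= 1) -> (gconv V z <= 1)%E.
  by move=> mV V0 V1; rewrite -(gconv1 z); apply: le_gconv => //; exact: rmeasurable_cst.
have fin V : rmeasurable V -> (forall w, 0 <= V w) -> (forall w, V w <= 1) ->
    gconv V z = (fine (gconv V z))%:E.
  move=> mV V0 V1; rewrite fineK// ge0_fin_numE ?gconv_ge0//.
  by apply: le_lt_trans (le1 V mV V0 V1) _; exact: ltry.
have tE := fin U mU U0 U1; set t := fine (gconv U z) in tE *.
have AE := fin _ mUs Us0 (fun w => le_trans (powR_le_id (U01 w) s1) (U1 w)).
set A := fine (gconv (fun w => U w `^ s) z) in AE *.
have t0 : 0 <= t by rewrite -lee_fin -tE gconv_ge0.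
rewrite AE lee_fin.
(* The conjugate exponent of s = 1 is infinite, so Young's inequality is kept for s > 1. *)
have [s1'|s1'] := eqVneq s 1.
  rewrite s1' powRr1// -lee_fin -tE -AE; apply: le_gconv => // w.
  by rewrite s1' powRr1.
have sgt1 : 1 < s by rewrite lt_neqAle eq_sym s1'.
pose r := s / (s - 1).
have sn0 : s != 0 by rewrite gt_eqF// (lt_trans ltr01).
have sm0 : s - 1 != 0 by rewrite gt_eqF// subr_gt0.
have rV : r^-1 = 1 - s^-1 by rewrite /r invf_div; field.
have r0 : 0 < r by rewrite divr_gt0 ?subr_gt0// (lt_trans ltr01).
have rr : s^-1 + r^-1 = 1 by rewrite rV; ring.
have s0 : 0 < s by exact: lt_trans sgt1.
have ts : (t `^ (s - 1)) `^ r = t `^ s by rewrite -powRrM /r mulrCA divff// mulr1.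
have yng w : t `^ (s - 1) * U w <= s^-1 * U w `^ s + r^-1 * t `^ s.
  have := conjugate_powR (U0 w) (powR_ge0 t (s - 1)) s0 r0 rr.
  by rewrite ts mulrC (mulrC _ s^-1) (mulrC _ r^-1).
have k0 : 0 <= r^-1 * t `^ s by rewrite mulr_ge0 ?powR_ge0// invr_ge0 ltW.
have cst : gconv (fun=> r^-1 * t `^ s) z = (r^-1 * t `^ s)%:E.
  transitivity (gconv (fun w => r^-1 * t `^ s * 1) z).
    by congr gconv; apply/funext => w; rewrite mulr1.
  rewrite (@gconvZ _ (fun=> 1))// ?gconv1 ?mule1//; exact: rmeasurable_cst.
have : (gconv (fun w => (t `^ (s - 1) * U w)%R) z <=
        gconv (fun w => (s^-1 * U w `^ s + r^-1 * t `^ s)%R) z)%E.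
  apply: le_gconv => //.
  - by apply: rmeasurableM => //; exact: rmeasurable_cst.
  - by apply: rmeasurableD; [apply: rmeasurableM => //|]; exact: rmeasurable_cst.
  - by move=> w; rewrite mulr_ge0 ?powR_ge0.
rewrite gconvZ ?powR_ge0// gconvD; last 4 first.
- by apply: rmeasurableM => //; exact: rmeasurable_cst.
- exact: rmeasurable_cst.
- by move=> w; rewrite mulr_ge0 ?powR_ge0// invr_ge0 ltW.
- by move=> w; rewrite mulr_ge0 ?powR_ge0// invr_ge0 ltW.
rewrite gconvZ ?invr_ge0 ?(ltW s0)//.
(* This reads t^s <= A/s + (1 - 1/s) t^s; the finite last term is moved to the left. *)
rewrite cst tE AE -!EFinM -EFinD lee_fin mulrC mulr_powRB1// rV => h.
have : s^-1 * t `^ s <= s^-1 * A by lra.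
by rewrite ler_pM2l// invr_gt0.
Qed.

End GaussConvolution.

Section GaussBound.
Context {R : realType}.
Local Notation C := R[i].
Implicit Types (q X Y U : C -> R) (z w : C).

(* Split X at height 1.  The part above is dominated by X^q, whose convolution is
   at most 1; on the part below the exponent can be frozen to the constant s,
   where Jensen's inequality applies. *)
Lemma gconv_bounded q (s c : R) : rmeasurable q -> (forall z, 1 <= q z) ->
  1 <= s -> 0 <= c -> log_decay q s c ->
  exists2 K : R, 1 <= K & forall X Y, rmeasurable X -> rmeasurable Y ->
    (forall z, 0 <= X z) -> (forall z, 0 <= Y z) -> (vmod q X <= 1)%E ->
    (forall z, ((Y z)%:E <= gconv X z)%E) ->
    (vmod q (fun z => (Y z / K)%R) <= 1)%E.
Proof.
move=> mq q1 s1 c0 qs.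
(* D is the cost of one change of exponent, pi^2 the mass of [poisson_weight]. In K0 the 1 comes
   from large values, and D(D + pi^2) + pi^2 from changing q z to s outside the convolution and s to
   q w inside it. The final constant doubles K0 because of [powR_half_sum]. *)
pose D := expR (4 * c); pose K0 := 1 + D * (D + pi ^+ 2) + pi ^+ 2.
have D0 : 0 <= D by exact: expR_ge0.
have p20 : 0 <= pi ^+ 2 :> R by exact: sqr_ge0.
have K01 : 1 <= K0.
  by rewrite /K0 -addrA lerDl addr_ge0// mulr_ge0// addr_ge0.
have K00 : 0 < K0 by exact: lt_le_trans K01.
have q0 z : 0 <= q z by exact: le_trans (q1 z).
exists (2 * K0); first lra.
move=> X Y mX mY X0 Y0 Xq YX.
pose E := @poisson_weight R; have mE := @rmeasurable_poisson_weight R.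
have E0 z : 0 <= E z by exact: ltW (poisson_weight_gt0 z).
pose Q z := X z `^ q z.
have mQ : rmeasurable Q by exact: rmeasurable_powR.
have Q0 z : 0 <= Q z by exact: powR_ge0.
pose big z := 1 <= X z.
have mbig : measurable_fun setT (fun x : R2 R => big (cplx x)).
  exact: (@measurable_fun_ler _ _ _ setT (fun=> 1) (fun x => X (cplx x))).
pose X1 z := if big z then X z else 0; pose X2 z := if big z then 0 else X z.
have mX1 : rmeasurable X1 by apply: rmeasurable_if => //; exact: rmeasurable_cst.
have mX2 : rmeasurable X2 by apply: rmeasurable_if => //; exact: rmeasurable_cst.
have X10 z : 0 <= X1 z by rewrite /X1; case: ifP.
have X20 z : 0 <= X2 z by rewrite /X2; case: ifP.
have X21 z : X2 z <= 1.
  by rewrite /X2 /big; case: ifP => // /negbT; rewrite -ltNge => /ltW.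
have X1Q z : X1 z <= Q z.
  by rewrite /X1 /Q /big; case: ifP => x1; [exact: le1r_powR|exact: powR_ge0].
have X2Q z : X2 z `^ q z <= Q z.
  by apply: le_powR => //; rewrite /X2; case: ifP.
have VQ z : (gconv Q z <= 1)%E by apply: le_trans Xq; exact: gconv_le_area_int.
have V1 z : (gconv X1 z <= gconv Q z)%E by exact: le_gconv.
have V2 z : (gconv X2 z <= 1)%E.
  by rewrite -(gconv1 z); apply: le_gconv => //; exact: rmeasurable_cst.
have e1 z : gconv X1 z = (fine (gconv X1 z))%:E.
  rewrite fineK// ge0_fin_numE ?gconv_ge0//.
  by apply: le_lt_trans (le_trans (V1 z) (VQ z)) _; exact: ltry.
have e2 z : gconv X2 z = (fine (gconv X2 z))%:E.
  by rewrite fineK// ge0_fin_numE ?gconv_ge0//; apply: le_lt_trans (V2 z) _; exact: ltry.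
have mX2s : rmeasurable (fun w => X2 w `^ s).
  by apply: (@rmeasurable_powR _ (fun=> s)) => //; exact: rmeasurable_cst.
have mDQ : rmeasurable (fun w => D * Q w).
  by apply: rmeasurableM => //; exact: rmeasurable_cst.
have DQ0 w : 0 <= D * Q w by exact: mulr_ge0.
have pw z : (((Y z / 2) `^ q z)%R%:E <=
    gconv Q z + (D%:E * (D%:E * gconv Q z + gconv E z) + (E z)%:E))%E.
  set y1 := fine (gconv X1 z); set y2 := fine (gconv X2 z).
  have y10 : 0 <= y1 by rewrite fine_ge0// gconv_ge0.
  have y20 : 0 <= y2 by rewrite fine_ge0// gconv_ge0.
  have y11 : y1 <= 1 by rewrite -lee_fin -e1 (le_trans (V1 z)).
  have y21 : y2 <= 1 by rewrite -lee_fin -e2.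
  have Yy : Y z <= y1 + y2.
    rewrite -lee_fin EFinD -e1 -e2 -gconvD//; apply: le_trans (YX z) _.
    apply: le_gconv => //; first exact: rmeasurableD.
    by move=> w; rewrite /X1 /X2; case: ifP => _; rewrite ?addr0 ?add0r.
  have h : (Y z / 2) `^ q z <= y1 + (D * y2 `^ s + E z).
    apply: (@le_trans _ _ (((y1 + y2) / 2) `^ q z)).
      by apply: le_powR => //; rewrite ?divr_ge0// ler_wpM2r// invr_ge0.
    apply: (le_trans (powR_half_sum y10 y20 (q0 z))); apply: lerD.
      by rewrite powR_le_id// y10.
    by apply: powR_exponent_shift => //; rewrite y20.
  apply: (@le_trans _ _ (y1%:E + (D%:E * (y2 `^ s)%:E + (E z)%:E))%E).
    by rewrite -EFinM -!EFinD lee_fin.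
  apply: leeD; first by rewrite -e1.
  apply: leeD => //; apply: lee_wpmul2l; first by rewrite lee_fin.
  apply: (le_trans (gconv_jensen z s1 mX2 _)); first by move=> w; rewrite X20 X21.
  rewrite -gconvZ// -gconvD//; apply: le_gconv => //.
  - exact: rmeasurableD.
  - by move=> w; exact: powR_ge0.
  - move=> w; apply: (@le_trans _ _ (D * X2 w `^ q w + E w)).
      by apply: powR_exponent_shift => //; [rewrite X20 X21|rewrite distrC].
    by rewrite lerD2r ler_wpM2l.
have mYh : rmeasurable (fun z => Y z / 2).
  by apply: rmeasurableM => //; exact: rmeasurable_cst.
have Yh0 z : 0 <= Y z / 2 by rewrite divr_ge0.
have half : (vmod q (fun z => (Y z / 2)%R) <= K0%:E)%E.
  have emQ := emeas_gconv mQ Q0; have emE := emeas_gconv mE E0.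
  have gQ0 z : (0 <= gconv Q z)%E by exact: gconv_ge0.
  have gE0 z : (0 <= gconv E z)%E by exact: gconv_ge0.
  have em1 : emeas (fun z => D%:E * gconv Q z)%E.
    by apply: emeasurable_funM => //; exact: measurable_cst.
  have em2 : emeas (fun z => D%:E * gconv Q z + gconv E z)%E by exact: emeasurable_funD.
  have em3 : emeas (fun z => D%:E * (D%:E * gconv Q z + gconv E z))%E.
    by apply: emeasurable_funM => //; exact: measurable_cst.
  have emEE := rmeas_emeas mE.
  have En0 z : (0 <= (E z)%:E)%E by rewrite lee_fin.
  have em4 : emeas (fun z => D%:E * (D%:E * gconv Q z + gconv E z) + (E z)%:E)%E.
    exact: emeasurable_funD.
  have n1 z : (0 <= D%:E * gconv Q z)%E by rewrite mule_ge0.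
  have n2 z : (0 <= D%:E * gconv Q z + gconv E z)%E by rewrite adde_ge0.
  have n3 z : (0 <= D%:E * (D%:E * gconv Q z + gconv E z))%E by rewrite mule_ge0.
  have n4 z : (0 <= D%:E * (D%:E * gconv Q z + gconv E z) + (E z)%:E)%E by rewrite adde_ge0// lee_fin.
  apply: (@le_trans _ _ (area_int (fun z => gconv Q z + (D%:E * (D%:E * gconv Q z + gconv E z) + (E z)%:E))%E)).
    apply: le_area_int => [||z|z]; last exact: pw.
    - exact: rmeas_emeas (rmeasurable_powR mq mYh q1 Yh0).
    - exact: emeasurable_funD.
    - by rewrite lee_fin powR_ge0.
  rewrite (area_intD emQ em4 gQ0 n4) (area_intD em3 emEE n3 En0) (area_intZl D0 em2 n2).
  rewrite (area_intD em1 emE n1 gE0) (area_intZl D0 emQ gQ0) !area_int_gconv//.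
  rewrite area_int_poisson_weight.
  have -> : K0%:E = (1 + (D%:E * (D%:E + (pi ^+ 2)%:E) + (pi ^+ 2)%:E))%E.
    by rewrite /K0 -addrA.
  apply: leeD; first exact: Xq.
  apply: leeD => //; apply: lee_wpmul2l => //; apply: leeD => //.
  by rewrite -[leRHS]mule1; apply: lee_wpmul2l.
have -> : (fun z => Y z / (2 * K0)) = (fun z => Y z / 2 / K0).
  by apply/funext => z; rewrite invfM mulrA.
exact: vmod_scale half.
Qed.

End GaussBound.

(** * Norms and the Fock projection *)

Section FockNorm.
Context {R : realType}.
Local Notation C := R[i].
Local Notation Re := complex.Re.
Local Notation Im := complex.Im.
Implicit Types (p q X Y U : C -> R) (z w : C) (f g h : C -> C).

Definition fw f z : R := cabs (f z) * expR (- cabs z ^+ 2).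

Lemma fw_ge0 f z : 0 <= fw f z. Proof. by rewrite mulr_ge0 ?cabs_ge0 ?expR_ge0. Qed.

Lemma rmeasurable_fw f : cmeasurable f -> rmeasurable (fw f).
Proof.
move=> mf; apply: rmeasurableM; first exact: rmeasurable_cabs.
by apply: rmeasurable_expR; apply: rmeasurableN; exact: rmeasurableX rmeasurable_cabs_id.
Qed.

Lemma modularE q f : modular q f = vmod q (fw f).
Proof.
congr area_int; apply/funext => z; rewrite /fw powRM ?cabs_ge0 ?expR_ge0//.
by rewrite -expRM mulrC mulNr mulrC (mulrC (q z)).
Qed.

Lemma modular_div q f (l : R) : 0 < l ->
  modular q (fun z => f z / l%:C%C) = vmod q (fun z => fw f z / l).
Proof.
move=> l0; rewrite modularE; congr vmod; apply/funext => z.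
by rewrite /fw cabsM cabsV cabs_real gtr0_norm// mulrAC.
Qed.

Lemma modular_mul q f (l : R) : 0 < l ->
  modular q (fun z => l%:C%C * f z) = vmod q (fun z => l * fw f z).
Proof.
move=> l0; rewrite modularE; congr vmod; apply/funext => z.
by rewrite /fw cabsM cabs_real gtr0_norm// mulrA.
Qed.

Section exponent.
Variable q : C -> R.
Hypothesis mq : rmeasurable q.
Hypothesis q1 : forall z, 1 <= q z.

Lemma rmeasurable_divr X (l : R) : rmeasurable X -> rmeasurable (fun z => X z / l).
Proof. by move=> mX; apply: rmeasurableM => //; exact: rmeasurable_cst. Qed.

(** [inL] asks for a finite modular v at some scale; [vmod_scale] with 1 + v brings it below 1, the
    form in which the norm is defined. *)
Lemma inLP f : inL q f <-> cmeasurable f /\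
  exists2 l : R, 0 < l & (vmod q (fun z => (fw f z / l)%R) <= 1)%E.
Proof.
split=> [[mf [l [l0 fl]]]|[mf [l l0 fl]]]; split => //.
- move: fl; rewrite modular_mul// => fl.
  have mX : rmeasurable (fun z => l * fw f z).
    by apply: rmeasurableM; [exact: rmeasurable_cst|exact: rmeasurable_fw].
  have X0 z : 0 <= l * fw f z by rewrite mulr_ge0 ?fw_ge0// ltW.
  pose v := fine (vmod q (fun z => l * fw f z)).
  have v0 : (0 <= vmod q (fun z => (l * fw f z)%R))%E.
    by apply: area_int_ge0 => z; rewrite lee_fin powR_ge0.
  have vE : vmod q (fun z => l * fw f z) = v%:E by rewrite fineK// ge0_fin_numE.
  have vp : 0 <= v by rewrite -lee_fin -vE.
  have := @vmod_scale _ q _ (1 + v) mq mX q1 X0.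
  rewrite vE lee_fin lerDl vp lerDr ler01 => /(_ isT isT) H.
  exists ((1 + v) / l); first by rewrite divr_gt0// ltr_pwDl.
  move: H; congr (_ <= _)%E; congr vmod; apply/funext => z.
  by rewrite invf_div; ring.
- exists l^-1; rewrite invr_gt0; split => //; rewrite modular_mul ?invr_gt0//.
  rewrite (_ : (fun z => _) = (fun z => fw f z / l)).
    exact: le_lt_trans fl (ltry _).
  by apply/funext => z; rewrite mulrC.
Qed.

Lemma Lnorm_le f (l : R) : 0 < l -> (vmod q (fun z => (fw f z / l)%R) <= 1)%E ->
  Lnorm_var q f <= l.
Proof.
move=> l0 fl; apply: ge_inf; last by split => //; rewrite modular_div.
by exists 0 => x [/ltW].
Qed.

Lemma Lnorm_ge0 f : 0 <= Lnorm_var q f.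
Proof.
rewrite /Lnorm_var; set S := [set _ | _].
(* Outside the space the set may be empty, where [inf] takes the default value 0. *)
have [[x Sx]|/set0P/negP/negbNE/eqP ->] := pselect (S !=set0).
  by apply: lb_le_inf; [exists x|move=> y [/ltW]].
by rewrite inf0.
Qed.

Lemma vmod_div_mono f (l l' : R) : cmeasurable f -> 0 < l -> l <= l' ->
  (vmod q (fun z => (fw f z / l)%R) <= 1)%E -> (vmod q (fun z => (fw f z / l')%R) <= 1)%E.
Proof.
move=> mf l0 ll; have l0' : 0 < l' by exact: lt_le_trans ll.
apply: le_trans; apply: le_vmod => // [||z|z].
- by apply: rmeasurable_divr; exact: rmeasurable_fw.
- by apply: rmeasurable_divr; exact: rmeasurable_fw.
- by rewrite divr_ge0 ?fw_ge0// ltW.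
- by rewrite ler_wpM2l ?fw_ge0// lef_pV2.
Qed.

(** Strict inequality yields an admissible scale below l, and the modular decreases with the scale;
    this avoids the question whether the infimum is attained. *)
Lemma vmod_gt_Lnorm f (l : R) : inL q f -> Lnorm_var q f < l ->
  (vmod q (fun z => (fw f z / l)%R) <= 1)%E.
Proof.
move=> /inLP[mf [l0 l00 fl0]] fl.
have [|l1 [l10 h] l1l] := inf_lt _ fl.
  by exists l0; split => //; rewrite modular_div.
by apply: (vmod_div_mono mf l10 (ltW l1l)); rewrite -modular_div.
Qed.

Lemma gconv_fin f z : inL q f -> (gconv (fw f) z < +oo)%E.
Proof.
move=> /inLP[mf [l l0 fl]].
have mX := rmeasurable_divr l (rmeasurable_fw mf).
have X0 w : 0 <= fw f w / l by rewrite divr_ge0 ?fw_ge0// ltW.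
have mQ := rmeasurable_powR mq mX q1 X0.
have mQ1 : rmeasurable (fun w => 1 + (fw f w / l) `^ q w).
  by apply: rmeasurableD => //; exact: rmeasurable_cst.
have Q10 w : 0 <= 1 + (fw f w / l) `^ q w by rewrite addr_ge0 ?powR_ge0.
(* For q >= 1 one has x <= 1 + x^q; the 1 has convolution 1, and x^q has integral at most 1. *)
apply: (@le_lt_trans _ _ (gconv (fun w => (l * (1 + (fw f w / l) `^ q w))%R) z)).
  apply: le_gconv => [|||w]; [exact: rmeasurable_fw| |exact: fw_ge0|].
    by apply: rmeasurableM => //; exact: rmeasurable_cst.
  rewrite -ler_pdivrMl// mulrC; have [h|h] := leP 1 (fw f w / l).
    by apply: (le_trans (le1r_powR h (q1 w))); rewrite lerDr.
  by rewrite (le_trans (ltW h))// lerDl powR_ge0.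
rewrite gconvZ ?(ltW l0)// gconvD//; last first.
- by move=> w; rewrite powR_ge0.
- exact: rmeasurable_cst.
rewrite gconv1 lte_mul_pinfty ?lee_fin ?(ltW l0)//.
apply: (@le_lt_trans _ _ (1 + 1)%E); last by rewrite -EFinD ltry.
rewrite leeD2l//; apply: le_trans fl; apply: gconv_le_area_int => // w.
exact: powR_ge0.
Qed.

(** Completing the square: 2 Re(w conj z) - 2|w|^2 = |z|^2 - |w|^2 - |z - w|^2. The factor pi undoes
    the normalisation of [gker]. *)
Lemma cabs_pair_kernel f z w : cabs (pair_integrand f (fock_kernel z) w) =
  pi * expR (cabs z ^+ 2) * (fw f w * gker (z - w)).
Proof.
rewrite /pair_integrand !cabsM cabs_conj cabs_fock_kernel cabs_real ger0_norm ?expR_ge0//.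
rewrite /fw /gker.
have -> : pi * expR (cabs z ^+ 2) * (cabs (f w) * expR (- cabs w ^+ 2) *
   (pi^-1 * expR (- cabs (z - w) ^+ 2))) = (pi / pi) * (cabs (f w) * (expR (cabs z ^+ 2) *
   expR (- cabs w ^+ 2) * expR (- cabs (z - w) ^+ 2))) by ring.
rewrite divff ?gt_eqF ?pi_gt0// mul1r -mulrA -!expRD; congr (_ * expR _).
by rewrite !cabs_sqr !cE; ring.
Qed.

Lemma cmeasurable_pair f h : cmeasurable f -> cmeasurable h -> cmeasurable (pair_integrand f h).
Proof.
move=> mf mh; apply: cmeasurableM; last exact: cmeasurable_gauss2.
by apply: cmeasurableM => //; exact: cmeasurable_conj.
Qed.

Lemma cmeasurable_kernel z : cmeasurable (fock_kernel z).
Proof.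
apply: cmeasurable_cexp; apply: cmeasurableM; last exact: cmeasurable_cst.
by apply: cmeasurableM; [exact: cmeasurable_cst|exact: cmeasurable_id].
Qed.

Lemma area_int_pair_kernel f z : cmeasurable f ->
  area_int (fun w => (cabs (pair_integrand f (fock_kernel z) w))%:E) =
  ((pi * expR (cabs z ^+ 2))%:E * gconv (fw f) z)%E.
Proof.
move=> mf; rewrite /gconv -area_intZl.
- by congr area_int; apply/funext => w; rewrite cabs_pair_kernel EFinM.
- by rewrite mulr_ge0 ?expR_ge0 ?pi_ge0.
- exact: rmeas_emeas (rmeasurable_gconv_sec z (rmeasurable_fw mf)).
- by move=> w; rewrite lee_fin mulr_ge0 ?fw_ge0 ?gker_ge0.
Qed.

Lemma cintegrable_pair_kernel f z : inL q f ->
  cintegrable (pair_integrand f (fock_kernel z)).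
Proof.
move=> Lf; have [mf _] := Lf; apply/cintegrableP; split.
  by apply: cmeasurable_pair => //; exact: cmeasurable_kernel.
rewrite area_int_pair_kernel// lte_mul_pinfty ?lee_fin ?mulr_ge0 ?expR_ge0 ?pi_ge0//.
exact: gconv_fin.
Qed.

Definition fproj f z : C := Lambda (fock_kernel z) f.

(** The factor e^(|z|^2) of [cabs_pair_kernel] cancels against the weight at z, and (2/pi) pi leaves
    the constant 2. *)
Lemma fw_fproj f z : inL q f -> ((fw (fproj f) z)%:E <= gconv (fun w => (2 * fw f w)%R) z)%E.
Proof.
move=> Lf; have [mf _] := Lf; have := cabs_cint (cintegrable_pair_kernel z Lf).
rewrite area_int_pair_kernel// gconvZ//; [|exact: rmeasurable_fw|exact: fw_ge0].
have g0 : (0 <= gconv (fw f) z)%E by apply: gconv_ge0; exact: fw_ge0.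
rewrite -(fineK (_ : gconv (fw f) z \is a fin_num)); last first.
  by rewrite ge0_fin_numE// gconv_fin.
set t := fine _; rewrite -!EFinM !lee_fin => h.
rewrite /fw /fproj /Lambda cabsM cabs_real ger0_norm ?divr_ge0 ?pi_ge0//.
apply: (@le_trans _ _ (2 / pi * (pi * expR (cabs z ^+ 2) * t) * expR (- cabs z ^+ 2))).
  by rewrite ler_wpM2r ?expR_ge0// ler_wpM2l// divr_ge0 ?pi_ge0.
have -> : 2 / pi * (pi * expR (cabs z ^+ 2) * t) * expR (- cabs z ^+ 2) =
  2 * t * (pi^-1 * pi) * (expR (cabs z ^+ 2) * expR (- cabs z ^+ 2)) by ring.
by rewrite mulVf ?gt_eqF ?pi_gt0// -expRD subrr expR0 !mulr1.
Qed.

(** [gconv_bounded] is applied to [fw g] divided by an admissible scale l, then l decreases to the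
    norm. Measurability of [fproj g] is assumed here because it will follow, where needed, from
    [fproj g] being entire. *)
Lemma fproj_bounded (s c : R) : 1 <= s -> 0 <= c -> log_decay q s c ->
  exists2 K : R, 0 < K & forall g, inL q g -> cmeasurable (fproj g) ->
    inL q (fproj g) /\ Lnorm_var q (fproj g) <= K * Lnorm_var q g.
Proof.
move=> s1 c0 qs; have [K K1 HK] := gconv_bounded mq q1 s1 c0 qs.
have K0 : 0 < K by exact: lt_le_trans K1.
exists (2 * K); first by rewrite mulr_gt0.
move=> g Lg mP; have [mg _] := Lg.
have key (l : R) : 0 < l -> (vmod q (fun z => (fw g z / l)%R) <= 1)%E ->
    (vmod q (fun z => (fw (fproj g) z / (2 * K * l))%R) <= 1)%E.
  move=> l0 gl; have l20 : 0 < 2 * l by rewrite mulr_gt0.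
  have := HK (fun z => fw g z / l) (fun z => fw (fproj g) z / (2 * l)).
  rewrite (_ : (fun z => fw (fproj g) z / (2 * l) / K) =
               (fun z => fw (fproj g) z / (2 * K * l))); last first.
    by apply/funext => z; field; rewrite (gt_eqF K0) (gt_eqF l0).
  apply=> //.
  - exact: rmeasurable_divr (rmeasurable_fw mg).
  - exact: rmeasurable_divr (rmeasurable_fw mP).
  - by move=> z; rewrite divr_ge0 ?fw_ge0// ltW.
  - by move=> z; rewrite divr_ge0 ?fw_ge0// ltW.
  move=> z; have := fw_fproj z Lg.
  have -> : (fun w => 2 * fw g w) = (fun w => 2 * l * (fw g w / l)).
    by apply/funext => w; field; rewrite (gt_eqF l0).
  rewrite gconvZ ?(ltW l20)//; last 2 first.
  - exact: rmeasurable_divr (rmeasurable_fw mg).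
  - by move=> w; rewrite divr_ge0 ?fw_ge0// ltW.
  move=> h; have -> : ((fw (fproj g) z / (2 * l))%:E =
      ((2 * l)^-1)%:E * (fw (fproj g) z)%:E)%E by rewrite -EFinM mulrC.
  have i0 : (0 <= ((2 * l)^-1)%:E)%E by rewrite lee_fin invr_ge0 ltW.
  apply: (le_trans (lee_wpmul2l i0 h)).
  by rewrite muleA -EFinM mulVf ?mul1e// (gt_eqF l20).
split.
  have [_ [l l0 gl]] := (inLP g).1 Lg; apply/inLP; split => //.
  by exists (2 * K * l); [rewrite !mulr_gt0|exact: key].
apply/ler_addgt0Pr => e e0; have K20 : 0 < 2 * K by rewrite mulr_gt0.
have l0 : 0 < Lnorm_var q g + e / (2 * K) by rewrite ltr_wpDl ?Lnorm_ge0 ?divr_gt0.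
have -> : 2 * K * Lnorm_var q g + e = 2 * K * (Lnorm_var q g + e / (2 * K)).
  by rewrite mulrDr (mulrC _ (e / _)) divfK// gt_eqF.
apply: Lnorm_le; first by rewrite mulr_gt0.
by apply: key => //; apply: vmod_gt_Lnorm => //; rewrite ltrDl divr_gt0.
Qed.

End exponent.
End FockNorm.

(** * Log-Hoelder exponents and conjugates *)

Section Plog.
Context {R : realType}.
Local Notation C := R[i].
Local Notation Re := complex.Re.
Local Notation Im := complex.Im.
Implicit Types (p q X Y U : C -> R) (z w : C) (f g h : C -> C).

Lemma Plog_continuous p : Plog p -> forall z (e : R), 0 < e ->
  exists2 r : R, 0 < r & forall h : C, cabs h < r -> `|p (z + h) - p z| <= e.
Proof.
move=> [_ [_ [_ [[c [c0 H]] _]]]] z e e0.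
(* The radius solves c / ln(1/|h|) <= e, within the range 1/2 of the hypothesis. *)
exists (Num.min 2^-1 (expR (- (c / e)))); first by rewrite lt_min invr_gt0 expR_gt0 ltr0n.
move=> h; rewrite lt_min => /andP[h1 h2].
have [->|hn0] := eqVneq h 0; first by rewrite addr0 subrr normr0 ltW.
have hp := cabs_gt0 hn0.
have := H (z + h) z; rewrite (addrC z) addrK hp h1 => /(_ isT) /le_trans; apply.
have hl : c / e <= ln ((cabs h)^-1).
  rewrite lnV ?posrE// lerNr -[leRHS]expRK ler_ln ?posrE ?expR_gt0//; exact: ltW.
have ce : 0 < c / e by rewrite divr_gt0.
by rewrite ler_pdivrMr ?(lt_le_trans ce)// mulrC -ler_pdivrMr.
Qed.

Definition open_box (x y r : R) : set (R2 R) :=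
  (`]x - r, x + r[ `*` `]y - r, y + r[)%classic.

Lemma area_box_gt0 (x y r : R) : 0 < r -> (0 < area (open_box x y r))%E.
Proof.
move=> r0; rewrite /open_box /area /areaM product_measure1E//; [|exact: measurable_itv..].
have H (u : R) (B : set R := (`]u - r, u + r[)%classic) : (0 < @lebesgue_measure R B)%E.
  by rewrite lebesgue_measure_itv/= lte_fin ifT -?EFinB ?lte_fin; lra.
exact: mule_gt0 (H x) (H y).
Qed.

(** An essential lower bound holds off a null set; if p z < a, continuity keeps p below a on a whole
    box around z, which has positive area. *)
Lemma Plog_lower p : Plog p -> exists2 a : R, 1 < a & forall z, a <= p z.
Proof.
move=> Pp; have [_ [pm _]] := Pp.
have [a [a1 ha]] : exists a : R, 1 < a /\ (a%:E <= p_minus p)%E.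
  (* The essential infimum is extended-real; at +oo the number 2 serves as [a]. *)
  move: pm; case: (p_minus p) => [r|_|]//; last by exists 2; rewrite ltr1n leey.
  by rewrite lte_fin => r1; exists r.
exists a => // z; rewrite leNgt; apply/negP => za.
have /ess_infP[N [mN N0 HN]] := ha.
have d0 : 0 < (a - p z) / 2 by rewrite divr_gt0// subr_gt0.
have [r r0 H] := Plog_continuous Pp z d0.
have r20 : 0 < r / 2 by rewrite divr_gt0.
have := area_box_gt0 (Re z) (Im z) r20; rewrite lt_neqAle => /andP[/negP + _]; apply.
rewrite eq_sym -measure_le0 -N0; apply: le_measure; rewrite ?inE//.
  by apply: measurableX; exact: measurable_itv.
move=> [u v]; rewrite /open_box/= !in_itv/= => -[hu hv]; apply: HN => /=.
rewrite lee_fin => ap.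
have hr : cabs (cplx (u, v) - z) < r.
  rewrite (le_lt_trans (cabs_le _))// !cE/=.
  have h1 : `|u - Re z| < r / 2 by rewrite ltr_norml; apply/andP; split; lra.
  have h2 : `|v - Im z| < r / 2 by rewrite ltr_norml; apply/andP; split; lra.
  lra.
have := H _ hr; rewrite (addrC z) subrK ler_norml => /andP[_]; lra.
Qed.

Lemma ln_eD_ge1 z : 1 <= ln (expR 1 + cabs z).
Proof.
rewrite -[X in X <= _](@expRK R 1) ler_ln ?posrE ?expR_gt0 ?lerDl ?cabs_ge0//.
by rewrite ltr_pwDl ?expR_gt0 ?cabs_ge0.
Qed.

Lemma log_decay_bounded q (s c : R) : 0 <= c -> log_decay q s c -> forall z, q z <= s + c.
Proof.
move=> c0 qs z; have := qs z; rewrite ler_norml => /andP[_ h].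
have : c / ln (expR 1 + cabs z) <= c.
  by rewrite ler_pdivrMr ?(lt_le_trans ltr01 (ln_eD_ge1 z))// ler_peMr// ln_eD_ge1.
lra.
Qed.

(** If s < a, let e be half the gap: at the real point e^(c/e), read with [expR], the exponent
    deviates from s by at most e and so falls below a. *)
Lemma log_decay_lower q (s c a : R) : 0 <= c -> log_decay q s c ->
  (forall z, a <= q z) -> a <= s.
Proof.
move=> c0 qs aq; rewrite leNgt; apply/negP => sa.
pose e := (a - s) / 2; have e0 : 0 < e by rewrite divr_gt0// subr_gt0.
pose x := expR (c / e); have x0 : 0 < x by exact: expR_gt0.
have := qs x%:C%C; rewrite cabs_real (gtr0_norm x0) => h.
have l : c / e <= ln (expR 1 + x).
  rewrite -[leLHS]expRK ler_ln ?posrE ?addr_gt0 ?expR_gt0// -/x lerDr expR_ge0//.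
have l0 : 0 < ln (expR 1 + x).
  by have := ln_eD_ge1 x%:C%C; rewrite cabs_real (gtr0_norm x0); lra.
have : c / ln (expR 1 + x) <= e by rewrite ler_pdivrMr// mulrC -ler_pdivrMr.
have := aq x%:C%C; move: h; rewrite ler_norml /e => /andP[_]; lra.
Qed.

Section conjugate.
Variables (p : C -> R) (a s c : R).
Hypotheses (mp : rmeasurable p) (a1 : 1 < a) (ap : forall z, a <= p z).
Hypotheses (c0 : 0 <= c) (ps : log_decay p s c).
Local Notation p' := (conj_exponent p).

Let p1 z : 0 < p z - 1. Proof. by move: (ap z) a1; lra. Qed.

Lemma rmeasurable_conj_exponent : rmeasurable p'.
Proof.
have -> : p' = (fun z => p z * expR (- ln (p z - 1))).
  by apply/funext => z; rewrite expRN lnK// posrE.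
apply: rmeasurableM => //; apply: rmeasurable_expR; apply: rmeasurableN.
apply: (rmeasurable_comp (@measurable_ln R)); apply: rmeasurableB => //.
exact: rmeasurable_cst.
Qed.

Lemma conj_exponent_gt1 z : 1 < p' z.
Proof. by rewrite /conj_exponent ltr_pdivlMr// mul1r; move: a1; lra. Qed.

Lemma conj_exponent_sum z : (p z)^-1 + (p' z)^-1 = 1.
Proof.
rewrite /conj_exponent invf_div; have : p z != 0 by rewrite gt_eqF//; have := p1 z; move: a1; lra.
by move=> h; field.
Qed.

(** With s' = s/(s - 1), p' - s' = -(p - s)/((p - 1)(s - 1)), and both factors of the denominator
    are at least a - 1. *)
Lemma conj_exponent_decay : log_decay p' (s / (s - 1)) (c / (a - 1) ^+ 2).
Proof.
have as' : a <= s by exact: log_decay_lower ps ap.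
move=> z; have az := ap z.
have e : p' z - s / (s - 1) = - ((p z - s) / ((p z - 1) * (s - 1))).
  by rewrite /conj_exponent; field; apply/andP; split; rewrite gt_eqF//; move: a1; lra.
have a10 : 0 < (a - 1) ^+ 2 by rewrite exprn_gt0//; move: a1; lra.
have d : (a - 1) ^+ 2 <= (p z - 1) * (s - 1) by rewrite expr2 ler_pM//; move: a1; lra.
have d0 : 0 < (p z - 1) * (s - 1) by exact: lt_le_trans d.
rewrite e normrN normrM normfV (gtr0_norm d0) mulrAC.
by apply: ler_pM; rewrite ?invr_ge0 ?(ltW d0)// lef_pV2.
Qed.

Lemma conj_exponent_conv : 1 <= s / (s - 1) /\ 0 <= c / (a - 1) ^+ 2.
Proof.
have as' : a <= s by exact: log_decay_lower ps ap.
split; first by rewrite ler_pdivlMr ?mul1r; move: a1; lra.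
by rewrite divr_ge0// sqr_ge0.
Qed.

End conjugate.
End Plog.

Local Opaque Lnorm_var area_int.

(** * Hoelder's inequality and the linear structure of the space *)

Section Holder.
Context {R : realType}.
Local Notation C := R[i].
Local Notation Re := complex.Re.
Local Notation Im := complex.Im.
Implicit Types (f g h : C -> C).

Lemma cabs_pair f h (z : C) : cabs (pair_integrand f h z) = fw f z * fw h z.
Proof.
rewrite /pair_integrand !cabsM cabs_conj cabs_real ger0_norm ?expR_ge0// /fw.
have -> : - (2 * cabs z ^+ 2) = - cabs z ^+ 2 + - cabs z ^+ 2 by ring.
by rewrite expRD; ring.
Qed.

(** Passes from scales strictly above two norms to the norms themselves; d is chosen so that k((a +
    d)(b + d) - ab) <= e. *)
Lemma le_mul_limit (x k a b : R) : 0 < k -> 0 <= a -> 0 <= b ->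
  (forall l m, a < l -> b < m -> x <= k * (l * m)) -> x <= k * (a * b).
Proof.
move=> k0 a0 b0 H; apply/ler_addgt0Pr => e e0.
pose S := a + b + 1.
have S0 : 0 < S by rewrite ltr_wpDl// addr_ge0.
pose d := Num.min 1 (e / (k * S)).
have d0 : 0 < d by rewrite lt_min ltr01 divr_gt0// mulr_gt0.
have d1 : d <= 1 by rewrite ge_min lexx.
have dS : k * S * d <= e by rewrite mulrC -ler_pdivlMr ?mulr_gt0// ge_min lexx orbT.
apply: (le_trans (H (a + d) (b + d) _ _)); rewrite ?ltrDl//.
have -> : k * ((a + d) * (b + d)) = k * (a * b) + k * ((a + b + d) * d) by ring.
rewrite lerD2l; apply: le_trans dS; rewrite -mulrA ler_pM2l// ler_pM2r//.
by rewrite /S lerD2l.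
Qed.

Section conj.
Variables p q : C -> R.
Hypotheses (mp : rmeasurable p) (mq : rmeasurable q).
Hypotheses (p1 : forall z, 1 <= p z) (q1 : forall z, 1 <= q z).
Hypothesis pq : forall z, (p z)^-1 + (q z)^-1 = 1.

(** Young's inequality pointwise, with the weights 1/p and 1/q bounded by 1 since they vary with z;
    the two modulars add up to the factor 2. *)
Lemma holder_modular f h (l m : R) : cmeasurable f -> cmeasurable h -> 0 < l -> 0 < m ->
  (vmod p (fun z => (fw f z / l)%R) <= 1)%E -> (vmod q (fun z => (fw h z / m)%R) <= 1)%E ->
  (area_int (fun z => (cabs (pair_integrand f h z))%:E) <= (2 * (l * m))%:E)%E.
Proof.
move=> mf mh l0 m0 fl hm.
have mF := rmeasurable_divr l (rmeasurable_fw mf).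
have mH := rmeasurable_divr m (rmeasurable_fw mh).
have F0 z : 0 <= fw f z / l by rewrite divr_ge0 ?fw_ge0// ltW.
have H0 z : 0 <= fw h z / m by rewrite divr_ge0 ?fw_ge0// ltW.
have mFp := rmeas_emeas (rmeasurable_powR mp mF p1 F0).
have mHq := rmeas_emeas (rmeasurable_powR mq mH q1 H0).
have Fp0 z : (0 <= ((fw f z / l) `^ p z)%:E)%E by rewrite lee_fin powR_ge0.
have Hq0 z : (0 <= ((fw h z / m) `^ q z)%:E)%E by rewrite lee_fin powR_ge0.
have lm0 : 0 <= l * m by rewrite mulr_ge0// ltW.
have mS : emeas (fun z => ((fw f z / l) `^ p z)%:E + ((fw h z / m) `^ q z)%:E)%E.
  exact: emeasurable_funD.
have S0 z : (0 <= ((fw f z / l) `^ p z)%:E + ((fw h z / m) `^ q z)%:E)%E by rewrite adde_ge0.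
apply: (@le_trans _ _ (area_int (fun z => (l * m)%:E *
    (((fw f z / l) `^ p z)%:E + ((fw h z / m) `^ q z)%:E))%E)).
  apply: le_area_int => [||z|z].
  - exact: rmeas_emeas (rmeasurable_cabs (cmeasurable_pair mf mh)).
  - by apply: emeasurable_funM => //; exact: measurable_cst.
  - by rewrite lee_fin cabs_ge0.
  - rewrite -EFinD -EFinM lee_fin cabs_pair.
    have -> : fw f z * fw h z = l * m * ((fw f z / l) * (fw h z / m)).
      by field; rewrite (gt_eqF l0) (gt_eqF m0).
    apply: ler_wpM2l => //.
    have p0 : 0 < p z by exact: lt_le_trans (p1 z).
    have q0 : 0 < q z by exact: lt_le_trans (q1 z).
    apply: (le_trans (conjugate_powR (F0 z) (H0 z) p0 q0 (pq z))).
    apply: lerD; rewrite ler_pdivrMr// ler_peMr// ?powR_ge0//.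
rewrite (area_intZl lm0 mS S0) (area_intD mFp mHq Fp0 Hq0).
apply: (@le_trans _ _ ((l * m)%:E * (1 + 1))%E).
  by apply: lee_wpmul2l; [rewrite lee_fin|exact: leeD fl hm].
by rewrite -EFinD -EFinM lee_fin mulrC.
Qed.

Lemma cintegrable_pair f h : inL p f -> inL q h -> cintegrable (pair_integrand f h).
Proof.
move=> Lf Lh; have [mf [l l0 fl]] := (inLP mp p1 f).1 Lf.
have [mh [m m0 hm]] := (inLP mq q1 h).1 Lh.
apply/cintegrableP; split; first exact: cmeasurable_pair.
exact: le_lt_trans (holder_modular mf mh l0 m0 fl hm) (ltry _).
Qed.

Lemma holder_Lambda f h : inL p f -> inL q h ->
  cabs (Lambda h f) <= 4 / pi * (Lnorm_var p f * Lnorm_var q h).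
Proof.
move=> Lf Lh; have [mf _] := Lf; have [mh _] := Lh.
apply: le_mul_limit; [by rewrite divr_gt0// pi_gt0|exact: Lnorm_ge0|exact: Lnorm_ge0|].
move=> l m fl hm.
have l0 : 0 < l by exact: le_lt_trans (Lnorm_ge0 p f) fl.
have m0 : 0 < m by exact: le_lt_trans (Lnorm_ge0 q h) hm.
have vf := vmod_gt_Lnorm mp p1 Lf fl; have vh := vmod_gt_Lnorm mq q1 Lh hm.
have := le_trans (cabs_cint (cintegrable_pair Lf Lh)) (holder_modular mf mh l0 m0 vf vh).
rewrite lee_fin /Lambda cabsM cabs_real ger0_norm ?divr_ge0 ?pi_ge0// => hc.
apply: (@le_trans _ _ (2 / pi * (2 * (l * m)))).
  by rewrite ler_wpM2l// divr_ge0 ?pi_ge0.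
by rewrite le_eqVlt; apply/orP; left; apply/eqP; ring.
Qed.

End conj.

Section closure.
Variable q : C -> R.
Hypotheses (mq : rmeasurable q) (q1 : forall z, 1 <= q z).

Lemma inLZ (a : C) f : inL q f -> inL q (fun z => a * f z).
Proof.
move=> Lf; have [mf [l l0 fl]] := (inLP mq q1 f).1 Lf.
have a0 : 0 < cabs a + 1 by rewrite ltr_wpDl ?cabs_ge0.
apply/(inLP mq q1); split; first exact: cmeasurableZ.
exists ((cabs a + 1) * l); first by rewrite mulr_gt0.
apply: le_trans fl; apply: le_vmod => // [||z|z].
- by apply: rmeasurable_divr; apply: rmeasurable_fw; exact: cmeasurableZ.
- exact: rmeasurable_divr (rmeasurable_fw mf).
- by rewrite divr_ge0 ?fw_ge0// ltW// mulr_gt0.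
- rewrite ler_pdivrMr ?mulr_gt0// {1}/fw cabsM.
  have -> : fw f z / l * ((cabs a + 1) * l) = fw f z * (cabs a + 1).
    by field; rewrite (gt_eqF l0).
  rewrite -/(fw f z) -mulrA -/(fw f z) mulrC ler_wpM2l ?fw_ge0// lerDl//.
Qed.

Lemma inLD f g : inL q f -> inL q g -> inL q (fun z => f z + g z).
Proof.
move=> Lf Lg; have [mf [l l0 fl]] := (inLP mq q1 f).1 Lf.
have [mg [m m0 gm]] := (inLP mq q1 g).1 Lg.
pose M := Num.max l m; have M0 : 0 < M by rewrite lt_max l0.
have {}fl := vmod_div_mono mq q1 mf l0 (_ : l <= M) fl.
have {}gm := vmod_div_mono mq q1 mg m0 (_ : m <= M) gm.
have {}fl : (vmod q (fun z => (fw f z / M)%R) <= 1)%E by apply: fl; rewrite le_max lexx.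
have {}gm : (vmod q (fun z => (fw g z / M)%R) <= 1)%E by apply: gm; rewrite le_max lexx orbT.
have mfg := cmeasurableD mf mg.
have mX := rmeasurable_divr (2 * M) (rmeasurable_fw mfg).
have X0 z : 0 <= fw (fun z => f z + g z) z / (2 * M) by rewrite divr_ge0 ?fw_ge0// ltW// mulr_gt0.
have mF := rmeasurable_divr M (rmeasurable_fw mf).
have mG := rmeasurable_divr M (rmeasurable_fw mg).
have F0 z : 0 <= fw f z / M by rewrite divr_ge0 ?fw_ge0// ltW.
have G0 z : 0 <= fw g z / M by rewrite divr_ge0 ?fw_ge0// ltW.
(* One factor 2 makes the midpoint in [powR_half_sum], the other rescales a modular bounded by 2. *)
apply/(inLP mq q1); split => //; exists (2 * M * 2); first by rewrite !mulr_gt0.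
rewrite (_ : (fun z => _) = (fun z => fw (fun z => f z + g z) z / (2 * M) / 2)); last first.
  by apply/funext => z; rewrite [in LHS]invfM mulrA.
apply: (vmod_scale mq mX q1 X0); first lra.
apply: (@le_trans _ _ (vmod q (fun z => (fw f z / M)%R) + vmod q (fun z => (fw g z / M)%R))%E).
  rewrite /vmod -area_intD; last 4 first.
  - exact: rmeas_emeas (rmeasurable_powR mq mF q1 F0).
  - exact: rmeas_emeas (rmeasurable_powR mq mG q1 G0).
  - by move=> z; rewrite lee_fin powR_ge0.
  - by move=> z; rewrite lee_fin powR_ge0.
  apply: le_area_int => [||z|z].
  - exact: rmeas_emeas (rmeasurable_powR mq mX q1 X0).
  - apply: emeasurable_funD.
      exact: rmeas_emeas (rmeasurable_powR mq mF q1 F0).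
    exact: rmeas_emeas (rmeasurable_powR mq mG q1 G0).
  - by rewrite lee_fin powR_ge0.
  - rewrite -EFinD lee_fin; have q0 : 0 <= q z by exact: le_trans (q1 z).
    apply: le_trans (powR_half_sum (F0 z) (G0 z) q0); apply: le_powR => //.
    have -> : (fw f z / M + fw g z / M) / 2 = (fw f z + fw g z) / (2 * M).
      by field; rewrite (gt_eqF M0).
    rewrite ler_pM2r ?invr_gt0 ?mulr_gt0// /fw -mulrDl ler_wpM2r ?expR_ge0//.
    exact: cabsD.
by rewrite -[2]/(1 + 1) EFinD; exact: (leeD fl gm).
Qed.

End closure.
End Holder.

(** * Functions of exponential growth *)

Section Growth.
Context {R : realType}.
Local Notation C := R[i].
Local Notation Re := complex.Re.
Local Notation Im := complex.Im.
Implicit Types (p q X Y U : C -> R) (z w : C) (f g h : C -> C).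

Lemma half_gauss_le_poisson_weight z : expR (- (cabs z ^+ 2 / 2)) <= 4 * poisson_weight z.
Proof.
have b (x : R) : expR (- (x ^+ 2 / 2)) <= 2 * (1 + x ^+ 2)^-1.
  rewrite expRN -[2 * _]invrK invfM invrK lef_pV2 ?posrE ?expR_gt0 ?mulr_gt0 ?oneDsqr_gt0//.
  have := expR_ge1Dx (x ^+ 2 / 2); have := sqr_ge0 x; lra.
rewrite cabs_sqr (_ : - _ = - (Re z ^+ 2 / 2) + - (Im z ^+ 2 / 2)); last by field.
rewrite expRD (_ : 4 * poisson_weight z =
  (2 * (1 + Re z ^+ 2)^-1) * (2 * (1 + Im z ^+ 2)^-1)); last by rewrite /poisson_weight; ring.
by apply: ler_pM; rewrite ?expR_ge0.
Qed.

(** Gaussian decay beats exponential growth. The scale depends on f through M alone, and linearly,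
    so that small factors in pointwise bounds become small factors in norms. *)
Lemma growth_vmod q : rmeasurable q -> (forall z, 1 <= q z) -> forall B : R,
  exists2 N : R, 0 < N & forall (M : R) f, 0 < M -> cmeasurable f ->
    (forall z, cabs (f z) <= M * expR (B * cabs z)) ->
    (vmod q (fun z => (fw f z / (M * N))%R) <= 1)%E.
Proof.
move=> mq q1 B.
(* From (B - |z|)^2 >= 0: B|z| - |z|^2 <= B^2/2 - |z|^2/2. *)
pose CB := expR (B ^+ 2 / 2); have CB0 : 0 < CB by exact: expR_gt0.
have p0 : 0 < 4 * pi ^+ 2 :> R by rewrite mulr_gt0// exprn_gt0// pi_gt0.
exists (CB * (4 * pi ^+ 2)); first exact: mulr_gt0.
move=> M f M0 mf fM; have MC0 : 0 < M * CB by exact: mulr_gt0.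
have mX := rmeasurable_divr (M * CB) (rmeasurable_fw mf).
have X0 z : 0 <= fw f z / (M * CB) by rewrite divr_ge0 ?fw_ge0 ?ltW.
rewrite (_ : (fun z => _) = (fun z => fw f z / (M * CB) / (4 * pi ^+ 2))); last first.
  by apply/funext => z; rewrite -[RHS]mulrA -invfM mulrA.
have XE z : fw f z / (M * CB) <= expR (- (cabs z ^+ 2 / 2)).
  rewrite ler_pdivrMr// /fw.
  apply: (@le_trans _ _ (M * expR (B * cabs z) * expR (- cabs z ^+ 2))).
    by rewrite ler_wpM2r ?expR_ge0.
  rewrite mulrCA -mulrA ler_pM2l// /CB -!expRD ler_expR.
  by have := sqr_ge0 (B - cabs z); rewrite sqrrB -mulr_natl; lra.
apply: (vmod_scale mq mX q1 X0).
  have := pi_ge2 R => h; have : 2 * 2 <= pi ^+ 2 :> R by rewrite expr2 ler_pM.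
  lra.
apply: (@le_trans _ _ (area_int (fun z => (4%:E * (poisson_weight z)%:E)%E))); last first.
  rewrite area_intZl ?area_int_poisson_weight//.
    exact: rmeas_emeas (@rmeasurable_poisson_weight R).
  by move=> z; rewrite lee_fin ltW// poisson_weight_gt0.
apply: le_area_int => [||z|z].
- exact: rmeas_emeas (rmeasurable_powR mq mX q1 X0).
- apply: emeasurable_funM; first exact: measurable_cst.
  exact: rmeas_emeas (@rmeasurable_poisson_weight R).
- by rewrite lee_fin powR_ge0.
- rewrite -EFinM lee_fin; apply: le_trans (half_gauss_le_poisson_weight z).
  apply: (le_trans (powR_le_id _ (q1 z))); last exact: XE.
  rewrite X0 (le_trans (XE z))// -expR0 ler_expR oppr_le0 divr_ge0// sqr_ge0//.
Qed.

Lemma growth_Lnorm q : rmeasurable q -> (forall z, 1 <= q z) -> forall B : R,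
  exists2 N : R, 0 < N & forall (M : R) f, 0 <= M -> cmeasurable f ->
    (forall z, cabs (f z) <= M * expR (B * cabs z)) ->
    inL q f /\ Lnorm_var q f <= M * N.
Proof.
move=> mq q1 B; have [N N0 HN] := growth_vmod mq q1 B; exists N => //.
move=> M f M0 mf fM.
(* Working with M' > M covers M = 0, where the scale M N would vanish. *)
have key (M' : R) : M < M' -> 0 < M' * N /\ (vmod q (fun z => (fw f z / (M' * N))%R) <= 1)%E.
  move=> MM'; have M'0 : 0 < M' by exact: le_lt_trans MM'.
  split; first exact: mulr_gt0.
  apply: HN => // z; apply: le_trans (fM z) _.
  by rewrite ler_wpM2r ?expR_ge0 ?ltW.
split.
  have [k1 k2] := key (M + 1) (ltr_pwDr ltr01 (lexx _)).
  by apply/(inLP mq q1); split => //; exists ((M + 1) * N).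
apply/ler_addgt0Pr => e e0.
have [|k1 k2] := key (M + e / N); first by rewrite ltrDl divr_gt0.
have -> : M * N + e = (M + e / N) * N by rewrite mulrDl divfK// gt_eqF.
exact: Lnorm_le k1 k2.
Qed.

Lemma entire_kernel w : entire (fock_kernel w).
Proof.
have e1 : entire (fun z : C => 2 * z * conjc w).
  exact: entireZr (entireZ (@entire_id R)).
exact: (entire_comp (@entire_cexp R) e1).
Qed.

Lemma Re_le_cabsM z w : Re (z * conjc w) <= cabs w * cabs z.
Proof.
by rewrite mulrC -(cabs_conj w) -cabsM mulrC (le_trans (ler_norm _))// Re_le.
Qed.

Lemma cabs_kernel_le w z : cabs (fock_kernel w z) <= expR (2 * cabs w * cabs z).
Proof. by rewrite cabs_fock_kernel ler_expR -mulrA ler_pM2l// Re_le_cabsM. Qed.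

Lemma fock_kernelD w d z : fock_kernel (w + d) z = fock_kernel w z * fock_kernel d z.
Proof. by rewrite /fock_kernel -cexpD rmorphD/= mulrDr. Qed.

(** K_(w+d) = K_w K_d reduces the difference to [cexp_taylor1] at 2 z conj d. In the exponent 5 = 1
    + 4: the factor |z| <= e^|z| costs 1, and 2|z||d| <= 4|z|. *)
Lemma kernel_taylor1 w d z : cabs d <= 2 ->
  cabs (fock_kernel (w + d) z - fock_kernel w z) <=
  6 * cabs d * expR ((2 * cabs w + 5) * cabs z).
Proof.
move=> d2; have z0 := cabs_ge0 z; have d0 := cabs_ge0 d.
rewrite fock_kernelD -[X in _ - X]mulr1 -mulrBr cabsM.
have -> : (2 * cabs w + 5) * cabs z = 2 * cabs w * cabs z + (cabs z + 4 * cabs z) by ring.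
rewrite expRD mulrCA; apply: ler_pM; rewrite ?cabs_ge0 ?cabs_kernel_le//.
apply: (le_trans (cexp_taylor1 _)).
rewrite !cabsM cabs_conj (_ : cabs (2 : C) = 2); last by rewrite -[2]/(2%:R)%R -(rmorph_nat (real_complex R)) cabs_real ger0_norm.
have -> : 6 * cabs d * expR (cabs z + 4 * cabs z) =
  3 * (2 * expR (cabs z) * cabs d * expR (4 * cabs z)) by rewrite expRD; ring.
rewrite ler_pM2l//; apply: ler_pM; rewrite ?mulr_ge0 ?expR_ge0//.
  rewrite ler_wpM2r// ler_pM2l//; have := expR_ge1Dx (cabs z); lra.
rewrite ler_expR; have : cabs z * cabs d <= cabs z * 2 by exact: ler_wpM2l.
lra.
Qed.

(** The kernel is holomorphic in conj w, so the linear term carries conj d. The bound |z|^2 <= 2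
    e^|z| gives 32 = 4 * 4 * 2 and the 1 in 3 = 1 + 2. *)
Lemma kernel_taylor2 w d z : cabs d <= 1 ->
  cabs (fock_kernel (w + d) z - fock_kernel w z - conjc d * (2 * z * fock_kernel w z)) <=
  32 * cabs d ^+ 2 * expR ((2 * cabs w + 3) * cabs z).
Proof.
move=> d1; have z0 := cabs_ge0 z; have d0 := cabs_ge0 d.
rewrite fock_kernelD.
have -> : fock_kernel w z * fock_kernel d z - fock_kernel w z - conjc d * (2 * z * fock_kernel w z) =
  fock_kernel w z * (fock_kernel d z - 1 - 2 * z * conjc d) by ring.
rewrite cabsM.
have -> : (2 * cabs w + 3) * cabs z = 2 * cabs w * cabs z + (cabs z + 2 * cabs z) by ring.
rewrite expRD mulrCA; apply: ler_pM; rewrite ?cabs_ge0 ?cabs_kernel_le//.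
apply: (le_trans (cexp_taylor2 _)).
rewrite !cabsM cabs_conj (_ : cabs (2 : C) = 2); last by rewrite -[2]/(2%:R)%R -(rmorph_nat (real_complex R)) cabs_real ger0_norm.
have -> : 32 * cabs d ^+ 2 * expR (cabs z + 2 * cabs z) =
  4 * (4 * cabs d ^+ 2 * (2 * expR (cabs z)) * expR (2 * cabs z)) by rewrite expRD; ring.
rewrite ler_pM2l//; apply: ler_pM; rewrite ?sqr_ge0 ?expR_ge0//.
  have -> : (2 * cabs z * cabs d) ^+ 2 = 4 * cabs d ^+ 2 * (cabs z ^+ 2) by ring.
  apply: ler_wpM2l; first by rewrite mulr_ge0 ?sqr_ge0.
  by have := @expR_ge1Dxn R (cabs z) 1 z0; rewrite (_ : 2`! = 2%N)//; lra.
rewrite ler_expR; have : cabs z * cabs d <= cabs z * 1 by exact: ler_wpM2l.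
lra.
Qed.

End Growth.

(** * Pairings with bounded functions supported in rectangles *)

Section RectSupport.
Context {R : realType}.
Local Notation C := R[i].
Local Notation Re := complex.Re.
Local Notation Im := complex.Im.
Implicit Types (z w : C) (f g h r : C -> C).

(** Half-open, so that cutting a rectangle gives disjoint pieces and [rect_defect] is exactly
    additive. *)
Definition inQ (a b c d : R) z := (a <= Re z < b) && (c <= Im z < d).

Lemma measurable_inQ a b c d : measurable_fun setT (fun x : R2 R => inQ a b c d (cplx x)).
Proof.
apply: measurable_and; apply: measurable_and.
- by apply: (@measurable_fun_ler _ _ _ setT (fun=> a) (fun x : R2 R => x.1)) => //; exact: measurable_fst.
- by apply: (@measurable_fun_ltr _ _ _ setT (fun x : R2 R => x.1) (fun=> b)) => //; exact: measurable_fst.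
- by apply: (@measurable_fun_ler _ _ _ setT (fun=> c) (fun x : R2 R => x.2)) => //; exact: measurable_snd.
- by apply: (@measurable_fun_ltr _ _ _ setT (fun x : R2 R => x.2) (fun=> d)) => //; exact: measurable_snd.
Qed.

Lemma area_int_inQ a b c d : a <= b -> c <= d ->
  area_int (fun z => (if inQ a b c d z then 1 else 0)%:E) = ((b - a) * (d - c))%:E.
Proof.
move=> ab cd.
have H (u v : R) : u <= v -> (\int[@lebesgue_measure R]_x (\1_(`[u, v[%classic) x : R)%:E = (v - u)%:E)%E.
  move=> uv; rewrite integral_indic//= setIT -[LHS]/(@lebesgue_measure R (`[u, v[)%classic).
  rewrite lebesgue_measure_itv/= lte_fin; case: ltP => [_|vu]; first by rewrite -EFinB.
  by rewrite (@le_anti _ _ u v) ?uv// subrr.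
have := @ge0_area_int_prod R (\1_(`[a, b[%classic)) (\1_(`[c, d[%classic)).
rewrite (H a b ab) (H c d cd) -EFinM => <- //.
congr area_int; apply/funext => z; congr EFin; rewrite !indicE /inQ !mem_setE/= !in_itv/=.
by case: (a <= Re z < b); case: (c <= Im z < d) => /=; rewrite ?mulr1 ?mulr0.
Qed.

Lemma gauss2_le1 z : gauss2 z <= 1.
Proof. by rewrite /gauss2 -expR0 ler_expR oppr_le0 mulr_ge0// sqr_ge0. Qed.

(** The area of the rectangle is kept as a factor, while the Gaussian and 2/pi are bounded by 1. *)
Lemma rect_pair a b c d g r (M S : R) : a <= b -> c <= d ->
  cmeasurable g -> cmeasurable r -> 0 <= M -> 0 <= S ->
  (forall w, cabs (g w) <= M) -> (forall w, ~~ inQ a b c d w -> g w = 0) ->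
  (forall w, inQ a b c d w -> cabs (r w) <= S) ->
  cintegrable (pair_integrand g r) /\
  cabs (Lambda r g) <= M * S * ((b - a) * (d - c)).
Proof.
move=> ab cd mg mr M0 S0 gM gQ rS.
pose one z : R := if inQ a b c d z then 1 else 0.
have mone : rmeasurable one.
  by apply: rmeasurable_if; [exact: measurable_inQ|exact: rmeasurable_cst|exact: rmeasurable_cst].
have one0 z : 0 <= one z by rewrite /one; case: ifP.
have MS0 : 0 <= M * S by exact: mulr_ge0.
have bd w : cabs (pair_integrand g r w) <= M * S * one w.
  rewrite /pair_integrand !cabsM cabs_conj cabs_real ger0_norm ?expR_ge0//.
  rewrite /one; case: ifP => [wQ|/negbT wQ]; last by rewrite (gQ _ wQ) cabs0 !mul0r mulr0.
  apply: ler_pM; rewrite ?expR_ge0 ?mulr_ge0 ?cabs_ge0//; last exact: gauss2_le1.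
  by apply: ler_pM; rewrite ?cabs_ge0// rS.
have iE : area_int (fun w => (M * S * one w)%:E) = (M * S * ((b - a) * (d - c)))%:E.
  transitivity (area_int (fun w => ((M * S)%:E * (one w)%:E)%E)) => //.
  by rewrite area_intZl ?area_int_inQ//; exact: rmeas_emeas.
have mp := cmeasurable_pair mg mr.
have mb : rmeasurable (fun w => M * S * one w).
  by apply: rmeasurableM => //; exact: rmeasurable_cst.
have ip : cintegrable (pair_integrand g r).
  by apply: (le_cintegrable mp mb bd); rewrite iE ltry.
split=> //; rewrite /Lambda cabsM cabs_real ger0_norm ?divr_ge0 ?pi_ge0//.
have h : cabs (cint (pair_integrand g r)) <= M * S * ((b - a) * (d - c)).
  rewrite -lee_fin -iE; apply: (le_trans (cabs_cint ip)).
  apply: le_area_int => [||z|z].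
  - exact: rmeas_emeas (rmeasurable_cabs mp).
  - exact: rmeas_emeas.
  - by rewrite lee_fin cabs_ge0.
  - by rewrite lee_fin.
apply: le_trans h; rewrite ler_piMl ?cabs_ge0//.
by rewrite ler_pdivrMr ?pi_gt0// mul1r pi_ge2.
Qed.

Lemma pair_addl f g r z : pair_integrand (fun z => f z + g z) r z =
  pair_integrand f r z + pair_integrand g r z.
Proof. by rewrite /pair_integrand !mulrDl. Qed.

Lemma pair_scalel (k : C) f r z : pair_integrand (fun z => k * f z) r z =
  k * pair_integrand f r z.
Proof. by rewrite /pair_integrand !mulrA. Qed.

Lemma pair_subr g r r' z : pair_integrand g (fun w => r w - r' w) z =
  pair_integrand g r z - pair_integrand g r' z.
Proof. by rewrite /pair_integrand rmorphB/= mulrBr mulrBl. Qed.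

Lemma pair_scaler (k : C) g r z : pair_integrand g (fun w => k * r w) z =
  conjc k * pair_integrand g r z.
Proof. by rewrite /pair_integrand rmorphM/=; ring. Qed.

Lemma Lambda_addl h f g : cintegrable (pair_integrand f h) ->
  cintegrable (pair_integrand g h) ->
  Lambda h (fun z => f z + g z) = Lambda h f + Lambda h g.
Proof.
move=> fi gi; rewrite /Lambda -mulrDr -cintD//; congr (_ * _); congr cint.
by apply/funext => z; exact: pair_addl.
Qed.

Lemma Lambda_scalel h (k : C) f : cintegrable (pair_integrand f h) ->
  Lambda h (fun z => k * f z) = k * Lambda h f.
Proof.
move=> fi; rewrite /Lambda mulrCA -(cintZ k fi); congr (_ * _); congr cint.
by apply/funext => z; exact: pair_scalel.
Qed.

Lemma Lambda_subr g r r' : cintegrable (pair_integrand g r) ->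
  cintegrable (pair_integrand g r') ->
  Lambda (fun w => r w - r' w) g = Lambda r g - Lambda r' g.
Proof.
move=> ri ri'; rewrite /Lambda -mulrBr -cintB//; congr (_ * _); congr cint.
by apply/funext => z; exact: pair_subr.
Qed.

Lemma Lambda_scaler g (k : C) r : cintegrable (pair_integrand g r) ->
  Lambda (fun w => k * r w) g = conjc k * Lambda r g.
Proof.
move=> fi; rewrite /Lambda mulrCA -(cintZ (conjc k) fi); congr (_ * _); congr cint.
by apply/funext => z; exact: pair_scaler.
Qed.

Lemma cintegrable_scaler g (k : C) r : cintegrable (pair_integrand g r) ->
  cintegrable (pair_integrand g (fun w => k * r w)).
Proof.
move=> fi; rewrite (_ : pair_integrand g _ = fun z => conjc k * pair_integrand g r z).
  exact: cintegrableZ.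
by apply/funext => z; exact: pair_scaler.
Qed.

Definition bounded_support g := cmeasurable g /\ exists M rho : R,
  [/\ 0 <= M, 0 <= rho, forall w, cabs (g w) <= M &
      forall w, ~~ inQ (- rho) rho (- rho) rho w -> g w = 0].

Lemma inQ_mono (a a' : R) w : a <= a' -> inQ (- a) a (- a) a w -> inQ (- a') a' (- a') a' w.
Proof. by move=> aa; rewrite /inQ => /andP[/andP[? ?] /andP[? ?]]; apply/andP; split; apply/andP; split; lra. Qed.

Lemma inQ_cabs (a : R) w : inQ (- a) a (- a) a w -> cabs w <= 2 * a.
Proof.
rewrite /inQ => /andP[/andP[h1 h2] /andP[h3 h4]]; apply: (le_trans (cabs_le _)).
have k1 : `|Re w| <= a by rewrite ler_norml; apply/andP; split; lra.
have k2 : `|Im w| <= a by rewrite ler_norml; apply/andP; split; lra.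
lra.
Qed.

Lemma bounded_support_rect a b c d g : bounded_support g ->
  bounded_support (fun z => if inQ a b c d z then g z else 0).
Proof.
move=> [m1 [M1 [r1 [M10 r10 h1 k1]]]]; split.
  by apply: cmeasurable_if => //; [exact: measurable_inQ|exact: cmeasurable_cst].
exists M1, r1; split=> // w; first by case: ifP; rewrite ?cabs0.
by move=> nQ; rewrite k1// if_same.
Qed.

Lemma cintegrable_bounded_support g r : bounded_support g -> entire r ->
  cintegrable (pair_integrand g r).
Proof.
move=> [mg [M [rho [M0 rho0 gM gQ]]]] er.
have [S HS] := entire_bounded (2 * rho + 1) er.
have nr : - rho <= rho by lra.
have [|//] := @rect_pair (- rho) rho (- rho) rho g r M `|S| nr nr mg (entire_cmeasurable er)
  M0 (normr_ge0 _) gM gQ.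
move=> w /inQ_cabs wr; apply: le_trans (ler_norm S); apply: HS; lra.
Qed.

(** The kernel depends on conj z, but enters the pairing conjugated. The derivative is the pairing
    with 2 w K_z(w), and bounded support makes the remainder O(|d|^2). *)
Lemma fproj_entire g : bounded_support g -> entire (fproj g).
Proof.
move=> bg; have [mg [M [rho [M0 rho0 gM gQ]]]] := bg.
have nr : - rho <= rho by lra.
apply/entireP => z; pose h1 w : C := 2 * w * fock_kernel z w.
have eh1 : entire h1.
  have e2 : entire (fun w : C => 2 * w) := entireZ (c := 2) (@entire_id R).
  exact: (entireM e2 (entire_kernel (w := z))).
exists (Lambda h1 g) => e e0.
(* T |d|^2 is the bound of [rect_pair] for the Taylor remainder on the support, where |w| <= 2
   rho. *)
pose T := M * (32 * expR ((2 * cabs z + 3) * (2 * rho))) * ((rho - - rho) * (rho - - rho)).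
have T0 : 0 <= T by rewrite !mulr_ge0 ?expR_ge0//; lra.
exists (Num.min 1 (e / (T + 1))); first by rewrite lt_min ltr01 divr_gt0// ltr_wpDl.
move=> d; rewrite lt_min => /andP[d1 dT].
have d0 := cabs_ge0 d.
have ik w : cintegrable (pair_integrand g (fock_kernel w)).
  exact: cintegrable_bounded_support bg (entire_kernel (w := w)).
have i1 : cintegrable (pair_integrand g (fun w => conjc d * h1 w)).
  exact: cintegrable_scaler (cintegrable_bounded_support bg eh1).
have i2 : cintegrable (pair_integrand g (fun w => fock_kernel (z + d) w - fock_kernel z w)).
  rewrite (_ : pair_integrand g _ = fun u => pair_integrand g (fock_kernel (z + d)) u -
    pair_integrand g (fock_kernel z) u); first exact: cintegrableB.
  by apply/funext => u; exact: pair_subr.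
have -> : fproj g (z + d) - fproj g z - d * Lambda h1 g =
    Lambda (fun w => fock_kernel (z + d) w - fock_kernel z w - conjc d * h1 w) g.
  rewrite (Lambda_subr i2 i1) (Lambda_subr (ik _) (ik _)).
  by rewrite Lambda_scaler ?conjcK//; exact: cintegrable_bounded_support bg eh1.
pose S := 32 * cabs d ^+ 2 * expR ((2 * cabs z + 3) * (2 * rho)).
have S0 : 0 <= S by rewrite !mulr_ge0 ?sqr_ge0 ?expR_ge0.
have mr : cmeasurable (fun w => fock_kernel (z + d) w - fock_kernel z w - conjc d * h1 w).
  rewrite (_ : (fun w => _) = fun w => (fock_kernel (z + d) w + (-1) * fock_kernel z w) +
     (- conjc d) * h1 w); last by apply/funext => w; rewrite mulN1r mulNr.
  apply: cmeasurableD; last exact: cmeasurableZ (entire_cmeasurable eh1).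
  apply: cmeasurableD; first exact: cmeasurable_kernel.
  exact: cmeasurableZ (cmeasurable_kernel z).
have [|_ hL] := rect_pair nr nr mg mr M0 S0 gM gQ.
  move=> w /inQ_cabs wr; apply: (le_trans (kernel_taylor2 z w (ltW d1))).
  rewrite /S ler_wpM2l ?mulr_ge0 ?sqr_ge0// ler_expR ler_wpM2l//.
  by rewrite addr_ge0// mulr_ge0// cabs_ge0.
apply: (le_trans hL).
have -> : M * S * ((rho - - rho) * (rho - - rho)) = T * cabs d * cabs d by rewrite /S /T; ring.
rewrite ler_wpM2r//; have : (T + 1) * cabs d <= e by rewrite mulrC -ler_pdivlMr ?ltr_wpDl// ltW.
by apply: le_trans; rewrite ler_wpM2r// lerDl.
Qed.

Lemma bounded_support_inL (q : C -> R) g : rmeasurable q -> (forall z, 1 <= q z) ->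
  bounded_support g -> inL q g.
Proof.
move=> mq q1 [mg [M [rho [M0 rho0 gM gQ]]]].
have [N N0 HN] := growth_Lnorm mq q1 0.
have [|//] := HN M g M0 mg.
by move=> z; rewrite mul0r expR0 mulr1.
Qed.

End RectSupport.

(** * Representation of bounded functionals *)

Section Functional.
Context {R : realType}.
Local Notation C := R[i].
Local Notation Re := complex.Re.
Local Notation Im := complex.Im.
Implicit Types (z w : C) (f g h r : C -> C).

Variable q : C -> R.
Hypotheses (mq : rmeasurable q) (q1 : forall z, 1 <= q z).
Variable K : R.
Hypothesis K0 : 0 < K.
Hypothesis projK : forall g, inL q g -> cmeasurable (fproj g) ->
  inL q (fproj g) /\ Lnorm_var q (fproj g) <= K * Lnorm_var q g.
Variable L : (C -> C) -> C.
Variable A : R.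
Hypothesis A0 : 0 <= A.
Hypothesis LD : forall f g, inFock q f -> inFock q g -> L (fun z => f z + g z) = L f + L g.
Hypothesis LZ : forall (a : C) f, inFock q f -> L (fun z => a * f z) = a * L f.
Hypothesis LA : forall f, inFock q f -> cabs (L f) <= A * Lnorm_var q f.

Lemma inFockD f g : inFock q f -> inFock q g -> inFock q (fun z => f z + g z).
Proof. by move=> [ef Lf] [eg Lg]; split; [exact: (entireD ef eg)|exact: (inLD mq q1 Lf Lg)]. Qed.

Lemma inFockZ (a : C) f : inFock q f -> inFock q (fun z => a * f z).
Proof. by move=> [ef Lf]; split; [exact: (entireZ ef)|exact: (inLZ mq q1 a Lf)]. Qed.

Lemma inFockB f g : inFock q f -> inFock q g -> inFock q (fun z => f z - g z).
Proof.
move=> Ff Fg; rewrite (_ : (fun z => _) = fun z => f z + -1 * g z).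
  exact: (inFockD Ff (inFockZ (-1) Fg)).
by apply/funext => z; rewrite mulN1r.
Qed.

Lemma functionalB f g : inFock q f -> inFock q g -> L (fun z => f z - g z) = L f - L g.
Proof.
move=> Ff Fg; rewrite (_ : (fun z => _) = fun z => f z + -1 * g z).
  by rewrite (LD Ff (inFockZ (-1) Fg)) (LZ _ Fg) mulN1r.
by apply/funext => z; rewrite mulN1r.
Qed.

(** Lets L act on error terms known through pointwise bounds: a small M yields a small value of
    L. *)
Lemma functional_growth (B : R) : exists2 N : R, 0 <= N & forall (M : R) f, 0 <= M ->
  entire f -> (forall z, cabs (f z) <= M * expR (B * cabs z)) ->
  inFock q f /\ cabs (L f) <= M * N.
Proof.
have [N N0 HN] := growth_Lnorm mq q1 B; exists (A * N).
  by rewrite mulr_ge0// ltW.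
move=> M f M0 ef fM; have [Lf Nf] := HN M f M0 (entire_cmeasurable ef) fM.
have Ff : inFock q f by split.
split=> //; apply: (le_trans (LA Ff)); rewrite mulrCA.
by apply: ler_wpM2l.
Qed.

Lemma inFock_growth (B M : R) f : 0 <= M -> entire f ->
  (forall z, cabs (f z) <= M * expR (B * cabs z)) -> inFock q f.
Proof. by move=> M0 ef fM; have [N N0 HN] := functional_growth B; have [] := HN M f M0 ef fM. Qed.

Lemma inFock_kernel w : inFock q (fock_kernel w).
Proof.
apply: (inFock_growth (B := 2 * cabs w) ler01 (entire_kernel (w := w))) => z.
by rewrite mul1r cabs_kernel_le.
Qed.

Definition repr w : C := conjc (L (fock_kernel w)).

Lemma repr_lipschitz w : exists2 N : R, 0 <= N &
  forall d, cabs d <= 2 -> cabs (repr (w + d) - repr w) <= cabs d * N.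
Proof.
have [N N0 HN] := functional_growth (2 * cabs w + 5); exists (6 * N); first exact: mulr_ge0.
move=> d d2; rewrite /repr -rmorphB/= cabs_conj -functionalB; [|exact: inFock_kernel..].
have d0 : 0 <= 6 * cabs d by rewrite mulr_ge0 ?cabs_ge0.
have ed : entire (fun z => fock_kernel (w + d) z - fock_kernel w z).
  rewrite (_ : (fun z => _) = fun z => fock_kernel (w + d) z + -1 * fock_kernel w z).
    exact: (entireD (entire_kernel (w := w + d)) (entireZ (entire_kernel (w := w)))).
  by apply/funext => z; rewrite mulN1r.
have [_] := HN _ _ d0 ed (fun z => kernel_taylor1 w z d2).
by move/le_trans; apply; rewrite mulrCA mulrA.
Qed.

(** L is applied to the Taylor expansion of K_w in w, whose remainder stays O(|d|^2) under L by
    [functional_growth]. The conjugate in [repr] makes the result holomorphic, with derivative conj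
    (L h1). *)
Lemma repr_entire : entire repr.
Proof.
apply/entireP => w; pose h1 z : C := 2 * z * fock_kernel w z.
have eh1 : entire h1.
  have e2 : entire (fun w : C => 2 * w) := entireZ (c := 2) (@entire_id R).
  exact: (entireM e2 (entire_kernel (w := w))).
have Fh1 : inFock q h1.
  apply: (@inFock_growth (1 + 2 * cabs w) 2 h1 (ler0n _ 2) eh1) => z.
  rewrite /h1 !cabsM (_ : cabs (2 : C) = 2); last first.
    by rewrite -[2]/(2%:R)%R -(rmorph_nat (real_complex R)) cabs_real ger0_norm.
  rewrite -mulrA ler_pM2l// mulrDl mul1r expRD; apply: ler_pM; rewrite ?cabs_ge0 ?cabs_kernel_le//.
  have := expR_ge1Dx (cabs z); lra.
have [N N0 HN] := functional_growth (2 * cabs w + 3).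
exists (conjc (L h1)) => e e0.
have N320 : 0 < 32 * N + 1 by rewrite ltr_wpDl// mulr_ge0.
exists (Num.min 1 (e / (32 * N + 1))); first by rewrite lt_min ltr01 divr_gt0.
move=> d; rewrite lt_min => /andP[d1 dN]; have d0 := cabs_ge0 d.
have Fd := inFock_kernel (w + d); have Fw := inFock_kernel w.
have -> : repr (w + d) - repr w - d * conjc (L h1) =
    conjc (L (fun z => fock_kernel (w + d) z - fock_kernel w z - conjc d * h1 z)).
  rewrite (functionalB (inFockB Fd Fw) (inFockZ (conjc d) Fh1)) (functionalB Fd Fw) (LZ _ Fh1).
  by rewrite !rmorphB/= rmorphM/= conjcK.
rewrite cabs_conj.
have M0 : 0 <= 32 * cabs d ^+ 2 by rewrite mulr_ge0// sqr_ge0.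
have [ed _] := inFockB (inFockB Fd Fw) (inFockZ (conjc d) Fh1).
have [_ hL] := HN _ _ M0 ed (fun z => kernel_taylor2 w z (ltW d1)).
apply: (le_trans hL).
have -> : 32 * cabs d ^+ 2 * N = 32 * N * cabs d * cabs d by ring.
rewrite ler_wpM2r//; have : (32 * N + 1) * cabs d <= e by rewrite mulrC -ler_pdivlMr// ltW.
by apply: le_trans; rewrite ler_wpM2r// lerDl.
Qed.

Lemma inFock_fproj g : bounded_support g -> inFock q (fproj g).
Proof.
move=> bg; have ep := fproj_entire bg; split => //.
by have [] := projK (bounded_support_inL mq q1 bg) (entire_cmeasurable ep).
Qed.

Lemma fprojD f g : bounded_support f -> bounded_support g ->
  fproj (fun z => f z + g z) = (fun z => fproj f z + fproj g z).
Proof.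
move=> bf bg; apply/funext => z; apply: Lambda_addl;
  by apply: cintegrable_bounded_support => //; exact: (entire_kernel (w := z)).
Qed.

Definition rect_part g a b c d z : C := if inQ a b c d z then g z else 0.

Definition rect_defect g a b c d : C :=
  L (fproj (rect_part g a b c d)) - Lambda repr (rect_part g a b c d).

Lemma bounded_support_part g a b c d : bounded_support g ->
  bounded_support (rect_part g a b c d).
Proof. exact: bounded_support_rect. Qed.

Lemma rect_defectD g f1 f2 : bounded_support f1 -> bounded_support f2 ->
  (forall z, g z = f1 z + f2 z) ->
  L (fproj g) - Lambda repr g =
  (L (fproj f1) - Lambda repr f1) + (L (fproj f2) - Lambda repr f2).
Proof.
move=> b1 b2 e; have -> : g = (fun z => f1 z + f2 z) by apply/funext.
rewrite fprojD// LD; [|exact: inFock_fproj..].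
rewrite Lambda_addl; [|exact: (cintegrable_bounded_support b1 repr_entire)|
  exact: (cintegrable_bounded_support b2 repr_entire)].
by rewrite opprD addrACA.
Qed.

Lemma rect_defect_add g a b c d : bounded_support g -> a <= b -> c <= d ->
  rect_defect g a b c d =
  rect_defect g a ((a + b) / 2) c ((c + d) / 2) + rect_defect g ((a + b) / 2) b c ((c + d) / 2) +
  rect_defect g a ((a + b) / 2) ((c + d) / 2) d + rect_defect g ((a + b) / 2) b ((c + d) / 2) d.
Proof.
move=> bg ab cd; set m := (a + b) / 2; set n := (c + d) / 2.
have am : a <= m by rewrite /m; lra.
have mb : m <= b by rewrite /m; lra.
have cn : c <= n by rewrite /n; lra.
have nd : n <= d by rewrite /n; lra.
have bp x y u v := bounded_support_part x y u v bg.
have split_h x y u v t : x <= t -> t <= y -> forall z,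
    rect_part g x y u v z = rect_part g x t u v z + rect_part g t y u v z.
  move=> xt ty z; rewrite /rect_part /inQ; have [zt|tz] := ltP (Re z) t.
    by rewrite (lt_le_trans zt ty) !andbT/= addr0.
  by rewrite (le_trans xt tz) andbF/= add0r.
have split_v x y u v t : u <= t -> t <= v -> forall z,
    rect_part g x y u v z = rect_part g x y u t z + rect_part g x y t v z.
  move=> ut tv z; rewrite /rect_part /inQ; have [zt|tz] := ltP (Im z) t.
    by rewrite (lt_le_trans zt tv) !andbT/= andbF addr0.
  by rewrite (le_trans ut tz) !andbF/= add0r.
have Dh x y u v t (xt : x <= t) (ty : t <= y) : rect_defect g x y u v =
    rect_defect g x t u v + rect_defect g t y u v.
  exact: rect_defectD (bp _ _ _ _) (bp _ _ _ _) (split_h x y u v t xt ty).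
have Dv x y u v t (ut : u <= t) (tv : t <= v) : rect_defect g x y u v =
    rect_defect g x y u t + rect_defect g x y t v.
  exact: rect_defectD (bp _ _ _ _) (bp _ _ _ _) (split_v x y u v t ut tv).
by rewrite (Dv a b c d n cn nd) (Dh a b c n m am mb) (Dh a b n d m am mb) addrA.
Qed.

(** Let w0 = x + iy, s the half-perimeter and kappa the pairing of the piece G with 1. Both L(P G)
    and the pairing of G with [repr] differ from kappa L(K_w0) by O(s^3): the kernel and [repr] vary
    by O(s) over the rectangle, whose area is at most s^2. *)
Lemma rect_defect_small g x y (e : R) : bounded_support g -> 0 < e ->
  exists2 r : R, 0 < r & forall a b c d, a <= x <= b -> c <= y <= d ->
    b - a < r -> d - c < r -> cabs (rect_defect g a b c d) <= e * (b - a + (d - c)) ^+ 2.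
Proof.
move=> bg e0; have [mg [M [rho [M0 rho0 gM gQ]]]] := bg.
pose w0 := cplx (x, y).
have [N N0 HN] := functional_growth (2 * cabs w0 + 5).
have [N' N'0 HN'] := repr_lipschitz w0.
pose T := 6 * M * N + M * N'; have T0 : 0 <= T by rewrite addr_ge0 ?mulr_ge0.
have T10 : 0 < T + 1 by rewrite ltr_wpDl.
(* Side lengths below 1 give s <= 2, the range of [kernel_taylor1]; the second bound gives s (T + 1)
   <= e. *)
exists (Num.min 1 (e / (T + 1) / 2)); first by rewrite lt_min ltr01 !divr_gt0.
move=> a b c d xab ycd; rewrite !lt_min => /andP[ab1 abe] /andP[cd1 cde].
have ab : a <= b by move/andP: xab => [? ?]; lra.
have cd : c <= d by move/andP: ycd => [? ?]; lra.
set s := b - a + (d - c).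
have s0 : 0 <= s by rewrite /s; lra.
have s2 : s <= 2 by rewrite /s; lra.
have sT : s * (T + 1) <= e.
  by rewrite -ler_pdivlMr// /s; lra.
have area_s : (b - a) * (d - c) <= s ^+ 2.
  have : 0 <= (b - a) * (d - c) by rewrite mulr_ge0// subr_ge0.
  have := sqr_ge0 (b - a); have := sqr_ge0 (d - c); rewrite /s sqrrD -mulr_natl; lra.
have inQs w : inQ a b c d w -> cabs (w - w0) <= s.
  move=> /andP[/andP[h1 h2] /andP[h3 h4]]; move/andP: xab => [h5 h6]; move/andP: ycd => [h7 h8].
  rewrite (le_trans (cabs_le _))// !cE/= /s; apply: lerD; rewrite ler_norml; apply/andP; split; lra.
pose G := rect_part g a b c d.
have bG : bounded_support G := bounded_support_part a b c d bg.
have mG : cmeasurable G by case: bG.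
have GM w : cabs (G w) <= M by rewrite /G /rect_part; case: ifP => _ //; rewrite cabs0.
have GQ w : ~~ inQ a b c d w -> G w = 0 by rewrite /G /rect_part => /negbTE ->.
have e1 : entire (fun _ : C => 1 : C) by exact: entire_cst.
have i1 : cintegrable (pair_integrand G (fun=> 1)) := cintegrable_bounded_support bG e1.
pose kappa := Lambda (fun=> 1) G.
have FG := inFock_fproj bG; have Fw0 := inFock_kernel w0.
have Lf1 : cabs (L (fun z => fproj G z - kappa * fock_kernel w0 z)) <= M * (6 * s) * s ^+ 2 * N.
  have [ed _] := inFockB FG (inFockZ kappa Fw0).
  have M'0 : 0 <= M * (6 * s) * s ^+ 2 by rewrite !mulr_ge0 ?sqr_ge0.
  have [|//] := HN (M * (6 * s) * s ^+ 2) _ M'0 ed.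
  move=> z; have iz := cintegrable_bounded_support bG (entire_kernel (w := z)).
  have ic := cintegrable_scaler (conjc (fock_kernel w0 z)) i1.
  have -> : fproj G z - kappa * fock_kernel w0 z =
      Lambda (fun w => fock_kernel z w - conjc (fock_kernel w0 z) * 1) G.
    by rewrite (Lambda_subr iz ic) (Lambda_scaler _ i1) conjcK mulrC.
  have S0 : 0 <= 6 * s * expR ((2 * cabs w0 + 5) * cabs z) by rewrite !mulr_ge0 ?expR_ge0.
  have mr : cmeasurable (fun w => fock_kernel z w - conjc (fock_kernel w0 z) * 1).
    rewrite (_ : (fun w => _) = fun w => fock_kernel z w + - (conjc (fock_kernel w0 z))).
      by apply: cmeasurableD; [exact: cmeasurable_kernel|exact: cmeasurable_cst].
    by apply/funext => w; rewrite mulr1.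
  have [|_ h] := rect_pair ab cd mG mr M0 S0 GM GQ.
    move=> w wQ; have ds := inQs w wQ.
    (* K_z(w) = conj K_w(z) turns variation of the argument w into variation of the parameter, which
       the Taylor bound covers. *)
    have -> : fock_kernel z w - conjc (fock_kernel w0 z) * 1 =
        conjc (fock_kernel (w0 + (w - w0)) z - fock_kernel w0 z).
      rewrite mulr1 rmorphB/= (addrC w0) subrK; congr (_ - _).
      rewrite /fock_kernel cexp_conj; congr cexp; clear -z w.
      by case: z w => [x1 y1] [x2 y2]; apply: complex_ext; rewrite !cE/=; ring.
    rewrite cabs_conj; apply: (le_trans (kernel_taylor1 _ _ (le_trans ds s2))).
    by rewrite ler_wpM2r ?expR_ge0// ler_pM2l.
  apply: (le_trans h); rewrite -!mulrA ler_wpM2l// ler_pM2l// ler_wpM2l//.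
  by rewrite [leRHS]mulrA (mulrC (s * s)) -expr2 ler_wpM2l ?expR_ge0.
have Lf2 : cabs (Lambda repr G - kappa * L (fock_kernel w0)) <= M * (s * N') * s ^+ 2.
  have ir := cintegrable_bounded_support bG repr_entire.
  have ic := cintegrable_scaler (repr w0) i1.
  have -> : Lambda repr G - kappa * L (fock_kernel w0) =
      Lambda (fun w => repr w - repr w0 * 1) G.
    by rewrite (Lambda_subr ir ic) (Lambda_scaler _ i1) /repr conjcK mulrC.
  have S0 : 0 <= s * N' by rewrite mulr_ge0.
  have mr : cmeasurable (fun w => repr w - repr w0 * 1).
    rewrite (_ : (fun w => _) = fun w => repr w + - repr w0).
      by apply: cmeasurableD; [exact: (entire_cmeasurable repr_entire)|exact: cmeasurable_cst].
    by apply/funext => w; rewrite mulr1.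
  have [|_ h] := rect_pair ab cd mG mr M0 S0 GM GQ.
    move=> w wQ; have ds := inQs w wQ.
    have := HN' (w - w0) (le_trans ds s2); rewrite (addrC w0) subrK mulr1 => /le_trans; apply.
    by rewrite ler_wpM2r.
  by apply: (le_trans h); rewrite ler_wpM2l// mulr_ge0.
have -> : rect_defect g a b c d = L (fun z => fproj G z - kappa * fock_kernel w0 z) -
    (Lambda repr G - kappa * L (fock_kernel w0)).
  by rewrite (functionalB FG (inFockZ kappa Fw0)) (LZ _ Fw0) /rect_defect -/G; ring.
apply: (le_trans (cabsB _ _)); apply: (le_trans (lerD Lf1 Lf2)).
have -> : M * (6 * s) * s ^+ 2 * N + M * (s * N') * s ^+ 2 = (s * T) * s ^+ 2 by rewrite /T; ring.
rewrite ler_wpM2r ?sqr_ge0//; apply: le_trans sT; rewrite ler_wpM2l// lerDl//.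
Qed.

Lemma functional_fproj g : bounded_support g -> L (fproj g) = Lambda repr g.
Proof.
move=> bg; have [mg [M [rho [M0 rho0 gM gQ]]]] := bg.
have nr : - rho <= rho by lra.
have := @rect_additive_eq0 R (rect_defect g) (fun a b c d ab cd => rect_defect_add bg ab cd)
  (fun x y e e0 => rect_defect_small x y bg e0) _ _ _ _ nr nr.
rewrite /rect_defect (_ : rect_part g _ _ _ _ = g).
  by move=> /eqP; rewrite subr_eq0 => /eqP.
by apply/funext => z; rewrite /rect_part; case: ifP => // /negbT /gQ.
Qed.

End Functional.

(** * The dual norm estimate *)

Section DualNorm.
Context {R : realType}.
Local Notation C := R[i].
Local Notation Re := complex.Re.
Local Notation Im := complex.Im.
Implicit Types (z w : C) (f g h r : C -> C).

(** Monotone convergence, used to pass from modulars on squares to the modular on the plane. *)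
Lemma area_int_exhaust (G : C -> R) (b : nat -> C -> bool) (M : \bar R) :
  rmeasurable G -> (forall z, 0 <= G z) ->
  (forall n, measurable_fun setT (fun x : R2 R => b n (cplx x))) ->
  (forall z m n, (m <= n)%N -> b m z -> b n z) ->
  (forall z, exists n, b n z) ->
  (forall n, (area_int (fun z => (if b n z then G z else 0)%:E) <= M)%E) ->
  (area_int (fun z => (G z)%:E) <= M)%E.
Proof.
move=> mG G0 mb bS bz bM.
pose f_ n (x : R2 R) : \bar R := (if b n (cplx x) then G (cplx x) else 0)%:E.
have mf_ n : measurable_fun setT (f_ n).
  apply: (@rmeas_emeas _ (fun z => if b n z then G z else 0)).
  by apply: rmeasurable_if => //; exact: rmeasurable_cst.
have f0 n x : setT x -> (0 <= f_ n x)%E by move=> _; rewrite /f_ lee_fin; case: ifP.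
have nd x : setT x -> {homo f_ ^~ x : n m / (n <= m)%N >-> (n <= m)%E}.
  move=> _ m n mn; rewrite /f_ lee_fin; case: ifP => [/(bS _ _ _ mn) ->//|_].
  by case: ifP.
have lim x : limn (f_ ^~ x) = (G (cplx x))%:E.
  apply/cvg_lim => //; have [N HN] := bz (cplx x).
  by apply: cvg_near_cst; exists N => // n /= Nn; rewrite /f_ (bS _ _ _ Nn HN).
have := @cvg_monotone_convergence _ _ R area setT measurableT f_ mf_ f0 nd.
have -> : area_int (fun z => (G z)%:E) = (\int[area]_(x in setT) limn (f_ ^~ x))%E.
  by rewrite area_intE; apply: eq_integral => x _; rewrite lim.
move=> cv; apply: (cvge_le _ cv); apply: nearW => n.
by have := bM n; rewrite area_intE.
Qed.

Lemma Re_Lambda_ge0 f h (k : C -> R) : rmeasurable k -> (forall z, 0 <= k z) ->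
  cintegrable (pair_integrand f h) -> (forall z, Re (pair_integrand f h z) = k z) ->
  (area_int (fun z => (k z)%:E) <= (pi / 2 * cabs (Lambda h f))%:E)%E.
Proof.
move=> mk k0 ifh E.
have -> : area_int (fun z => (k z)%:E) = (Re (cint (pair_integrand f h)))%:E.
  have [/integrableP[_ i1] _] := ifh.
  rewrite /cint/= /Rintegral fineK.
    by rewrite area_intE; apply: eq_integral => x _; rewrite E.
  rewrite ge0_fin_numE.
    move: i1; congr (_ < _)%E; apply: eq_integral => x _.
    by rewrite /= E ger0_norm.
  by apply: integral_ge0 => x _; rewrite E lee_fin.
rewrite lee_fin /Lambda cabsM cabs_real ger0_norm ?divr_ge0 ?pi_ge0// mulrA.
have -> : pi / 2 * (2 / pi) = 1 :> R.
  by rewrite mulrA divfK ?pnatr_eq0// mulfV// gt_eqF// pi_gt0.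
by rewrite mul1r; apply: le_trans (Re_le _); exact: ler_norm.
Qed.

Section dual.
Variables p q : C -> R.
Hypotheses (mp : rmeasurable p) (mq : rmeasurable q).
Hypotheses (p1 : forall z, 1 <= p z) (q1 : forall z, 1 < q z).
Hypothesis pq : forall z, (p z)^-1 + (q z)^-1 = 1.
Variable b : R.
Hypothesis qb : forall z, q z <= b.
Variable h : C -> C.
Hypothesis eh : entire h.
Variables lam B : R.
Hypotheses (lam0 : 0 < lam) (B0 : 0 <= B) (Blam : pi / 2 * B < lam).
Hypothesis hB : forall g, bounded_support g -> cabs (Lambda h g) <= B * Lnorm_var p g.

Local Notation u := (fun z => fw h z / lam).
Local Notation box n := (inQ (- n%:R) n%:R (- n%:R) (n%:R : R)).

(* The extremal function of Hoelder's inequality, (h/|h|) e^(|z|^2) u^(q-1) with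
   u = fw h / lam.  At the zeros of h the junk value of the coefficient is
   multiplied by 0. *)
Definition dual_coef z : R :=
  expR (cabs z ^+ 2 + (q z - 1) * ln (fw h z / lam) - ln (cabs (h z))).

Definition dual_test n z : C := if box n z then (dual_coef z)%:C%C * h z else 0.

Lemma rmeasurable_fw_div : rmeasurable u.
Proof. by apply: rmeasurableM; [exact: rmeasurable_fw (entire_cmeasurable eh)|exact: rmeasurable_cst]. Qed.

Lemma fw_div_ge0 z : 0 <= u z. Proof. by rewrite divr_ge0 ?fw_ge0// ltW. Qed.

Lemma cabs_dual_coef z : dual_coef z * cabs (h z) = expR (cabs z ^+ 2) * u z `^ (q z - 1).
Proof.
have q10 : q z - 1 != 0 by rewrite gt_eqF// subr_gt0.
have [hz|hz] := eqVneq (h z) 0.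
  by rewrite /fw hz cabs0 !mul0r powR0// !mulr0.
have u0 : u z != 0.
  by rewrite /fw gt_eqF// divr_gt0// mulr_gt0 ?expR_gt0// cabs_gt0.
rewrite /dual_coef !expRD expRN lnK ?posrE ?cabs_gt0// /powR (negbTE u0).
by rewrite mulfVK// gt_eqF// cabs_gt0.
Qed.

Lemma cabs_dual_test n z : cabs (dual_test n z) =
  if box n z then expR (cabs z ^+ 2) * u z `^ (q z - 1) else 0.
Proof.
rewrite /dual_test; case: ifP => _; last exact: cabs0.
by rewrite cabsM cabs_real ger0_norm ?expR_ge0// cabs_dual_coef.
Qed.

Lemma fw_dual_test n z : fw (dual_test n) z = if box n z then u z `^ (q z - 1) else 0.
Proof.
rewrite /fw cabs_dual_test; case: ifP => _; last by rewrite mul0r.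
by rewrite mulrAC -expRD subrr expR0 mul1r.
Qed.

(** Since p and q are conjugate, (q - 1) p = q. *)
Lemma vmod_dual_test n :
  vmod p (fw (dual_test n)) = area_int (fun z => (if box n z then u z `^ q z else 0)%:E).
Proof.
rewrite /vmod; congr area_int; apply/funext => z; rewrite fw_dual_test.
have p0 : p z != 0 by rewrite gt_eqF// (lt_le_trans ltr01).
have q0 : q z != 0 by rewrite gt_eqF// (lt_trans ltr01).
case: ifP => _; last by rewrite powR0.
rewrite -powRrM; congr (_ `^ _)%:E.
have : ((p z)^-1 + (q z)^-1) * (p z * q z) = q z + p z by field; rewrite p0 q0.
by rewrite pq mul1r => h1; lra.
Qed.

Lemma cmeasurable_dual_test n : cmeasurable (dual_test n).
Proof.
apply: cmeasurable_if; [exact: measurable_inQ| |exact: cmeasurable_cst].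
have mh := entire_cmeasurable eh.
apply: cmeasurableM => //; apply: cmeasurable_real; apply: rmeasurable_expR.
apply: rmeasurableB; last exact: (rmeasurable_comp (@measurable_ln R)) (rmeasurable_cabs mh).
apply: rmeasurableD; first exact: rmeasurableX rmeasurable_cabs_id.
apply: rmeasurableM; first by apply: rmeasurableB => //; exact: rmeasurable_cst.
exact: (rmeasurable_comp (@measurable_ln R)) rmeasurable_fw_div.
Qed.

Lemma bounded_support_dual_test n : bounded_support (dual_test n).
Proof.
split; first exact: cmeasurable_dual_test.
have [M HM] := entire_bounded (2 * n%:R + 1) eh.
(* On the box |z| <= 2n. Adding 1 to the base makes the power increasing in the exponent, so that
   the bound b of q can replace q - 1. *)
pose T := expR ((2 * n%:R) ^+ 2) * (1 + `|M| / lam) `^ b.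
have T0 : 0 <= T by rewrite mulr_ge0 ?expR_ge0// powR_ge0.
exists T, n%:R; split => //; last by move=> w /negbTE nw; rewrite /dual_test nw.
move=> z; rewrite cabs_dual_test; case: ifP => // /inQ_cabs zn.
apply: ler_pM; rewrite ?expR_ge0 ?powR_ge0//.
  by rewrite ler_expR ler_pXn2r ?nnegrE ?cabs_ge0 ?mulr_ge0.
have q10 : 0 <= q z - 1 by rewrite subr_ge0 ltW.
have X1 : 1 <= 1 + `|M| / lam by rewrite lerDl divr_ge0// ltW.
apply: (@le_trans _ _ ((1 + `|M| / lam) `^ (q z - 1))).
  apply: le_powR q10; first exact: fw_div_ge0.
  rewrite ler_wpDl// ler_pM2r ?invr_gt0//.
  apply: (@le_trans _ _ (cabs (h z))); last first.
    by apply: le_trans (ler_norm M); apply: HM; move: zn; lra.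
  by rewrite /fw ler_piMr ?cabs_ge0// -expR0 ler_expR oppr_le0 sqr_ge0.
apply: ler_powR => //; have := qb z; lra.
Qed.

(** The test function has the phase of h, so the pairing has a nonnegative density; the factor |h|
    supplies the missing power of u, up to lam. *)
Lemma Re_pair_dual_test n z : Re (pair_integrand (dual_test n) h z) =
  lam * (if box n z then u z `^ q z else 0).
Proof.
rewrite /pair_integrand /dual_test; case: ifP => _; last by rewrite !mul0r mulr0.
rewrite -[_ * h z * _]mulrA mulC_conj -!rmorphM/=.
have -> : dual_coef z * cabs (h z) ^+ 2 * expR (- (2 * cabs z ^+ 2)) =
  (dual_coef z * cabs (h z)) * expR (- cabs z ^+ 2) * fw h z.
  have -> : - (2 * cabs z ^+ 2) = - cabs z ^+ 2 + - cabs z ^+ 2 by ring.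
  by rewrite expRD /fw; ring.
rewrite cabs_dual_coef [X in _ * X = _](_ : fw h z = lam * u z); last by field; rewrite gt_eqF.
rewrite (mulrAC (expR _)) -expRD subrr expR0 mul1r mulrCA; congr (_ * _).
rewrite [LHS]mulrC mulr_powRB1 ?fw_div_ge0//; exact: lt_trans ltr01 (q1 z).
Qed.

(** Let r be the modular of u on a box. If r > 1, the test function has norm at most r by
    [vmod_scale], so lam r <= (pi/2) B r, against [Blam]. Hence r <= 1 on every box. *)
Lemma dual_modular : (vmod q (fun z => (fw h z / lam)%R) <= 1)%E.
Proof.
have q1' z : 1 <= q z by rewrite ltW.
have mk : rmeasurable (fun z => u z `^ q z) := rmeasurable_powR mq rmeasurable_fw_div q1' fw_div_ge0.
have mkn n : rmeasurable (fun z => if box n z then u z `^ q z else 0).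
  by apply: rmeasurable_if => //; [exact: measurable_inQ|exact: rmeasurable_cst].
have kn0 n z : 0 <= (if box n z then u z `^ q z else 0) by case: ifP => // _; exact: powR_ge0.
rewrite /vmod; apply: (@area_int_exhaust (fun z => u z `^ q z) (fun n z => box n z)) => //.
- by move=> z; exact: powR_ge0.
- by move=> n; exact: measurable_inQ.
- by move=> z m n mn; apply: inQ_mono; rewrite ler_nat.
- move=> z; exists (Num.truncn (cabs z)).+1.
  have := truncnS_gt (cabs z); have := Re_le z; have := Im_le z.
  rewrite /inQ !ler_norml => /andP[? ?] /andP[? ?] ?; apply/andP; split; apply/andP; split; lra.
move=> n; set rho := area_int _.
have bg := bounded_support_dual_test n.
have ig := cintegrable_bounded_support bg eh.
have mlk : rmeasurable (fun z => lam * (if box n z then u z `^ q z else 0)).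
  by apply: rmeasurableM => //; exact: rmeasurable_cst.
have lk0 z : 0 <= lam * (if box n z then u z `^ q z else 0) by rewrite mulr_ge0 ?(ltW lam0).
have := Re_Lambda_ge0 mlk lk0 ig (Re_pair_dual_test n).
under [X in (area_int X <= _)%E -> _]eq_fun do rewrite EFinM.
rewrite (area_intZl (ltW lam0) (rmeas_emeas (mkn n))) -/rho; last first.
  by move=> z; rewrite lee_fin.
have : (0 <= rho)%E by apply: area_int_ge0 => z; rewrite lee_fin.
have Erho : vmod p (fw (dual_test n)) = rho := vmod_dual_test n.
(* Finiteness of the pairing rules out an infinite modular. *)
case: rho Erho => [r| |]// Erho; last by rewrite gt0_muley ?lte_fin.
rewrite -EFinM !lee_fin => r0 hr; rewrite leNgt; apply/negP => r1.
have rp : 0 < r by exact: lt_trans r1.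
have mt := cmeasurable_dual_test n.
have Nr : Lnorm_var p (dual_test n) <= r.
  apply: Lnorm_le => //; apply: vmod_scale => //; [exact: rmeasurable_fw|exact: fw_ge0|exact: ltW|].
  by rewrite Erho.
have : lam * r <= pi / 2 * B * r.
  apply: (le_trans hr); rewrite -[leRHS]mulrA ler_wpM2l ?divr_ge0 ?pi_ge0//.
  by apply: (le_trans (hB bg)); rewrite ler_wpM2l.
by rewrite ler_pM2r// leNgt Blam.
Qed.

End dual.
End DualNorm.

(** * Truncation to squares and the operator norm *)

Section Duality.
Context {R : realType}.
Local Notation C := R[i].
Local Notation Re := complex.Re.
Local Notation Im := complex.Im.
Implicit Types (z w : C) (f g h r : C -> C).
Local Notation box n := (inQ (- n%:R) n%:R (- n%:R) (n%:R : R)).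

Lemma box_exhaust z : exists N, forall n, (N <= n)%N -> box n z.
Proof.
exists (Num.truncn (cabs z)).+1 => n; rewrite -(ler_nat R).
have := truncnS_gt (cabs z); have := Re_le z; have := Im_le z.
rewrite /inQ !ler_norml => /andP[? ?] /andP[? ?] ? ?; apply/andP; split; apply/andP; split; lra.
Qed.

Section truncation.
Variables (q : C -> R) (b : R).
Hypotheses (mq : rmeasurable q) (q1 : forall z, 1 <= q z) (qb : forall z, q z <= b).

(** Changing the scale multiplies the integrand by (l/e)^q, at most (1 + l/e)^b: a bounded exponent
    makes the modular finite at every scale. *)
Lemma vmod_lt_pinfty_div f (l e : R) : cmeasurable f -> 0 < l -> 0 < e ->
  (vmod q (fun z => (fw f z / l)%R) <= 1)%E -> (vmod q (fun z => (fw f z / e)%R) < +oo)%E.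
Proof.
move=> mf l0 e0 vl; pose T := (1 + l / e) `^ b.
have T0 : 0 <= T by exact: powR_ge0.
have mX (c : R) : 0 < c -> rmeasurable (fun z => (fw f z / c) `^ q z).
  move=> c0; apply: rmeasurable_powR => //.
    by apply: rmeasurableM; [exact: rmeasurable_fw|exact: rmeasurable_cst].
  by move=> z; rewrite divr_ge0 ?fw_ge0// ltW.
have Y0 z : (0 <= ((fw f z / l) `^ q z)%:E)%E by rewrite lee_fin powR_ge0.
apply: (@le_lt_trans _ _ (T%:E * vmod q (fun z => (fw f z / l)%R))%E); last first.
  by apply: (@le_lt_trans _ _ (T%:E * 1)%E); [rewrite lee_wpmul2l|rewrite mule1 ltry].
rewrite /vmod -(area_intZl T0 (rmeas_emeas (mX l l0)) Y0).
apply: le_area_int.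
- exact: rmeas_emeas (mX e e0).
- under eq_fun do rewrite -EFinM; apply: rmeas_emeas; apply: rmeasurableM; last exact: mX.
  exact: rmeasurable_cst.
- by move=> z; rewrite lee_fin powR_ge0.
move=> z; rewrite -EFinM lee_fin.
have -> : fw f z / e = (l / e) * (fw f z / l) by field; rewrite !gt_eqF.
have le0 : 0 <= l / e by rewrite divr_ge0 ?ltW.
rewrite powRM ?divr_ge0 ?fw_ge0 ?(ltW l0) ?(ltW e0)// ler_wpM2r ?powR_ge0//.
have q0 : 0 <= q z by exact: le_trans (q1 z).
apply: (@le_trans _ _ ((1 + l / e) `^ q z)); first by apply: le_powR => //; lra.
by apply: ler_powR => //; rewrite lerDl.
Qed.

Definition outer_part f n z : C := if box n z then 0 else f z.

Lemma cmeasurable_outer f n : cmeasurable f -> cmeasurable (outer_part f n).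
Proof.
by move=> mf; apply: cmeasurable_if => //; [exact: measurable_inQ|exact: cmeasurable_cst].
Qed.

(** The modular at scale e is finite, so its tail falls below 1, and then the outer part has norm at
    most e: truncations are dense. *)
Lemma outer_part_small f (e : R) : inL q f -> 0 < e ->
  exists n, inL q (outer_part f n) /\ Lnorm_var q (outer_part f n) <= e.
Proof.
move=> /(inLP mq q1)[mf [l l0 vl]] e0.
have fin := vmod_lt_pinfty_div mf l0 e0 vl.
pose G z := (fw f z / e) `^ q z.
have mG : rmeasurable G.
  apply: rmeasurable_powR => //.
    by apply: rmeasurableM; [exact: rmeasurable_fw|exact: rmeasurable_cst].
  by move=> z; rewrite divr_ge0 ?fw_ge0// ltW.
have G0 z : 0 <= G z by exact: powR_ge0.
have [N HN] := area_int_tail mG G0 fin (fun n => measurable_inQ _ _ _ _) box_exhaust ltr01.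
have vN : (vmod q (fun z => (fw (outer_part f N) z / e)%R) <= 1)%E.
  apply: le_trans (HN N (leqnn N)); rewrite le_eqVlt; apply/orP; left; apply/eqP.
  rewrite /vmod; congr area_int; apply/funext => z; rewrite /fw /outer_part.
  case: ifP => // _; rewrite cabs0 !mul0r powR0// gt_eqF//.
  exact: lt_le_trans (q1 z).
exists N; split; last exact: Lnorm_le e0 vN.
by apply/(inLP mq q1); split; [exact: cmeasurable_outer|exists e].
Qed.

End truncation.

Section operator_norm.
Variable q : C -> R.
Hypotheses (mq : rmeasurable q) (q1 : forall z, 1 <= q z).
Variable L : (C -> C) -> C.
Variable A : R.
Hypothesis A0 : 0 <= A.
Hypothesis LZ : forall (a : C) f, inFock q f -> L (fun z => a * f z) = a * L f.
Hypothesis LA : forall f, inFock q f -> cabs (L f) <= A * Lnorm_var q f.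

Let S := [set cabs (L f) | f in [set f | inFock q f /\ Lnorm_var q f <= 1]].

Lemma op_norm_set_ub : ubound S A.
Proof.
move=> _ [f [Ff Nf] <-]; apply: (le_trans (LA Ff)).
by rewrite -[leRHS]mulr1 ler_wpM2l.
Qed.

(** [sup] is meaningful for nonempty bounded sets; the zero function is the witness. *)
Lemma op_norm_set_neq0 : S !=set0.
Proof.
have [N N0 HN] := growth_Lnorm mq q1 0.
have e0 : entire (fun _ : C => 0 : C) by exact: entire_cst.
have [|L0 Nle] := HN 0 (fun=> 0) (lexx 0) (cmeasurable_cst 0).
  by move=> z; rewrite cabs0 mul0r.
exists (cabs (L (fun=> 0))), (fun=> 0) => //; split; first by split.
by apply: (le_trans Nle); rewrite mul0r.
Qed.

Lemma op_norm_le : op_norm (inFock q) (Lnorm_var q) L <= A.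
Proof. by apply: ge_sup; [exact: op_norm_set_neq0|exact: op_norm_set_ub]. Qed.

Lemma op_norm_ge f : inFock q f -> Lnorm_var q f <= 1 ->
  cabs (L f) <= op_norm (inFock q) (Lnorm_var q) L.
Proof. by move=> Ff Nf; apply: ub_le_sup; [exists A; exact: op_norm_set_ub|exists f]. Qed.

Lemma op_norm_ge0 : 0 <= op_norm (inFock q) (Lnorm_var q) L.
Proof.
have [x Sx] := op_norm_set_neq0; have := Sx => -[f [Ff Nf] _].
exact: le_trans (cabs_ge0 _) (op_norm_ge Ff Nf).
Qed.

(** f is rescaled by scales l strictly above its norm, which also covers functions of norm 0. *)
Lemma op_norm_bound f : inFock q f ->
  cabs (L f) <= op_norm (inFock q) (Lnorm_var q) L * Lnorm_var q f.
Proof.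
move=> Ff; rewrite mulrC -[leRHS]mul1r.
apply: (le_mul_limit ltr01 (Lnorm_ge0 _ _) op_norm_ge0) => l m Nl om.
have l0 : 0 < l by exact: le_lt_trans (Lnorm_ge0 q f) Nl.
have [ef Lf] := Ff; have vl := vmod_gt_Lnorm mq q1 Lf Nl.
pose g z : C := (l^-1)%:C%C * f z.
have Fg : inFock q g by split; [exact: (entireZ ef)|exact: (inLZ mq q1 _ Lf)].
have Ng : Lnorm_var q g <= 1.
  apply: Lnorm_le => //; apply: le_trans vl; rewrite le_eqVlt; apply/orP; left; apply/eqP.
  congr vmod; apply/funext => z; rewrite /fw /g cabsM cabs_real ger0_norm ?invr_ge0 ?(ltW l0)//.
  by rewrite divr1 -mulrA mulrC.
have := op_norm_ge Fg Ng; rewrite (LZ _ Ff) cabsM cabs_real ger0_norm ?invr_ge0 ?(ltW l0)//.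
move=> h; have : cabs (L f) <= l * op_norm (inFock q) (Lnorm_var q) L by rewrite -ler_pdivrMl.
by move/le_trans; apply; rewrite mul1r ler_wpM2l ?(ltW l0) ?(ltW om).
Qed.

End operator_norm.
End Duality.

(** * The duality theorem *)

Section Dual.
Context {R : realType}.
Local Notation C := R[i].
Implicit Types (z w : C) (f g h r : C -> C).
Local Notation box n := (inQ (- n%:R) n%:R (- n%:R) (n%:R : R)).

Variables p q : C -> R.
Hypotheses (mp : rmeasurable p) (mq : rmeasurable q).
Hypotheses (p1 : forall z, 1 <= p z) (q1 : forall z, 1 < q z).
Hypothesis pq : forall z, (p z)^-1 + (q z)^-1 = 1.
Variables b b' : R.
Hypotheses (pb : forall z, p z <= b) (qb : forall z, q z <= b').
Variable K : R.
Hypothesis K0 : 0 < K.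
Hypothesis projK : forall g, inL p g -> cmeasurable (fproj g) ->
  inL p (fproj g) /\ Lnorm_var p (fproj g) <= K * Lnorm_var p g.

Let q1' z : 1 <= q z := ltW (q1 z).

Lemma fproj_id f : inFock p f -> fproj f = f.
Proof.
move=> [ef Lf]; apply/funext => w; apply: reproducing => //.
exact: (cintegrable_pair_kernel mp p1).
Qed.

Lemma bounded_support_inner f n : entire f -> bounded_support (fun z => if box n z then f z else 0).
Proof.
move=> ef; split.
  by apply: cmeasurable_if;
    [exact: measurable_inQ|exact: entire_cmeasurable|exact: cmeasurable_cst].
have [M HM] := entire_bounded (2 * n%:R + 1) ef.
exists `|M|, n%:R; split => //; last by move=> w /negbTE ->.
move=> w; case: ifP => [/inQ_cabs wn|_]; last by rewrite cabs0.
by apply: le_trans (ler_norm M); apply: HM; move: wn; lra.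
Qed.

Lemma Lambda_bounded f h : inL p f -> inL q h ->
  cabs (Lambda h f) <= 4 / pi * Lnorm_var q h * Lnorm_var p f.
Proof.
move=> Lf Lh; have := holder_Lambda mp mq p1 q1' pq Lf Lh.
by rewrite (mulrC (Lnorm_var p f)) mulrA.
Qed.

Section functional.
Variable L : (C -> C) -> C.
Variable A : R.
Hypothesis A0 : 0 <= A.
Hypothesis LD : forall f g, inFock p f -> inFock p g -> L (fun z => f z + g z) = L f + L g.
Hypothesis LZ : forall (a : C) f, inFock p f -> L (fun z => a * f z) = a * L f.
Hypothesis LA : forall f, inFock p f -> cabs (L f) <= A * Lnorm_var p f.

Let er : entire (repr L) := repr_entire mp p1 A0 LD LZ LA.

Lemma cabs_Lambda_repr g : bounded_support g ->
  cabs (Lambda (repr L) g) <= A * K * Lnorm_var p g.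
Proof.
move=> bg; rewrite -(functional_fproj mp p1 projK A0 LD LZ LA bg).
apply: (le_trans (LA (inFock_fproj mp p1 projK bg))); rewrite -mulrA ler_wpM2l//.
by have [] := projK (bounded_support_inL mp p1 bg) (entire_cmeasurable (fproj_entire bg)).
Qed.

(** Every scale above (pi/2) A K is admissible in [dual_modular]: A K bounds the pairing on test
    functions, and pi/2 undoes the factor 2/pi of the pairing. *)
Lemma repr_inFock : inFock q (repr L) /\ Lnorm_var q (repr L) <= pi / 2 * K * A.
Proof.
have AK0 : 0 <= A * K by rewrite mulr_ge0 ?(ltW K0).
have piAK : 0 <= pi / 2 * (A * K) by rewrite mulr_ge0// divr_ge0// pi_ge0.
have dual l : pi / 2 * (A * K) < l -> (vmod q (fun z => (fw (repr L) z / l)%R) <= 1)%E.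
  move=> hl; apply: (dual_modular mp mq p1 q1 pq qb er _ AK0 hl cabs_Lambda_repr).
  exact: le_lt_trans hl.
have l1 : pi / 2 * (A * K) < pi / 2 * (A * K) + 1 by rewrite ltrDl.
split.
  split => //; apply/(inLP mq q1'); split; first exact: entire_cmeasurable.
  exists (pi / 2 * (A * K) + 1); last exact: dual.
  by rewrite ltr_wpDl.
rewrite -mulrA (mulrC K); apply/ler_addgt0Pr => e e0.
apply: Lnorm_le; first by rewrite ltr_wpDl.
by apply: dual; rewrite ltrDl.
Qed.

(** Split f at a large box. On the inner part [functional_fproj] is exact; on the outer part the two
    functionals together are at most N times its norm, which is small. *)
Lemma functional_repr f : inFock p f -> L f = Lambda (repr L) f.
Proof.
move=> Ff; have [ef Lf] := Ff; have [[_ Lr] _] := repr_inFock.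
pose N := A * K + 4 / pi * Lnorm_var q (repr L).
have N0 : 0 <= N.
  apply: addr_ge0; first by rewrite mulr_ge0 ?(ltW K0).
  by apply: mulr_ge0; [rewrite divr_ge0// pi_ge0|exact: Lnorm_ge0].
apply/eqP; rewrite -subr_eq0; apply/eqP; apply: cabs_eps_eq0 => e e0.
have d0 : 0 < e / (N + 1) by rewrite divr_gt0// ltr_wpDl.
have [n [Lo No]] := outer_part_small mp p1 pb Lf d0.
pose fi z := if box n z then f z else 0; pose fo := outer_part f n.
have bi : bounded_support fi := bounded_support_inner n ef.
have Li := bounded_support_inL mp p1 bi.
have fE : f = (fun z => fi z + fo z).
  by apply/funext => z; rewrite /fi /fo /outer_part; case: ifP; rewrite ?addr0 ?add0r.
have Pfi := inFock_fproj mp p1 projK bi.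
(* P fo = f - P fi exhibits [fproj fo] as entire, although fo need not have bounded support; this
   supplies the measurability asked by [projK]. *)
have PoE : fproj fo = (fun z => f z + -1 * fproj fi z).
  apply/funext => z; have <- : fproj f z = f z by rewrite fproj_id.
  have -> : fproj f z = fproj fi z + fproj fo z.
    rewrite -(Lambda_addl (cintegrable_pair_kernel mp p1 z Li) (cintegrable_pair_kernel mp p1 z Lo)).
    by rewrite -fE.
  by rewrite mulN1r addrAC subrr add0r.
have epo : entire (fproj fo).
  rewrite PoE; apply: (entireD ef); apply: entireZ; by case: Pfi.
have [Lpo Npo] := projK Lo (entire_cmeasurable epo).
have Fpo : inFock p (fproj fo) by split.
have LfE : L f = Lambda (repr L) fi + L (fproj fo).
  rewrite -(functional_fproj mp p1 projK A0 LD LZ LA bi) -(LD Pfi Fpo); congr L.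
  by apply/funext => z; rewrite PoE mulN1r addrCA subrr addr0.
have LrE : Lambda (repr L) f = Lambda (repr L) fi + Lambda (repr L) fo.
  rewrite -(Lambda_addl (cintegrable_pair mp mq p1 q1' pq Li Lr)
    (cintegrable_pair mp mq p1 q1' pq Lo Lr)).
  by rewrite -fE.
rewrite LfE LrE opprD addrACA subrr add0r.
apply: (le_trans (cabsB _ _)).
apply: (@le_trans _ _ (N * Lnorm_var p fo)).
  rewrite /N mulrDl; apply: lerD.
    by apply: (le_trans (LA Fpo)); rewrite -mulrA ler_wpM2l.
  exact: Lambda_bounded Lo Lr.
apply: (@le_trans _ _ (N * (e / (N + 1)))); first by rewrite ler_wpM2l.
by rewrite mulrA ler_pdivrMr ?ltr_wpDl// mulrC ler_pM2l// lerDl.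
Qed.

End functional.

(** The pairing is conjugate symmetric, so conj of Lambda_h(K_w) is the pairing of h with K_w, which
    is h(w) by the reproducing property in F^q. *)
Lemma repr_Lambda h : inFock q h -> repr (Lambda h) = h.
Proof.
move=> [eh Lh]; apply/funext => w.
have ik := cintegrable_pair_kernel mq q1' w Lh.
have E : pair_integrand (fock_kernel w) h =
    fun z => conjc (pair_integrand h (fock_kernel w) z).
  apply/funext => z; rewrite /pair_integrand; move: (fock_kernel w z) (h z) => x y.
  by case: x y => [? ?] [? ?]; apply: complex_ext; rewrite !cE/=; ring.
rewrite -[RHS](reproducing eh ik) /repr /Lambda E (cint_conj ik).
by move: (cint _) => x; apply: complex_ext; rewrite !cE/=; ring.
Qed.

End Dual.

Section Main.
Context {R : realType}.
Local Notation C := R[i].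

Lemma Plog_log_decay (p : C -> R) : Plog p ->
  exists s c : R, [/\ 1 <= s, 0 <= c & log_decay p s c].
Proof.
by move=> [_ [_ [_ [_ [s [s1 [c [c0 h]]]]]]]]; exists s, c; split => //; exact: ltW.
Qed.

End Main.

Theorem mainTheorem9 (R : realType) (p : R[i] -> R) :
  Plog p ->
  (* each Lambda_h, h in F^{p'}, is a well-defined bounded linear functional *)
  (forall h : R[i] -> R[i], inFock (conj_exponent p) h ->
     (forall f, inFock p f -> cintegrable (pair_integrand f h)) /\
     bounded_linear_functional (inFock p) (Lnorm_var p) (Lambda h)) /\
  (* every bounded linear functional is some Lambda_h *)
  (forall L : (R[i] -> R[i]) -> R[i],
     bounded_linear_functional (inFock p) (Lnorm_var p) L ->
     exists h, inFock (conj_exponent p) h /\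
       forall f, inFock p f -> L f = Lambda h f) /\
  (* ||Lambda_h|| is comparable to ||h||_{F^{p'}} *)
  (exists c C : R, 0 < c /\ 0 < C /\
     forall h, inFock (conj_exponent p) h ->
       c * Lnorm_var (conj_exponent p) h
         <= op_norm (inFock p) (Lnorm_var p) (Lambda h) /\
       op_norm (inFock p) (Lnorm_var p) (Lambda h)
         <= C * Lnorm_var (conj_exponent p) h).
Proof.
move=> Pp; have [[mp p1] _] := Pp.
have [a a1 ap] := Plog_lower Pp.
have [s [c [s1 c0 ps]]] := Plog_log_decay Pp.
set q := conj_exponent p.
have mq : rmeasurable q := rmeasurable_conj_exponent mp a1 ap.
have q1 : forall z, 1 < q z := conj_exponent_gt1 a1 ap.
have q1' z : 1 <= q z := ltW (q1 z).
have pq : forall z, (p z)^-1 + (q z)^-1 = 1 := conj_exponent_sum a1 ap.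
have pb := log_decay_bounded c0 ps.
(* p' inherits the decay of p, whence the upper bound that keeps the test functions bounded. *)
have [_ c0'] := conj_exponent_conv a1 ap c0 ps.
have qb := log_decay_bounded c0' (conj_exponent_decay a1 ap c0 ps).
have [K K0 projK] := fproj_bounded mp p1 s1 c0 ps.
have Lint h : inFock q h -> forall f, inFock p f -> cintegrable (pair_integrand f h).
  by move=> [_ Lh] f [_ Lf]; exact: (cintegrable_pair mp mq p1 q1' pq Lf Lh).
have LD h : inFock q h -> forall f g, inFock p f -> inFock p g ->
    Lambda h (fun z => f z + g z) = Lambda h f + Lambda h g.
  by move=> Fh f g Ff Fg; exact: (Lambda_addl (Lint h Fh f Ff) (Lint h Fh g Fg)).
have LZ h : inFock q h -> forall (k : R[i]) f, inFock p f ->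
    Lambda h (fun z => k * f z) = k * Lambda h f.
  by move=> Fh k f Ff; exact: (Lambda_scalel k (Lint h Fh f Ff)).
have LB h : inFock q h -> forall f, inFock p f ->
    cabs (Lambda h f) <= 4 / pi * Lnorm_var q h * Lnorm_var p f.
  by move=> [_ Lh] f [_ Lf]; exact: (Lambda_bounded mp mq p1 q1 pq Lf Lh).
split; [|split].
- move=> h Fh; split; first exact: Lint.
  split; first exact: LD.
  by split; [exact: LZ|exists (4 / pi * Lnorm_var q h); exact: LB].
- move=> L [lD [lZ [A lA]]].
  (* The given bound A may be negative; norms being nonnegative, its absolute value is also a
     bound. *)
  have lA' f : inFock p f -> cabs (L f) <= `|A| * Lnorm_var p f.
    move=> Ff; apply: (le_trans (lA f Ff)).
    by apply: ler_wpM2r; [exact: Lnorm_ge0|exact: ler_norm].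
  exists (repr L); split.
    by have [] := repr_inFock mp mq p1 q1 pq qb K0 projK (normr_ge0 A) lD lZ lA'.
  exact: (functional_repr mp mq p1 q1 pq pb qb K0 projK (normr_ge0 A) lD lZ lA').
have piK : 0 < pi / 2 * K by rewrite mulr_gt0// divr_gt0// pi_gt0.
(* The lower constant inverts the bound of [repr_inFock]; 4/pi is 2/pi times the 2 of
   [holder_modular]. *)
exists (pi / 2 * K)^-1, (4 / pi); split; first by rewrite invr_gt0.
split; first by rewrite divr_gt0// pi_gt0.
move=> h Fh; have B0 : 0 <= 4 / pi * Lnorm_var q h.
  by apply: mulr_ge0; [exact: divr_ge0 (ler0n _ 4) (pi_ge0 R)|exact: Lnorm_ge0].
split; last exact: (op_norm_le mp p1 B0 (LB h Fh)).
have ob := op_norm_bound mp p1 B0 (LZ h Fh) (LB h Fh).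
have o0 := op_norm_ge0 mp p1 B0 (LB h Fh).
(* The operator norm itself is taken as the bound A; since [repr] of Lambda_h is h, this bounds the
   norm of h. *)
have [_] := repr_inFock mp mq p1 q1 pq qb K0 projK o0 (LD h Fh) (LZ h Fh) ob.
by rewrite (repr_Lambda mq q1 Fh) ler_pdivrMl.
Qed.
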